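(* For every $p>1$ there exist positive constants $C,c$ depending only on $p$ such that for every potential $V$ in the strip $S=\{(x_1,x_2)\in\mathbb{R}^2:x_1\in\mathbb{R},\ 0<x_2<\pi\}$ $$\mathrm{Neg}(V,S)\le1+C\sum_{\{n\in\mathbb{Z}:\,a_n(V)>c\}}\sqrt{a_n(V)}+C\sum_{\{n\in\mathbb{Z}:\,b_n(V)>c\}}b_n(V),$$ where $$a_n(V)=\int_{S_n}(1+|x_1|)\,V(x)\,dx,\qquad b_n(V)=\Big(\int_{S\cap\{n<x_1<n+1\}}V^p(x)\,dx\Big)^{1/p}.$$
   Context: The rectangles $S_n$, $n\in\mathbb{Z}$, are $S_n=\{x\in S:2^{n-1}<x_1<2^n\}$ for $n>0$, $S_0=\{x\in S:-1<x_1<1\}$, $S_n=\{x\in S:-2^{|n|}<x_1<-2^{|n|-1}\}$ for $n<0$. The quantities $a_n(V),b_n(V)$ and both sides of the inequality may be $+\infty$. A potential in an open set $\Omega\subset\mathbb{R}^2$ is a non-negative function $V\in L^1_{loc}(\Omega)$. For a potential $V$ in $\Omega$ put $$\mathcal{F}_{V,\Omega}=\Big\{f\in L^2_{loc}(\Omega):\ \int_\Omega|\nabla f|^2dx<\infty,\ \int_\Omega Vf^2dx<\infty\Big\}$$ (real-valued functions, $\nabla f$ the distributional gradient) and $\mathcal{E}_{V,\Omega}(f)=\int_\Omega|\nabla f|^2dx-\int_\Omega Vf^2dx$. Then $\mathrm{Neg}(V,\Omega)\in\{0,1,2,\dots,\infty\}$ is the supremum of $\dim\mathcal{V}$ over all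 linear subspaces $\mathcal{V}$ of $\mathcal{F}_{V,\Omega}$ such that $\mathcal{E}_{V,\Omega}(f)\le0$ for all $f\in\mathcal{V}$. *)

(* Defs.v *)
From HB Require Import structures.
From mathcomp Require Import all_boot all_order all_algebra.
From mathcomp Require Import all_classical all_reals all_analysis.

Set Implicit Arguments.
Unset Strict Implicit.
Unset Printing Implicit Defensive.

Import Order.TTheory GRing.Theory Num.Theory.
Import numFieldNormedType.Exports.

Local Open Scope classical_set_scope.
Local Open Scope ring_scope.

Definition leb2 (R : realType) :
    {measure set (measurableTypeR R * measurableTypeR R) -> \bar R} :=
  (@lebesgue_measure R \x @lebesgue_measure R)%E.

Definition e1 (R : realType) : R * R := (1, 0).
Definition e2 (R : realType) : R * R := (0, 1).

Section Sobolev.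
Context (R : realType).
Implicit Types (Omega : set (R * R)) (f g phi V : R * R -> R).

Fixpoint Ck (k : nat) phi : Prop :=
  if k is k'.+1 then
    [/\ continuous phi,
        forall x, derivable phi x (e1 R), forall x, derivable phi x (e2 R),
        Ck k' ('D_(e1 R) phi) & Ck k' ('D_(e2 R) phi)]
  else continuous phi.

Definition test_function Omega phi : Prop :=
  [/\ forall k, Ck k phi,
      compact (closure [set x | phi x != 0]) &
      closure [set x | phi x != 0] `<=` Omega].

Definition L1loc Omega f : Prop :=
  measurable_fun Omega f /\
  forall K : set (R * R), compact K -> K `<=` Omega ->
    (\int[leb2 R]_(x in K) `|f x|%:E < +oo)%E.

Definition L2loc Omega f : Prop :=
  measurable_fun Omega f /\
  forall K : set (R * R), compact K -> K `<=` Omega ->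
    (\int[leb2 R]_(x in K) (f x ^+ 2)%:E < +oo)%E.

Definition weak_derivative Omega (v : R * R) f g : Prop :=
  L1loc Omega g /\
  forall phi, test_function Omega phi ->
    \int[leb2 R]_(x in Omega) (f x * 'D_v phi x) =
    - \int[leb2 R]_(x in Omega) (g x * phi x).

Definition is_weak_grad Omega f (G : (R * R -> R) * (R * R -> R)) : Prop :=
  weak_derivative Omega (e1 R) f G.1 /\ weak_derivative Omega (e2 R) f G.2.

(* Some representative of the distributional gradient, which is unique up to
   a null set when it exists as a pair of locally integrable functions; a junk
   value otherwise. *)
Definition wgrad Omega f : (R * R -> R) * (R * R -> R) :=
  xget (cst 0, cst 0) [set G | is_weak_grad Omega f G].

Definition dirichlet Omega f : \bar R :=
  (\int[leb2 R]_(x in Omega)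
     ((wgrad Omega f).1 x ^+ 2 + (wgrad Omega f).2 x ^+ 2)%:E)%E.

Definition potential_energy V Omega f : \bar R :=
  (\int[leb2 R]_(x in Omega) (V x * f x ^+ 2)%:E)%E.

Definition potential Omega V : Prop :=
  (forall x, Omega x -> 0 <= V x) /\ L1loc Omega V.

(* A distributional gradient with finite Dirichlet integral is in particular a
   locally integrable function, hence the requirement [is_weak_grad]. *)
Definition form_domain V Omega : set (R * R -> R) :=
  [set f | [/\ L2loc Omega f, is_weak_grad Omega f (wgrad Omega f),
               (dirichlet Omega f < +oo)%E &
               (potential_energy V Omega f < +oo)%E]].

Definition energy V Omega f : \bar R :=
  (dirichlet Omega f - potential_energy V Omega f)%E.

Definition linear_subspace (W : set (R * R -> R)) : Prop :=
  W (cst 0) /\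
  forall (a : R) f g, W f -> W g -> W (fun x => a * f x + g x).

(* Functions are identified when they agree almost everywhere on Omega, so
   independence and dimension are those of the classes. *)
Definition ae_free Omega (n : nat) (f : 'I_n -> R * R -> R) : Prop :=
  forall c : 'I_n -> R,
    {ae leb2 R, forall x, Omega x -> \sum_(i < n) c i * f i x = 0} ->
    forall i, c i = 0.

Definition ae_dim Omega (W : set (R * R -> R)) : \bar R :=
  ereal_sup [set (n%:R)%:E | n in
    [set n : nat | exists f : 'I_n -> R * R -> R,
       (forall i, W (f i)) /\ ae_free Omega f]].

Definition Neg V Omega : \bar R :=
  ereal_sup [set ae_dim Omega W | W in
    [set W : set (R * R -> R) |
       [/\ linear_subspace W, W `<=` form_domain V Omega &
           forall f, W f -> (energy V Omega f <= 0)%E]]].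

Definition strip : set (R * R) := [set x | 0 < x.2 < pi].

Definition rectangle (n : int) : set (R * R) :=
  strip `&` [set x |
    if 0 < n then 2 ^+ `|n|.-1 < x.1 < 2 ^+ `|n|
    else if n == 0 then -1 < x.1 < 1
    else - 2 ^+ `|n| < x.1 < - 2 ^+ `|n|.-1].

Definition a_ V (n : int) : \bar R :=
  (\int[leb2 R]_(x in rectangle n) ((1 + `|x.1|) * V x)%:E)%E.

Definition b_ (p : R) V (n : int) : \bar R :=
  ((\int[leb2 R]_(x in strip `&` [set x | n%:~R < x.1 < (n + 1)%:~R]%R)
      (V x `^ p)%:E) `^ p^-1)%E.

End Sobolev.

(* Main.v *)
Require Import Defs.
From HB Require Import structures.
From mathcomp Require Import all_boot all_order all_algebra.
From mathcomp Require Import all_classical all_reals all_analysis measurable_realfun.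
From mathcomp Require Import ring lra.

Set Implicit Arguments.
Unset Strict Implicit.
Unset Printing Implicit Defensive.

Import Order.TTheory GRing.Theory Num.Theory.
Import numFieldNormedType.Exports.

Local Open Scope classical_set_scope.
Local Open Scope ring_scope.

(** Fix [f] on the strip with finite Dirichlet integral [D(f)].  The only
fact about its gradient that the argument needs compares averages over boxes:
if a box [P] is cut in two across direction [i], the averages of [f] over the
two pieces differ by at most the square root of
[len i P / len (~~ i) P * int_P |grad f|^2].  It comes from testing the weak
derivative against a tent function across the cut times a plateau along it
([cut_ineq]), and it holds up to the boundary of the strip because [f] is
square integrable there ([strip_int], [strip_ctrl]).

Halve a box [Q] repeatedly and let [E_k f] be the average of [f] over the box
of generation [k] around the current point.  Then [(E_(k+1) f - E_k f)^2] is a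
quarter of the squared jump across the halving, so on a box [P] its integral
against [V] is at most [len i P / len (~~ i) P * int_P V] times the energy of
[f] on [P].  If that factor is at most [eps * tau ^ j] with [tau < 1] whenever
the jump is not zero, summing over generations gives
[int_Q (E_D f - E_0 f)^2 V <= C * eps * int_Q |grad f|^2] ([tree_energy]).
The boxes with a larger factor are few ([selection]), and requiring the jump to
vanish on each of them is one linear condition on [f].  This is used twice.

- On the block carrying [a_n], halved horizontally down to unit cells, both the
  width and the mass of [V] shrink with the generation.  Killing all jumps of
  the first [K] generations costs [2 ^ K - 1] conditions, the remaining costly
  boxes number about [a_n / 2 ^ K], and [2 ^ K] of order [sqrt a_n] balances
  the two ([select_line]).
- On a unit cell, halved alternately in the two directions, the aspect ratios
  stay bounded, and a bound on the [L^p] norm with [p > 1] forces the mass of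
  small boxes to decay geometrically apart from [O(b_n)] boxes
  ([select_cell]).  Here [E_k f] tends to [f] almost everywhere
  ([Ecell_cvg]), so the deviation of [f] itself from its average is bounded.

Both lists are empty when [a_n] and [b_n] are small.  What remains are the
averages of [f] over the blocks.  They are required to vanish on the central
block and on every block with [a_n > c]; the other averages are bounded by a
discrete Hardy inequality, because the squared difference of neighbouring
averages is at most a constant times the energy on the two blocks times their
width ([hardy]).

Altogether at most [1 + C sum sqrt a_n + C sum b_n] linear conditions imply
[int V f^2 <= D(f) / 2] ([strip_energy]).  If moreover [D(f) <= int V f^2] then
[D(f) = 0], so [f] is constant by the Poincare inequality, and it is zero
because its average over the central block is zero ([null_energy_eq0]).  A
space of larger dimension than the number of conditions would contain a
nonzero function satisfying them all ([common_kernel]). *)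

(** * Smooth functions of one variable *)

Section Smooth.
Context {R : realType}.
Implicit Types (u v : R -> R).

(** Witnessing the derivative existentially, instead of iterating an operator,
makes the closure properties plain inductions on [k]. *)
Fixpoint smooth_upto (k : nat) u : Prop :=
  if k is k'.+1 then
    exists2 u' : R -> R, (forall x : R, is_derive x 1 u (u' x)) & smooth_upto k' u'
  else True.

Definition smooth u := forall k, smooth_upto k u.

Lemma smooth_uptoW k u : smooth_upto k.+1 u -> smooth_upto k u.
Proof.
elim: k u => // k IH u [u' du su']; exists u' => //; exact: IH.
Qed.

Lemma smooth_uptoD k u v :
  smooth_upto k u -> smooth_upto k v -> smooth_upto k (fun x => u x + v x).
Proof.
elim: k u v => // k IH u v [u' du su] [v' dv sv].
exists (fun x => u' x + v' x); last exact: IH.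
by move=> x; apply: is_deriveD.
Qed.

Lemma smooth_uptoM k u v :
  smooth_upto k u -> smooth_upto k v -> smooth_upto k (fun x => u x * v x).
Proof.
elim: k u v => // k IH u v su sv.
have su1 := smooth_uptoW su; have sv1 := smooth_uptoW sv.
move: su sv => [u' du su] [v' dv sv].
exists (fun x => u x * v' x + v x * u' x).
  by move=> x; exact: (is_deriveM (du x) (dv x)).
by apply: smooth_uptoD; apply: IH.
Qed.

Lemma smooth_upto_cst k (c : R) : smooth_upto k (fun=> c).
Proof.
elim: k c => // k IH c; exists (fun=> 0) => // x; exact: is_derive_cst.
Qed.

Lemma smooth_upto_affine k (a b : R) : smooth_upto k (fun x => a * x + b).
Proof.
case: k => // k; exists (fun=> a); last exact: smooth_upto_cst.
move=> x.
have := is_deriveD (is_deriveM (is_derive_cst a x 1) (is_derive_id x (1 : R)))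
  (is_derive_cst b x 1).
by rewrite /GRing.scale /= mulr1 mulr0 !addr0.
Qed.

Lemma smooth_upto_comp k u v :
  smooth_upto k u -> smooth_upto k v -> smooth_upto k (fun x => u (v x)).
Proof.
elim: k u v => // k IH u v su sv.
have sv1 := smooth_uptoW sv.
move: su sv => [u' du su] [v' dv sv].
exists (fun x => u' (v x) * v' x); last by apply: smooth_uptoM => //; exact: IH.
by move=> x; apply: is_derive1_comp.
Qed.

Lemma smooth_derive u : smooth u ->
  (forall x : R, is_derive x 1 u ((derive1 u) x)) /\ smooth (derive1 u).
Proof.
move=> su; have du (x : R) : is_derive x 1 u ((derive1 u) x).
  by have [u' du _] := su 1%N; rewrite derive1E; have [? ->] := du x; exact: du.
split=> // k; have [u' du' su'] := su k.+1.
suff -> : (derive1 u) = u' by [].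
apply/funext => x; rewrite derive1E; by have [_ ->] := du' x.
Qed.

(** The functions [x^-n * exp (-1/x)] are closed under differentiation up to
linear combinations, which is how [exp (-1/x)] is seen to be smooth at 0. *)
Definition flat (n : nat) (x : R) : R :=
  if 0 < x then x ^- n * expR (- x^-1) else 0.

(** One term of the exponential series, [expR (x^-1)] being at least
[x^-(n+1) / (n+1)!]. *)
Lemma flat_le n (x : R) : 0 < x -> flat n x <= (n.+1)`!%:R * x.
Proof.
move=> x0; rewrite /flat x0 expRN.
have y0 : 0 < x^-1 by rewrite invr_gt0.
have := expR_ge1Dxn n (ltW y0); set e := expR _ => He.
have {}He : x ^- n.+1 / (n.+1)`!%:R <= e.
  by apply: le_trans He; rewrite exprVn lerDr.
have f0 : (0 : R) < (n.+1)`!%:R by rewrite ltr0n fact_gt0.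
have xn0 : 0 < x ^+ n by rewrite exprn_gt0.
have e0 : 0 < e by exact: expR_gt0.
rewrite ler_pdivrMr //.
have -> : x ^- n = (n.+1)`!%:R * x * (x ^- n.+1 / (n.+1)`!%:R).
  by rewrite exprSr; field; rewrite !gt_eqF.
by rewrite ler_pM2l // mulr_gt0.
Qed.

Lemma flat_ge0 n (x : R) : 0 <= flat n x.
Proof.
rewrite /flat; case: ifP => // x0.
by rewrite mulr_ge0 ?expR_ge0 // invr_ge0 exprn_ge0 // ltW.
Qed.

Lemma flat_le0 n (x : R) : x <= 0 -> flat n x = 0.
Proof. by rewrite /flat leNgt => /negbTE ->. Qed.

Lemma cvg_flat0 n : flat n x @[x --> (0 : R)] --> (0 : R).
Proof.
apply: (@squeeze_cvgr _ _ _ _ (fun=> 0) (fun x : R => (n.+1)`!%:R * `|x|)).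
- near=> x; rewrite flat_ge0 /=.
  have [x0|x0] := leP x 0; first by rewrite flat_le0 // mulr_ge0.
  by rewrite gtr0_norm // flat_le.
- exact: cvg_cst.
- rewrite -[X in _ --> X](mulr0 ((n.+1)`!%:R : R)); apply: cvgMr.
  by rewrite -[X in _ --> X](normr0 R); exact: norm_continuous.
Unshelve. all: by end_near. Qed.

(** At 0 the difference quotient of [flat n] is [flat n.+1] itself, so
continuity of the latter gives the derivative. *)
Lemma is_derive_flat n (x : R) :
  is_derive x 1 (flat n) (flat n.+2 x - n%:R * flat n.+1 x).
Proof.
have [x0|x0|->] := ltgtP x 0.
- have -> : flat n.+2 x - n%:R * flat n.+1 x = 0.
    by rewrite !flat_le0 ?(ltW x0) // mulr0 subr0.
  apply: (@near_eq_is_derive _ _ _ (fun=> 0)).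
  + by near=> y; rewrite flat_le0 //; near: y; exact: lt_le_nbhsl.
- apply: (@near_eq_is_derive _ _ _ (fun y : R => y^-1 ^+ n * expR (- y^-1))).
  + by near=> y; rewrite /flat ifT ?exprVn //; near: y; exact: lt_nbhsr.
  have xn0 : x != 0 by rewrite gt_eqF.
  have dV : is_derive x 1 (fun y : R => y^-1) (- x ^- 2).
    have := @is_deriveV _ id x 1 1 xn0 (is_derive_id x (1 : R)).
    by rewrite /GRing.scale /= mulr1.
  have dX := is_deriveX n dV.
  rewrite exprfctE in dX.
  have dE := is_derive1_comp (is_derive_expR _) (is_deriveN dV).
  have D := is_deriveM dX dE.
  apply: (is_derive_eq D).
  rewrite /flat x0 /GRing.scale /=.
  rewrite /(- _)%R /= -!exprVn; set y := x^-1; set e := expR _.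
  case: n {dX D} => [|n] /=; first by ring.
  by rewrite !exprS; ring.
- apply/is_derive1_caratheodory; exists (flat n.+1); split.
  + move=> z; rewrite (@flat_le0 _ 0) // !subr0.
    have [z0|z0] := leP z 0; first by rewrite !flat_le0 // mul0r.
    rewrite /flat z0 exprS; field.
    by rewrite expf_neq0 gt_eqF.
  + by rewrite /prop_for /continuous_at [flat n.+1 0]flat_le0 //; exact: cvg_flat0.
  + by rewrite !flat_le0 // mulr0 subr0.
Unshelve. all: by end_near. Qed.

Lemma smooth_flat n : smooth (flat n).
Proof.
move=> k; elim: k n => // k IH n.
exists (fun x => flat n.+2 x + (- n%:R) * flat n.+1 x).
  by move=> x; rewrite mulNr; exact: is_derive_flat.
by apply: smooth_uptoD => //; apply: smooth_uptoM => //; exact: smooth_upto_cst.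
Qed.

(** With [h x = exp (-1/x)] for positive [x] and [c = h 1], the function
[1 - h (c - h x) / h c] is a smooth step from 0 to 1 on [[0, 1]]; multiply it
by [x]. *)
Lemma smooth_relu : exists P : R -> R, [/\ smooth P,
  forall x, x <= 0 -> P x = 0 & forall x, 1 <= x -> P x = x].
Proof.
pose h := flat 0; pose c := h 1.
have c0 : 0 < c by rewrite /c /h /flat ltr01 expr0 invr1 mul1r expR_gt0.
have hc0 : 0 < h c by rewrite /h /flat c0 expr0 invr1 mul1r expR_gt0.
exists (fun x => (1 * x + 0) * (1 + (- (h c)^-1) * h (-1 * h x + c))); split.
- move=> k.
  apply: smooth_uptoM; first exact: smooth_upto_affine.
  apply: smooth_uptoD; first exact: smooth_upto_cst.
  apply: smooth_uptoM; first exact: smooth_upto_cst.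
  apply: smooth_upto_comp; first exact: smooth_flat.
  apply: (@smooth_upto_comp _ (fun x => -1 * x + c)); first exact: smooth_upto_affine.
  exact: smooth_flat.
- move=> x x0; rewrite [h x]flat_le0 // mulr0 add0r mulNr mulVf ?gt_eqF //.
  by rewrite subrr mulr0.
- move=> x x1; rewrite [h (_ + _)]flat_le0; first by rewrite mulr0 !addr0 mulr1 mul1r.
  have x0 : 0 < x by exact: lt_le_trans x1.
  rewrite mulN1r addrC subr_le0 /c /h /flat ltr01 x0 !expr0 invr1 !mul1r.
  by rewrite ler_expR lerN2 invf_le1.
Qed.

End Smooth.

(** * Boxes and their dyadic subdivision *)

(** Directions are booleans, [false] being horizontal, so that [~~ i] is the
other direction. *)
Definition crd (T : Type) (i : bool) (x : T * T) : T := if i then x.2 else x.1.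

Section Box.
Context {R : realType}.
Notation mu := (leb2 R).
Notation T2 := (measurableTypeR R * measurableTypeR R)%type.

Definition box : Type := ((R * R) * (R * R))%type.
Implicit Types (Q P : box) (x : R * R) (i s : bool) (m : R).

(** Half-open boxes: a box is then the disjoint union of the two boxes
obtained by cutting it. *)
Definition bset Q : set T2 := `]Q.1.1, Q.1.2] `*` `]Q.2.1, Q.2.2].
Definition len i Q : R := (crd i Q).2 - (crd i Q).1.
Definition area Q : R := len false Q * len true Q.
Definition wf Q : bool := (Q.1.1 < Q.1.2) && (Q.2.1 < Q.2.2).
Definition cut i m s Q : box :=
  let J := if s then (m, (crd i Q).2) else ((crd i Q).1, m) in
  if i then (Q.1, J) else (J, Q.2).
Definition mid i Q : R := ((crd i Q).1 + (crd i Q).2) / 2.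
Definition halve i s Q : box := cut i (mid i Q) s Q.

Lemma bsetE Q x :
  bset Q x = ((Q.1.1 < x.1 <= Q.1.2) && (Q.2.1 < x.2 <= Q.2.2)) :> Prop.
Proof.
rewrite /bset /setX /= !in_itv /=; apply/propext; split; first by case=> -> ->.
by case/andP.
Qed.

Lemma measurable_bset Q : measurable (bset Q).
Proof. by apply: measurableX; exact: measurable_itv. Qed.

Lemma mu_bset Q : wf Q -> mu (bset Q) = (area Q)%:E.
Proof.
have mu_itv (a b : R) : a < b ->
    lebesgue_measure (`]a, b]%classic : set R) = (b - a)%:E.
  by move=> ab; rewrite lebesgue_measure_itv /= lte_fin ab.
case/andP => h1 h2.
rewrite [LHS]product_measure1E; try exact: measurable_itv.
by rewrite EFinM; congr (_ * _)%E; exact: mu_itv.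
Qed.

Lemma len_gt0 i Q : wf Q -> 0 < len i Q.
Proof. by case/andP => ? ?; case: i; rewrite subr_gt0. Qed.

Lemma area_gt0 Q : wf Q -> 0 < area Q.
Proof. by move=> wQ; rewrite mulr_gt0 ?len_gt0. Qed.

Lemma areaE i Q : area Q = len i Q * len (~~ i) Q.
Proof. by case: i => //=; rewrite /area mulrC. Qed.

Lemma bset_cut i m Q : (crd i Q).1 <= m <= (crd i Q).2 ->
  bset Q = bset (cut i m false Q) `|` bset (cut i m true Q).
Proof.
case: Q => [[a b] [c d]]; case/andP => h1 h2.
apply/seteqP; split => x; rewrite /setU /= !bsetE /=; case: i h1 h2 => /= h1 h2.
- by move=> /andP[-> /andP[-> ->]] /=; rewrite andbT; case: leP => _; [left|right].
- by move=> /andP[/andP[-> ->] ->] /=; rewrite !andbT; case: leP => _; [left|right].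
- move=> [|] /andP[-> /andP[h3 h4]] /=; apply/andP; split=> //.
    exact: le_trans h2.
  exact: le_lt_trans h1 h3.
- move=> [|] /andP[/andP[h3 h4] ->] /=; rewrite andbT; apply/andP; split=> //.
    exact: le_trans h2.
  exact: le_lt_trans h1 h3.
Qed.

Lemma disj_cut i m Q :
  [disjoint bset (cut i m false Q) & bset (cut i m true Q)].
Proof.
rewrite disj_set2E; apply/eqP; rewrite -subset0 => x [] /=; rewrite !bsetE.
case: i => /= /andP[/andP[_ h1] /andP[_ h2]] /andP[/andP[h3 _] /andP[h4 _]].
  by rewrite ltNge h2 in h4.
by rewrite ltNge h1 in h3.
Qed.

Lemma midP i Q : wf Q -> (crd i Q).1 < mid i Q < (crd i Q).2.
Proof. by rewrite /mid; case: i => /andP[/= h1 h2]; apply/andP; split; lra. Qed.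

Lemma wf_cut i m s Q : wf Q -> (crd i Q).1 < m < (crd i Q).2 -> wf (cut i m s Q).
Proof.
by rewrite /wf; case: i => /=; case: s => /= /andP[h1 h2] /andP[h3 h4];
  apply/andP.
Qed.

Lemma wf_halve i s Q : wf Q -> wf (halve i s Q).
Proof. by move=> wQ; apply: wf_cut => //; exact: midP. Qed.

Lemma len_halve i s Q : len i (halve i s Q) = len i Q / 2.
Proof. by rewrite /len /halve /cut /mid; case: i; case: s => /=; field. Qed.

Lemma len_halveN i s Q : len (~~ i) (halve i s Q) = len (~~ i) Q.
Proof. by rewrite /len /halve /cut /mid; case: i; case: s. Qed.

Lemma area_halve i s Q : area (halve i s Q) = area Q / 2.
Proof. by rewrite !(areaE i) len_halve len_halveN; field. Qed.

Lemma bset_halve i Q : wf Q ->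
  bset Q = bset (halve i false Q) `|` bset (halve i true Q).
Proof. by move=> /(midP i)/andP[h1 h2]; apply: bset_cut; rewrite !ltW. Qed.

Lemma disj_halve i Q : [disjoint bset (halve i false Q) & bset (halve i true Q)].
Proof. exact: disj_cut. Qed.

Lemma sub_halve i s Q : wf Q -> bset (halve i s Q) `<=` bset Q.
Proof. by move=> wQ; rewrite [X in _ `<=` X](bset_halve i wQ); case: s; [right|left]. Qed.

Lemma halve_side i s Q x : bset (halve i s Q) x -> (mid i Q < crd i x) = s.
Proof.
rewrite bsetE /halve /cut; case: i; case: s => /= /andP[/andP[h1 h2] /andP[h3 h4]] //.
all: by apply/negbTE; rewrite -leNgt.
Qed.

Lemma halve_mem i Q x : wf Q -> bset Q x ->
  bset (halve i (mid i Q < crd i x) Q) x.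
Proof.
move=> wQ; rewrite {1}(bset_halve i wQ) => -[] H; by have -> := halve_side H.
Qed.

(** The generation-[k] boxes of [Q], and the one among them that contains a
given point; [d k] is the direction in which generation [k] is halved. *)
Implicit Types (d : nat -> bool) (k : nat).

Definition shiftd d : nat -> bool := fun k => d k.+1.

Fixpoint nodes d k Q : seq box :=
  if k is k'.+1 then
    nodes (shiftd d) k' (halve (d 0%N) false Q) ++
    nodes (shiftd d) k' (halve (d 0%N) true Q)
  else [:: Q].

Fixpoint node d k Q x : box :=
  if k is k'.+1 then
    node (shiftd d) k' (halve (d 0%N) (mid (d 0%N) Q < crd (d 0%N) x) Q) x
  else Q.

(** [node] unfolds from the root, whereas the energy of one step is computed
at the leaves. *)
Lemma nodeS d k Q x : node d k.+1 Q x =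
  halve (d k) (mid (d k) (node d k Q x) < crd (d k) x) (node d k Q x).
Proof. by elim: k d Q => // k IH d Q; rewrite [LHS]IH. Qed.

Lemma nodesSP d k Q P : P \in nodes d k.+1 Q ->
  exists2 N, N \in nodes d k Q & exists s, P = halve (d k) s N.
Proof.
elim: k d Q => [|k IH] d Q.
  rewrite /= !inE => /orP[] /eqP ->; exists Q; rewrite ?mem_head //; by [exists false|exists true].
rewrite [nodes _ _.+2 _]/= mem_cat => /orP[] /IH[N HN [s ->]].
  by exists N; [rewrite /= mem_cat HN|exists s].
by exists N; [rewrite /= mem_cat HN orbT|exists s].
Qed.

Lemma size_nodes d k Q : size (nodes d k Q) = (2 ^ k)%N.
Proof.
by elim: k d Q => // k IH d Q; rewrite /= size_cat !IH expnS mul2n addnn.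
Qed.

Lemma wf_nodes d k Q : wf Q -> {in nodes d k Q, forall P, wf P}.
Proof.
move=> wQ; elim: k => [|k IH] P; first by rewrite inE => /eqP ->.
by case/nodesSP => N /IH wN [s ->]; exact: wf_halve.
Qed.

Lemma sub_nodes d k Q : wf Q -> {in nodes d k Q, forall P, bset P `<=` bset Q}.
Proof.
move=> wQ; elim: k => [|k IH] P; first by rewrite inE => /eqP ->.
case/nodesSP => N HN [s ->]; apply: subset_trans (IH _ HN).
by apply: sub_halve; exact: wf_nodes HN.
Qed.

Lemma area_nodes d k Q : {in nodes d k Q, forall P, area P = area Q / 2 ^+ k}.
Proof.
elim: k => [|k IH] P; first by rewrite inE expr0 divr1 => /eqP ->.
case/nodesSP => N /IH HN [s ->]; rewrite area_halve HN exprSr; field.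
by rewrite expf_neq0.
Qed.

Lemma node_mem d k Q x : wf Q -> bset Q x -> bset (node d k Q x) x.
Proof.
elim: k d Q => // k IH d Q wQ Qx; apply: IH; first exact: wf_halve.
exact: halve_mem.
Qed.

Lemma node_nodes d k Q x : node d k Q x \in nodes d k Q.
Proof.
elim: k d Q => [|k IH] d Q; first exact: mem_head.
by rewrite /= mem_cat; case: ltP => _; rewrite IH ?orbT.
Qed.

Lemma node_wf d k Q x : wf Q -> wf (node d k Q x).
Proof. by move=> wQ; exact: wf_nodes (node_nodes _ _ _ _). Qed.

End Box.

(** * Integrals along a generation of boxes *)

Section Nodes.
Context {R : realType}.
Notation mu := (leb2 R).
Notation T2 := (measurableTypeR R * measurableTypeR R)%type.
Implicit Types (Q P : @box R) (x : T2) (d : nat -> bool) (k : nat).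
Implicit Types (f W : T2 -> R) (Phi : @box R -> R).

Lemma eq_node_halve d k Q s x : bset (halve (d 0%N) s Q) x ->
  node d k.+1 Q x = node (shiftd d) k (halve (d 0%N) s Q) x.
Proof. by move=> /halve_side; rewrite /= => ->. Qed.

(** Functions of the current box that may also depend on the point: the box is
constant on each piece of the subdivision. *)
Lemma measurable_node_dep d k Q (Psi : @box R -> T2 -> R) : wf Q ->
    (forall P, measurable_fun setT (Psi P)) ->
  measurable_fun (bset Q) (fun x => Psi (node d k Q x) x).
Proof.
move=> + mP; elim: k d Q => [|k IH] d Q wQ.
  exact: (measurable_funTS (mP Q)).
rewrite (bset_halve (d 0%N) wQ).
apply/measurable_funU; [exact: measurable_bset|exact: measurable_bset|].
split.
- apply: (eq_measurable_fun
    (fun x => Psi (node (shiftd d) k (halve (d 0%N) false Q) x) x)).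
    by move=> x /set_mem xQ; rewrite (eq_node_halve _ xQ).
  by apply: IH; exact: wf_halve.
- apply: (eq_measurable_fun
    (fun x => Psi (node (shiftd d) k (halve (d 0%N) true Q) x) x)).
    by move=> x /set_mem xQ; rewrite (eq_node_halve _ xQ).
  by apply: IH; exact: wf_halve.
Qed.

Lemma measurable_node d k Q Phi : wf Q ->
  measurable_fun (bset Q) (fun x => Phi (node d k Q x)).
Proof.
move=> wQ; apply: (@measurable_node_dep d k Q (fun P _ => Phi P) wQ) => P.
exact: measurable_cst.
Qed.

Lemma ge0_int_node_dep d k Q (Psi : @box R -> T2 -> R) : wf Q ->
    (forall P, measurable_fun setT (Psi P)) -> (forall P x, 0 <= Psi P x) ->
  (\int[mu]_(x in bset Q) (Psi (node d k Q x) x)%:E =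
   \sum_(P <- nodes d k Q) \int[mu]_(x in bset P) (Psi P x)%:E)%E.
Proof.
move=> + mP P0; elim: k d Q => [|k IH] d Q wQ; first by rewrite big_seq1.
rewrite {1}(bset_halve (d 0%N) wQ) ge0_integral_setU //; last 5 first.
- exact: measurable_bset.
- exact: measurable_bset.
- by rewrite -bset_halve //; apply/measurable_EFinP; exact: measurable_node_dep.
- by move=> x _; rewrite lee_fin.
- exact: disj_halve.
rewrite [nodes _ _ _]/= big_cat /= -!IH; try exact: wf_halve.
congr (_ + _)%E; apply: eq_integral => x /set_mem xQ;
  by rewrite -(eq_node_halve _ xQ).
Qed.

Lemma ge0_int_node d k Q Phi W : wf Q -> (forall P, 0 <= Phi P) ->
    measurable_fun setT W -> (forall x, 0 <= W x) ->
  (\int[mu]_(x in bset Q) (Phi (node d k Q x) * W x)%:E =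
   \sum_(P <- nodes d k Q) (Phi P)%:E * \int[mu]_(x in bset P) (W x)%:E)%E.
Proof.
move=> wQ P0 mW W0.
rewrite (ge0_int_node_dep d k (Psi := fun P x => Phi P * W x)) //.
- apply: eq_bigr => P _; rewrite -ge0_integralZl_EFin //.
  + exact: measurable_bset.
  + by move=> x _; rewrite lee_fin.
  + by apply/measurable_EFinP; exact: measurable_funTS.
- by move=> P; apply: measurable_funM => //; exact: measurable_cst.
- by move=> P x; rewrite mulr_ge0.
Qed.

Lemma int_node d k Q Phi f : wf Q -> mu.-integrable (bset Q) (EFin \o f) ->
  mu.-integrable (bset Q) (fun x => (Phi (node d k Q x) * f x)%:E) /\
  \int[mu]_(x in bset Q) (Phi (node d k Q x) * f x) =
  \sum_(P <- nodes d k Q) Phi P * \int[mu]_(x in bset P) f x.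
Proof.
elim: k d Q => [|k IH] d Q wQ iF.
  split.
    under eq_fun do rewrite EFinM.
    exact: (integrableZl (measurable_bset Q) (Phi Q) iF).
  by rewrite big_seq1 /= RintegralZl //; exact: measurable_bset.
have iH s : mu.-integrable (bset (halve (d 0%N) s Q)) (EFin \o f).
  by apply: integrableS iF; try exact: measurable_bset; exact: sub_halve.
have mPf : mu.-integrable (bset Q) (fun x => (Phi (node d k.+1 Q x) * f x)%:E).
  pose M := \sum_(P <- nodes d k.+1 Q) `|Phi P|.
  under eq_fun do rewrite EFinM.
  apply: (@integrableMr _ _ _ mu (bset Q) _ (fun x => Phi (node d k.+1 Q x))) => //.
  - exact: measurable_bset.
  - exact: measurable_node.
  - exists M; split; first exact: num_real.
    move=> y My x _ /=; apply: le_trans (ltW My).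
    rewrite /M (big_rem (node d k.+1 Q x)) ?node_nodes //=.
    by rewrite lerDl sumr_ge0.
split=> //.
rewrite {1}(bset_halve (d 0%N) wQ) Rintegral_setU //; last 4 first.
- exact: measurable_bset.
- exact: measurable_bset.
- by rewrite -bset_halve.
- exact: disj_halve.
rewrite [nodes _ _ _]/= big_cat /=.
rewrite -(IH _ _ (wf_halve _ _ wQ) (iH false)).2 -(IH _ _ (wf_halve _ _ wQ) (iH true)).2.
congr (_ + _); apply: eq_Rintegral => x /set_mem xQ;
  by rewrite -(eq_node_halve _ xQ).
Qed.

End Nodes.

(** * Telescoping along the dyadic tree *)

Section Martingale.
Context {R : realType}.
Notation mu := (leb2 R).
Notation T2 := (measurableTypeR R * measurableTypeR R)%type.
Implicit Types (Q P : @box R) (x : R * R) (d : nat -> bool) (k : nat).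
Implicit Types (f G V : T2 -> R) (i : bool).

Definition avg f Q : R := (\int[mu]_(x in bset Q) f x) / area Q.
Definition Ecell f d k Q (x : T2) : R := avg f (node d k Q x).
Definition jump i m f P : R := avg f (cut i m true P) - avg f (cut i m false P).
Definition osc i f P : R := jump i (mid i P) f P.
Definition gint G P : R := \int[mu]_(x in bset P) G x.

(** All that the argument retains of [G] being the squared length of the
gradient of [f]. *)
Definition ctrl f G Q := [/\ mu.-integrable (bset Q) (EFin \o f),
  mu.-integrable (bset Q) (EFin \o G), (forall x, 0 <= G x) &
  forall P i m, wf P -> bset P `<=` bset Q -> (crd i P).1 < m < (crd i P).2 ->
    (jump i m f P) ^+ 2 <= len i P / len (~~ i) P * gint G P].

Lemma gint_ge0 G P : (forall x, 0 <= G x) -> 0 <= gint G P.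
Proof. by move=> G0; exact: Rintegral_ge0. Qed.

Lemma integrable_sub f Q P : bset P `<=` bset Q ->
  mu.-integrable (bset Q) (EFin \o f) -> mu.-integrable (bset P) (EFin \o f).
Proof.
by move=> PQ; apply: integrableS => //; exact: measurable_bset.
Qed.

Lemma oscP f G Q P i : ctrl f G Q -> wf P -> bset P `<=` bset Q ->
  (osc i f P) ^+ 2 <= len i P / len (~~ i) P * gint G P.
Proof. by move=> [_ _ _ cf] wP PQ; apply: cf => //; exact: midP. Qed.

Lemma avg_halve f P i : wf P -> mu.-integrable (bset P) (EFin \o f) ->
  avg f P = (avg f (halve i true P) + avg f (halve i false P)) / 2.
Proof.
move=> wP iF; rewrite /avg {1}(bset_halve i wP) Rintegral_setU.
- rewrite !area_halve; field; rewrite gt_eqF //; exact: area_gt0.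
- exact: measurable_bset.
- exact: measurable_bset.
- by rewrite -bset_halve.
- exact: disj_halve.
Qed.

(** A parent's average is the mean of its children's, so each child deviates
from it by half the jump. *)
Lemma Ecell_step f d k Q x : wf Q -> mu.-integrable (bset Q) (EFin \o f) ->
  (Ecell f d k.+1 Q x - Ecell f d k Q x) ^+ 2 =
  (osc (d k) f (node d k Q x)) ^+ 2 / 4.
Proof.
move=> wQ iF; rewrite /Ecell nodeS; set P := node d k Q x.
have wP : wf P by exact: node_wf.
have iP : mu.-integrable (bset P) (EFin \o f).
  by apply: integrable_sub iF; apply: (sub_nodes wQ); exact: node_nodes.
rewrite (avg_halve (d k) wP iP) /osc /jump -/(halve _ _ _) -/(halve _ _ _).
by case: (_ < _); field.
Qed.

Lemma sum_gint G d k Q : wf Q -> mu.-integrable (bset Q) (EFin \o G) ->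
  \sum_(P <- nodes d k Q) gint G P = gint G Q.
Proof.
move=> wQ iG; have [_] := int_node d k (fun=> 1) wQ iG.
under eq_Rintegral do rewrite mul1r.
by move=> /esym; under eq_bigr do rewrite mul1r.
Qed.

Lemma measurable_Ecell f d k Q : wf Q -> measurable_fun (bset Q) (Ecell f d k Q).
Proof. by move=> wQ; exact: (measurable_node d k (avg f)). Qed.

(** The alternative that makes a box harmless at level [c]: either its jump is
killed or the potential is small on it. *)
Definition cheap d k f V (c : R) P := osc (d k) f P = 0 \/
  ((len (d k) P / len (~~ d k) P)%:E * \int[mu]_(x in bset P) (V x)%:E <= c%:E)%E.

(** The squared step is constant on a box of generation [k], and the jump is
controlled by the energy of that box; so a cheap box contributes at most [c / 4] times its own energy. *)
Lemma step_energy f G V d k Q (c : R) : wf Q -> ctrl f G Q ->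
    measurable_fun setT V -> (forall x, 0 <= V x) -> 0 <= c ->
    {in nodes d k Q, forall P, cheap d k f V c P} ->
  (\int[mu]_(x in bset Q)
      ((Ecell f d k.+1 Q x - Ecell f d k Q x) ^+ 2 * V x)%:E
     <= (c / 4 * gint G Q)%:E)%E.
Proof.
move=> wQ cf mV V0 c0 cheapP; have [iF iG G0 _] := cf.
under eq_integral => x _ do rewrite Ecell_step //.
rewrite (ge0_int_node d k (Phi := fun P => osc (d k) f P ^+ 2 / 4)) //; last first.
  by move=> P; rewrite divr_ge0 // sqr_ge0.
rewrite -(sum_gint d k wQ iG) mulr_sumr -sumEFin big_seq [leRHS]big_seq.
apply: lee_sum => P HP.
have wP := wf_nodes wQ HP; have PQ := sub_nodes wQ HP.
have g0 : 0 <= gint G P by exact: gint_ge0.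
have [->|Hc] := cheapP _ HP.
  by rewrite expr0n /= mul0r mul0e lee_fin mulr_ge0 // divr_ge0.
have v0 : (0 <= \int[mu]_(x in bset P) (V x)%:E)%E.
  by apply: integral_ge0 => x _; rewrite lee_fin.
apply: (@le_trans _ _ ((gint G P / 4)%:E *
   ((len (d k) P / len (~~ d k) P)%:E * \int[mu]_(x in bset P) (V x)%:E))%E).
  rewrite muleA -EFinM; apply: lee_wpmul2r => //; rewrite lee_fin.
  by have := oscP (d k) cf wP PQ; move: (len _ _ / _) => r; lra.
apply: (@le_trans _ _ ((gint G P / 4)%:E * c%:E)%E).
  by rewrite lee_wpmul2l // lee_fin divr_ge0.
by rewrite -EFinM lee_fin mulrC mulrA mulrAC.
Qed.

Lemma sqr_addW (a b s : R) : 0 < s ->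
  (a + b) ^+ 2 <= (1 + s) * a ^+ 2 + (1 + s^-1) * b ^+ 2.
Proof.
move=> s0; rewrite -subr_ge0.
have -> : (1 + s) * a ^+ 2 + (1 + s^-1) * b ^+ 2 - (a + b) ^+ 2 =
          s * (a - b / s) ^+ 2 by field; rewrite gt_eqF.
by rewrite mulr_ge0 ?sqr_ge0 ?ltW.
Qed.

Lemma Ecell_cheap_eq f d (K k : nat) Q x : wf Q ->
    mu.-integrable (bset Q) (EFin \o f) -> (k <= K)%N ->
    (forall j, (j < K)%N -> {in nodes d j Q, forall P, osc (d j) f P = 0}) ->
  Ecell f d k Q x = avg f Q.
Proof.
move=> wQ iF + osc0; elim: k => // k IH kK; rewrite -IH ?(ltnW kK) //.
apply/eqP; rewrite -subr_eq0 -sqrf_eq0 Ecell_step //.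
by rewrite (osc0 _ kK) ?node_nodes // expr0n /= mul0r.
Qed.

(** The first [K] steps vanish and the later ones decay like [tau ^ j], but
the steps are not orthogonal with respect to [V].  They are added one at a time
with [sqr_addW], with weights [1 + s_j] whose product stays below 2 while
[1 + s_j^-1] grows like [th ^ - j] for some [th] strictly between [tau] and 1,
so that the weighted steps remain summable. *)
Lemma tree_energy f G V d K Q (eps tau : R) : wf Q -> ctrl f G Q ->
    measurable_fun setT V -> (forall x, 0 <= V x) -> 0 <= eps -> 0 < tau < 1 ->
    (forall j, (j < K)%N -> {in nodes d j Q, forall P, osc (d j) f P = 0}) ->
    (forall j, {in nodes d (K + j) Q, forall P,
       cheap d (K + j) f V (eps * tau ^+ j) P}) ->
  forall D, (\int[mu]_(x in bset Q) ((Ecell f d D Q x - avg f Q) ^+ 2 * V x)%:E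
     <= (2 * eps / (1 - tau) ^+ 2 * gint G Q)%:E)%E.
Proof.
move=> wQ cf mV V0 e0 /andP[t0 t1] osc0 ch D; have [iF iG G0 _] := cf.
have g0 : 0 <= gint G Q by exact: gint_ge0.
have zero k : (k <= K)%N -> (\int[mu]_(x in bset Q)
    ((Ecell f d k Q x - avg f Q) ^+ 2 * V x)%:E = 0)%E.
  move=> kK; rewrite integral0_eq // => x _.
  by rewrite (Ecell_cheap_eq x wQ iF kK osc0) subrr expr0n /= mul0r.
have [DK|KD] := leqP D K.
  rewrite zero // lee_fin; apply: mulr_ge0 => //.
  by apply: divr_ge0; [exact: mulr_ge0|exact: sqr_ge0].
rewrite -(subnKC (ltnW KD)); move: (D - K)%N => {KD D} J.
(* [A] and [B] solve the recursion produced by [sqr_addW] with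
   [s = th ^ j * (1 - th) / A j]: [A j] is the accumulated weight and [B j] the
   accumulated energy. *)
pose th := (1 + tau) / 2.
have th0 : 0 < th by rewrite /th; lra.
have th1 : th < 1 by rewrite /th; lra.
have tth : tau < th by rewrite /th; lra.
pose A j : R := 2 - th ^+ j.
pose B j : R := \sum_(i < j) (eps / 4 * (tau / th) ^+ i / (1 - th) * gint G Q).
have Age1 j : 1 <= A j by rewrite /A; have := exprn_ile1 j (ltW th0) (ltW th1); lra.
have Ale2 j : A j <= 2 by rewrite /A; have := exprn_ge0 j (ltW th0); lra.
have B0 j : 0 <= B j.
  rewrite /B; apply: sumr_ge0 => i _; apply: mulr_ge0; last by [].
  apply: divr_ge0; last by rewrite subr_ge0 ltW.
  apply: mulr_ge0; first by rewrite divr_ge0.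
  by rewrite exprn_ge0 // divr_ge0 // ltW.
have main : (\int[mu]_(x in bset Q) ((Ecell f d (K + J) Q x - avg f Q) ^+ 2 * V x)%:E
     <= (A J * B J)%:E)%E.
  elim: J => [|J IH].
    by rewrite addn0 zero // lee_fin mulr_ge0 // (le_trans ler01).
  pose s := th ^+ J * (1 - th) / A J.
  have AJ0 : 0 < A J by exact: lt_le_trans (Age1 J).
  have thJ0 : 0 < th ^+ J by rewrite exprn_gt0.
  have s0 : 0 < s by rewrite divr_gt0 // mulr_gt0 // subr_gt0.
  have mE k : measurable_fun (bset Q) (Ecell f d k Q) by exact: measurable_Ecell.
  have mVQ : measurable_fun (bset Q) V by exact: measurable_funTS.
  pose u x := (Ecell f d (K + J) Q x - avg f Q) ^+ 2 * V x.
  pose w x := (Ecell f d (K + J).+1 Q x - Ecell f d (K + J) Q x) ^+ 2 * V x.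
  have muk k : measurable_fun (bset Q)
      (fun x => (Ecell f d k Q x - avg f Q) ^+ 2 * V x).
    apply: measurable_funM => //; apply: (measurable_funX 2).
    by apply: measurable_funB => //; exact: measurable_cst.
  have mu_ : measurable_fun (bset Q) u by exact: muk.
  have mw : measurable_fun (bset Q) w.
    by apply: measurable_funM => //; apply: (measurable_funX 2); exact: measurable_funB.
  have u0 x : 0 <= u x by rewrite mulr_ge0 // sqr_ge0.
  have w0 x : 0 <= w x by rewrite mulr_ge0 // sqr_ge0.
  have mQ := measurable_bset Q.
  apply: (@le_trans _ _ (\int[mu]_(x in bset Q)
      (((1 + s)%:E * (u x)%:E) + ((1 + s^-1)%:E * (w x)%:E))%E)%E).
    apply: ge0_le_integral => //.
    - by move=> x _; rewrite lee_fin mulr_ge0 // sqr_ge0.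
    - by apply/measurable_EFinP; exact: muk.
    - apply: emeasurable_funD; apply: emeasurable_funM => //; exact/measurable_EFinP.
    - move=> x _; rewrite -!EFinM -EFinD lee_fin /u /w.
      rewrite [(1 + s) * _]mulrA [(1 + s^-1) * _]mulrA -mulrDl.
      rewrite ler_wpM2r //. apply: le_trans (sqr_addW _ _ s0).
      rewrite le_eqVlt; apply/orP; left; apply/eqP.
      by rewrite addnS; congr (_ ^+ 2); ring.
  have c1 : 0 <= 1 + s by rewrite addr_ge0 // ltW.
  have c2 : 0 <= 1 + s^-1 by rewrite addr_ge0 // invr_ge0 ltW.
  rewrite ge0_integralD //; last 4 first.
  - by move=> x _; rewrite -EFinM lee_fin mulr_ge0.
  - by apply: emeasurable_funM => //; exact/measurable_EFinP.
  - by move=> x _; rewrite -EFinM lee_fin mulr_ge0.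
  - by apply: emeasurable_funM => //; exact/measurable_EFinP.
  rewrite !ge0_integralZl_EFin //; last 4 first.
  - by move=> x _; rewrite lee_fin.
  - exact/measurable_EFinP.
  - by move=> x _; rewrite lee_fin.
  - exact/measurable_EFinP.
  apply: (@le_trans _ _ ((1 + s)%:E * (A J * B J)%:E +
     (1 + s^-1)%:E * (eps * tau ^+ J / 4 * gint G Q)%:E)%E).
    apply: leeD; rewrite lee_wpmul2l ?lee_fin //.
    apply: (step_energy wQ cf mV V0) => //.
    by rewrite mulr_ge0 // exprn_ge0 // ltW.
  rewrite -!EFinM -EFinD lee_fin /B big_ord_recr /= -/(B J).
  rewrite le_eqVlt; apply/orP; left; apply/eqP.
  have -> : A J.+1 = A J + th ^+ J * (1 - th) by rewrite /A exprSr; ring.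
  rewrite /s (expr_div_n tau).
  have alg (a b g t v e h : R) : a != 0 -> t != 0 -> 1 - h != 0 ->
      (1 + t * (1 - h) / a) * (a * b) +
        (1 + (t * (1 - h) / a)^-1) * (e * v / 4 * g) =
      (a + t * (1 - h)) * (b + e / 4 * (v / t) / (1 - h) * g).
    by move=> a0 t_0 h0; field; rewrite a0 t_0 h0.
  by apply: alg; rewrite gt_eqF // subr_gt0.
apply: (le_trans main); rewrite lee_fin.
apply: (@le_trans _ _ (2 * B J)); first by rewrite ler_wpM2r.
have r1 : tau / th < 1 by rewrite ltr_pdivrMr // mul1r.
have r0 : 0 <= tau / th by rewrite divr_ge0 // ltW.
have t1' : 0 < 1 - tau by rewrite subr_gt0.
have geo : \sum_(i < J) (tau / th) ^+ i <= 2 / (1 - tau).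
  apply: (@le_trans _ _ (1 - tau / th)^-1).
    rewrite -[leRHS]mul1r ler_pdivlMr ?subr_gt0 // mulrC.
    have -> : (1 - tau / th) * \sum_(i < J) (tau / th) ^+ i = 1 - (tau / th) ^+ J.
      by have := subrX1 (tau / th) J; move: (\sum_(_ < _) _) => S E; lra.
    by rewrite lerBlDr lerDl exprn_ge0.
  have -> : 1 - tau / th = (1 - tau) / (2 * th) by rewrite /th; field; lra.
  by rewrite invf_div ler_pM2r ?invr_gt0 //; lra.
rewrite /B -!mulr_suml -mulr_sumr.
have -> : 2 * eps / (1 - tau) ^+ 2 * gint G Q =
  2 * (eps / 4 * (2 / (1 - tau)) / (1 - th) * gint G Q).
  by rewrite /th; field; lra.
rewrite ler_pM2l // ler_wpM2r // ler_pM2r ?invr_gt0 ?subr_gt0 //.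
by rewrite ler_wpM2l // divr_ge0.
Qed.

End Martingale.

(** * Integrals over quadrants determine a function *)

Section Quadrants.
Context {R : realType}.
Notation mu := (leb2 R).
Notation T2 := (measurableTypeR R * measurableTypeR R)%type.

Definition quad (a b : R) : set T2 := `]a, +oo[ `*` `]b, +oo[.

Lemma measurable_quad (a b : R) : measurable (quad a b).
Proof. by apply: measurableX; exact: measurable_itv. Qed.

Definition quads := [set A : set T2 | exists a b, A = quad a b].

Lemma quads_strips (i : bool) (x : R) :
  <<s quads >> ((fun z : T2 => crd i z) @^-1` `]x, +oo[).
Proof.
have cov (y : R) : exists k : nat, (- k%:R : R) < y.
  exists (Num.truncn `|y|).+1; rewrite ltrNl.
  by apply: le_lt_trans (truncnS_gt _); rewrite -normrN ler_norm.
pose A k : set T2 := if i then quad (- k%:R) x else quad x (- k%:R).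
have -> : (fun z : T2 => crd i z) @^-1` `]x, +oo[ = \bigcup_k A k.
  apply/seteqP; split => z /=.
    rewrite in_itv /= andbT /A /quad /crd => xz; case: i xz {A} => xz.
      by have [k kz] := cov z.1; exists k => //; split; rewrite /= in_itv /= andbT.
    by have [k kz] := cov z.2; exists k => //; split; rewrite /= in_itv /= andbT.
  by case=> k _; rewrite /A /quad /crd; case: i {A} => -[] /=.
apply: (@bigcup_measurable _ (g_sigma_algebraType quads)) => k _.
apply: sub_sigma_algebra; rewrite /A.
by case: i {A}; [exists (- k%:R), x|exists x, (- k%:R)].
Qed.

Lemma measurable_quads : @measurable _ T2 = <<s quads >>.
Proof.
have mc (i : bool) : measurable_fun setT
    ((fun z : T2 => crd i z : measurableTypeR R) : g_sigma_algebraType quads -> measurableTypeR R).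
  apply: (@measurability _ _ _ _ _ _ (@RGenOInfty.G R)).
    exact: RGenOInfty.measurableE.
  move=> _ [_ [x ->] <-]; rewrite setTI; exact: quads_strips.
rewrite eqEsubset; split.
  apply: smallest_sub; first exact: smallest_sigma_algebra.
  rewrite subUset; split => _ [A mA <-].
    exact: (mc false _ A mA).
  exact: (mc true _ A mA).
apply: smallest_sub; first exact: sigma_algebra_measurable.
by move=> _ [a [b ->]]; exact: measurable_quad.
Qed.

Lemma setI_closed_quads : setI_closed quads.
Proof.
move=> _ _ [a [b ->]] [c [d ->]]; exists (Num.max a c), (Num.max b d).
apply/seteqP; split => x; rewrite /quad /= !in_itv /= !andbT !gt_max.
  by move=> [[-> ->] [-> ->]].
by move=> [/andP[-> ->] /andP[-> ->]].
Qed.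

Lemma quads_integral0 (D : set T2) (u : T2 -> \bar R) : measurable D ->
  mu.-integrable D u -> (\int[mu]_(x in D) u x = 0)%E ->
  (forall a b, \int[mu]_(x in D `&` quad a b) u x = 0)%E ->
  forall E, measurable E -> (\int[mu]_(x in D `&` E) u x = 0)%E.
Proof.
move=> mD iu u0 uq E; rewrite measurable_quads.
apply: (@dynkin_induction _ T2 quads
  (fun E => \int[mu]_(x in D `&` E) u x = 0)%E measurable_quads setI_closed_quads).
- by rewrite setIT.
- by move=> _ [a [b ->]].
- move=> A mA PA.
  have mDA : measurable (D `&` A) by exact: measurableI.
  have mDAc : measurable (D `&` ~` A) by apply: measurableI => //; exact: measurableC.
  have := u0; rewrite -{1}(setIT D) -(setUv A) setIUr integral_setU //.
  + by rewrite PA add0e.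
  + by rewrite -setIUr setUv setIT; exact: measurable_int iu.
  + by rewrite disj_set2E setIACA setICr setI0.
- move=> F mF tF PF; rewrite setI_bigcupr integral_bigcup //.
  + by rewrite eseries0 // => k _ _; exact: PF.
  + exact: trivIset_setIl.
  + by move=> k; exact: measurableI.
  + apply: integrableS iu => //; last by rewrite -setI_bigcupr; exact: subIsetl.
    by apply: bigcup_measurable => k _; exact: measurableI.
Qed.

(** The quadrants are a pi-system generating the Borel sets of the plane, and
agreement of the integrals passes to differences and to disjoint unions. *)
Lemma quads_ae_eq (D : set T2) (f g : T2 -> \bar R) : measurable D ->
  mu.-integrable D f -> mu.-integrable D g ->
  (\int[mu]_(x in D) f x = \int[mu]_(x in D) g x)%E ->
  (forall a b, \int[mu]_(x in D `&` quad a b) f x =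
               \int[mu]_(x in D `&` quad a b) g x)%E ->
  ae_eq mu D f g.
Proof.
move=> mD iF iG fg0 fg; apply: integral_ae_eq => //; first exact: measurable_int iG.
move=> E ED mE.
have sub A : measurable A -> A `<=` D ->
    (\int[mu]_(x in A) f x = \int[mu]_(x in A) g x)%E <->
    (\int[mu]_(x in A) (f \- g) x = 0)%E.
  move=> mA AD; have ifA := integrableS mD mA AD iF.
  have igA := integrableS mD mA AD iG.
  have := integrable_fin_num mA ifA; have := integrable_fin_num mA igA.
  rewrite integralB // => gf ff; split => [->|]; first by rewrite subee.
  by move: gf ff; case: integral => // a; case: integral => // b _ _ [] /eqP;
    rewrite subr_eq0 => /eqP ->.
apply/sub => //; rewrite -(setIidr ED); apply: quads_integral0 => //.
- exact: integrableB.
- exact/sub.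
- move=> a b; apply/sub; [|exact: subIsetl|exact: fg].
  by apply: measurableI => //; exact: measurable_quad.
Qed.

End Quadrants.

(** * Alternating halvings *)

Section Alt.
Context {R : realType}.
Notation mu := (leb2 R).
Notation T2 := (measurableTypeR R * measurableTypeR R)%type.
Implicit Types (Q P : @box R) (k : nat) (f G V : T2 -> R).

Definition alt (k : nat) : bool := ~~ odd k.

(** Alternating halvings produce only two values of [len i P / len (~~ i) P]
in the direction about to be halved; this is their sum. *)
Definition aspect Q : R := len true Q / len false Q + 2 * (len false Q / len true Q).

Lemma aspect_gt0 Q : wf Q -> 0 < aspect Q.
Proof.
move=> wQ; have h := len_gt0 false wQ; have v := len_gt0 true wQ.
by rewrite /aspect addr_gt0 ?mulr_gt0 ?invr_gt0.
Qed.

Lemma alt_ratio k Q : wf Q -> {in nodes alt k Q, forall P,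
  len (alt k) P / len (~~ alt k) P =
  if odd k then 2 * (len false Q / len true Q) else len true Q / len false Q}.
Proof.
move=> wQ; have h := len_gt0 false wQ; have v := len_gt0 true wQ.
elim: k => [|k IH] P; first by rewrite inE => /eqP ->.
case/nodesSP => N HN [s ->]; have wN := wf_nodes wQ HN; move/IH: HN.
have -> : alt k.+1 = ~~ alt k by rewrite /alt.
rewrite negbK len_halveN len_halve.
have l1 := len_gt0 (alt k) wN; have l2 := len_gt0 (~~ alt k) wN.
have -> : len (~~ alt k) N / (len (alt k) N / 2) =
          2 / (len (alt k) N / len (~~ alt k) N) by field; rewrite !gt_eqF.
move=> ->; rewrite oddS; case: (odd k) => /=; field; by rewrite !gt_eqF.
Qed.

Lemma alt_ratio_le k Q P : wf Q -> P \in nodes alt k Q ->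
  len (alt k) P / len (~~ alt k) P <= aspect Q.
Proof.
move=> wQ HP; rewrite (alt_ratio wQ HP) /aspect.
have h := len_gt0 false wQ; have v := len_gt0 true wQ.
case: ifP => _; first by rewrite lerDr divr_ge0 // ltW.
by rewrite lerDl mulr_ge0 // divr_ge0 // ltW.
Qed.

(** Bounded aspect ratio turns the decay of the areas into decay of the
diameters. *)
Lemma alt_len_le k Q i P : wf Q -> P \in nodes alt k Q ->
  len i P ^+ 2 <= aspect Q * area Q / 2 ^+ k.
Proof.
move=> wQ HP; have wP := wf_nodes wQ HP.
have h := len_gt0 false wQ; have v := len_gt0 true wQ.
have l1 := len_gt0 (alt k) wP; have l2 := len_gt0 (~~ alt k) wP.
rewrite -mulrA -(area_nodes HP) (areaE (alt k)).
have -> : len i P ^+ 2 = (len i P / len (~~ i) P) * (len (alt k) P * len (~~ alt k) P).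
  rewrite -areaE (areaE i); field; rewrite gt_eqF //; exact: len_gt0.
apply: ler_wpM2r; first by rewrite mulr_ge0 // ltW.
have [->|/negPf Hi] := eqVneq i (alt k); first exact: alt_ratio_le.
have -> : i = ~~ alt k by move: Hi; case: i; case: (alt k).
rewrite negbK -invf_div (alt_ratio wQ HP) /aspect.
have v0 := divr_gt0 v h; have h0 := divr_gt0 h v.
by case: ifP => _; [rewrite invfM|]; rewrite invf_div; lra.
Qed.

Lemma alt_step_energy f G Q k : wf Q -> ctrl f G Q ->
  (\int[mu]_(x in bset Q) ((Ecell f alt k.+1 Q x - Ecell f alt k Q x) ^+ 2)%:E
     <= (aspect Q * area Q / 4 * gint G Q / 2 ^+ k)%:E)%E.
Proof.
move=> wQ cf; have a0 := aspect_gt0 wQ; have A0 := area_gt0 wQ.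
have := @step_energy R f G (fun=> 1) alt k Q (aspect Q * area Q / 2 ^+ k) wQ cf.
under eq_integral do rewrite mulr1.
move=> H; apply: (le_trans (H _ _ _ _)).
- exact: measurable_cst.
- by [].
- by rewrite divr_ge0 ?exprn_ge0 // mulr_ge0 // ltW.
- move=> P HP; right; have wP := wf_nodes wQ HP.
  rewrite integral_cst ?mul1e; last exact: measurable_bset.
  rewrite [mu _]mu_bset // -EFinM lee_fin (area_nodes HP) mulrA.
  rewrite ler_wpM2r ?invr_ge0 ?exprn_ge0 // ler_wpM2r ?(ltW A0) //.
  exact: alt_ratio_le.
- by rewrite lee_fin le_eqVlt; apply/orP; left; apply/eqP; field; rewrite expf_neq0.
Qed.

(** Telescoping against the constant weight 1: the mass of a box is its area,
which is halved at each generation. *)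
Lemma alt_energy f G Q D : wf Q -> ctrl f G Q ->
  (\int[mu]_(x in bset Q) ((Ecell f alt D Q x - avg f Q) ^+ 2)%:E
     <= (8 * aspect Q * area Q * gint G Q)%:E)%E.
Proof.
move=> wQ cf; have a0 := aspect_gt0 wQ; have A0 := area_gt0 wQ.
under eq_integral => x _ do rewrite -[_ ^+ 2]mulr1.
have H := @tree_energy R f G (fun=> 1) alt 0 Q (aspect Q * area Q) (1 / 2) wQ cf.
 apply: (le_trans (H _ _ _ _ _ _ D)).
- exact: measurable_cst.
- by [].
- by rewrite mulr_ge0 // ltW.
- by clear H; apply/andP; split; lra.
- by [].
- move=> k P HP; right; have wP := wf_nodes wQ HP.
  rewrite integral_cst ?mul1e; last exact: measurable_bset.
  rewrite [mu _]mu_bset // -EFinM lee_fin (area_nodes HP) add0n mulrA.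
  rewrite mul1r exprVn ler_wpM2r ?invr_ge0 ?exprn_ge0 // ler_wpM2r ?(ltW A0) //.
  exact: alt_ratio_le.
- by rewrite lee_fin le_eqVlt; apply/orP; left; apply/eqP; field.
Qed.

End Alt.

(** * Convergence of the dyadic averages and the Poincare inequality *)

Section Conv.
Context {R : realType}.
Notation mu := (leb2 R).
Notation T2 := (measurableTypeR R * measurableTypeR R)%type.
Implicit Types (Q P : @box R) (k : nat) (f G V : T2 -> R).

Section Fix.
Variables (f G : T2 -> R) (Q : @box R).
Hypotheses (wQ : wf Q) (cf : ctrl f G Q).

Let E k (x : T2) : R := Ecell f alt k Q x.
Let dE k (x : T2) : R := E k.+1 x - E k x.
Let S (x : T2) : \bar R := (\sum_(0 <= k <oo) `|dE k x|%:E)%E.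
Let mQ := measurable_bset Q.

Let mE k : measurable_fun (bset Q) (E k).
Proof. exact: measurable_Ecell. Qed.

Let mdE k : measurable_fun (bset Q) (dE k).
Proof. exact: measurable_funB. Qed.

Let mabs k : measurable_fun (bset Q) (fun x => `|dE k x|%:E).
Proof. by apply/measurable_EFinP; apply: measurableT_comp => //; exact: mdE. Qed.

Let C : R := aspect Q * area Q / 4 * gint G Q.

Let C0 : 0 <= C.
Proof.
have a0 := aspect_gt0 wQ; have A0 := area_gt0 wQ; have [_ _ G0 _] := cf.
by rewrite mulr_ge0 ?gint_ge0 // divr_ge0 // mulr_ge0 // ltW.
Qed.

(** The [L^2] norms of the steps decay like [2 ^ - (k / 2)], and Young's
inequality with weight [(3 / 4) ^ k] gives a geometric bound in [L^1].  So the
averages converge almost everywhere under an integrable bound. *)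
Let int_dE k : (\int[mu]_(x in bset Q) `|dE k x|%:E
  <= ((area Q + C) * (3 / 4) ^+ k)%:E)%E.
Proof.
have A0 := area_gt0 wQ.
pose t : R := (3 / 4) ^+ k.
have t0 : 0 < t by rewrite exprn_gt0.
have mt : measurable_fun (bset Q) (fun x => (dE k x ^+ 2)%:E).
  by apply/measurable_EFinP; apply: (measurable_funX 2).
apply: (@le_trans _ _ (\int[mu]_(x in bset Q)
   (t%:E + (t^-1)%:E * (dE k x ^+ 2)%:E)%E)%E).
  apply: ge0_le_integral => //.
  - by apply: emeasurable_funD; [exact: measurable_cst|exact: emeasurable_funM].
  - move=> x _; rewrite -EFinM -EFinD lee_fin -subr_ge0.
    set a := dE k x.
    have -> : t + t^-1 * a ^+ 2 - `|a| = t^-1 * ((`|a| - t) ^+ 2 + t * `|a|).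
      rewrite -[a ^+ 2]real_normK ?num_real //; field; by rewrite gt_eqF.
    apply: mulr_ge0; first by rewrite invr_ge0 ltW.
    by rewrite addr_ge0 ?sqr_ge0 // mulr_ge0 // ltW.
rewrite ge0_integralD //; last 3 first.
- by move=> x _; rewrite lee_fin ltW.
- by move=> x _; rewrite -EFinM lee_fin mulr_ge0 ?sqr_ge0 // invr_ge0 ltW.
- exact: emeasurable_funM.
rewrite integral_cst // ge0_integralZl_EFin //; last 2 first.
- by move=> x _; rewrite lee_fin sqr_ge0.
- by rewrite invr_ge0 ltW.
rewrite [mu _]mu_bset // mulrDl EFinD -EFinM [t * _]mulrC; apply: leeD => //.
apply: (@le_trans _ _ ((t^-1)%:E * (C / 2 ^+ k)%:E)%E).
  by rewrite lee_wpmul2l ?lee_fin ?invr_ge0 ?(ltW t0) //; exact: alt_step_energy.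
rewrite -EFinM lee_fin mulrCA ler_wpM2l // -invfM -/t.
rewrite invf_ple ?posrE ?mulr_gt0 ?exprn_gt0 //.
rewrite /t -!exprMn -exprVn; apply: lerXn2r; rewrite ?nnegrE; lra.
Qed.

Let S_ge0 x : (0 <= S x)%E.
Proof. by apply: nneseries_ge0 => k _ _; rewrite lee_fin. Qed.

Let integrable_S : mu.-integrable (bset Q) S.
Proof.
apply/integrableP; split.
  apply: (emeasurable_fun_cvg (fun n x => \sum_(0 <= k < n) `|dE k x|%:E)%E).
    by move=> n; apply: emeasurable_sum => k; exact: mabs.
  by move=> x _; apply: is_cvg_nneseries => k _ _; rewrite lee_fin.
under eq_integral => x _ do rewrite gee0_abs //.
rewrite integral_nneseries //.
apply: (@le_lt_trans _ _ ((area Q + C) * 4)%:E); last by rewrite ltry.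
apply: lime_le.
  by apply: is_cvg_nneseries => k _ _; apply: integral_ge0 => x _; rewrite lee_fin.
apply: nearW => n; apply: (@le_trans _ _ (\sum_(0 <= k < n) ((area Q + C) * (3 / 4) ^+ k)%:E)%E).
  by apply: lee_sum => k _; exact: int_dE.
rewrite sumEFin lee_fin -mulr_sumr ler_wpM2l //.
  by rewrite addr_ge0 // ltW // area_gt0.
rewrite big_mkord; have := subrX1 (3 / 4 : R) n.
have : 0 <= (3 / 4 : R) ^+ n by rewrite exprn_ge0.
by move: (\sum_(_ < _) _) ((3 / 4) ^+ n) => a b; lra.
Qed.

Let partial_S n x : (`|E n x - avg f Q|%:E <= S x)%E.
Proof.
apply: (@le_trans _ _ (\sum_(0 <= k < n) `|dE k x|%:E)%E).
  rewrite sumEFin lee_fin.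
  have -> : E n x - avg f Q = \sum_(0 <= k < n) dE k x.
    by rewrite (telescope_sumr (fun k => E k x)) ?leq0n.
  exact: ler_norm_sum.
by apply: nneseries_lim_ge => k _ _; rewrite lee_fin.
Qed.

Let h (x : T2) : \bar R := limn_esup (fun k => (E k x)%:E).

Let cvg_h x : S x \is a fin_num -> (E k x)%:E @[k --> \oo] --> h x.
Proof.
move=> Sx; suff [l El] : exists l : R, E k x @[k --> \oo] --> l.
  have El' : (E k x)%:E @[k --> \oo] --> l%:E by apply: cvg_EFin; [exact: nearW|exact: El].
  by rewrite /h (cvg_limn_einf_sup El').2.
have cn : cvgn (series (fun k => dE k x)).
  apply: normed_cvg; apply: nondecreasing_is_cvgn.
    by apply: nondecreasing_series => k _ _; exact: normr_ge0.
  exists (fine (S x)) => _ [n _ <-].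
  rewrite -lee_fin fineK // /series /= -sumEFin.
  by apply: nneseries_lim_ge => k _ _; rewrite lee_fin.
have /cvg_ex[l cl] := cn.
exists (avg f Q + l).
have -> : (fun k => E k x) = (fun n => avg f Q + series (fun k => dE k x) n).
  by apply/funext => n; rewrite /series /= (telescope_sumr (fun k => E k x)) // addrC subrK.
by apply: cvgD => //; exact: cvg_cst.
Qed.

Let ae_fin : {ae mu, forall x, bset Q x -> S x \is a fin_num}.
Proof. exact: integrable_ae. Qed.

(** The indicator of the generation-[k] boxes contained in [U]: it tends to
the indicator of [U] for open [U], and against it [E k] and [f] have the same
integral.  This identifies the limit of the averages with [f]. *)
Let chi (U : set T2) k (x : T2) : R := (asbool (bset (node alt k Q x) `<=` U))%:R.

Let int_chi U k : (\int[mu]_(x in bset Q) (chi U k x * E k x)%:E =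
   \int[mu]_(x in bset Q) (chi U k x * f x)%:E)%E.
Proof.
have [iF iG _ _] := cf.
pose Phi P : R := (asbool (bset P `<=` U))%:R.
have i1 : mu.-integrable (bset Q) (EFin \o (fun=> 1 : R)).
  apply/integrableP; split; first exact: measurable_cst.
  rewrite integral_cst //= normr1 mul1e [mu _]mu_bset //; exact: ltry.
have [iA eA] := int_node alt k (fun P => Phi P * avg f P) wQ i1.
have [iB eB] := int_node alt k Phi wQ iF.
have : \int[mu]_(x in bset Q) (chi U k x * E k x) =
   \int[mu]_(x in bset Q) (chi U k x * f x).
  rewrite [RHS]eB; under eq_Rintegral do rewrite -[_ * E k _]mulr1.
  rewrite [LHS]eA !big_seq; apply: eq_bigr => P HP.
  have wP := wf_nodes wQ HP.
  rewrite Rintegral_cst; last exact: measurable_bset.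
  rewrite mul1r [mu _]mu_bset //= /avg -mulrA divfK // gt_eqF //; exact: area_gt0.
have iA' : mu.-integrable (bset Q) (fun x => (chi U k x * E k x)%:E).
  by apply: eq_integrable iA => // x _; rewrite /= mulr1.
rewrite /Rintegral => e.
by rewrite -(fineK (integrable_fin_num mQ iA')) -(fineK (integrable_fin_num mQ iB)) e.
Qed.

Let lim_chi (U : set T2) : measurable U ->
  (forall x, bset Q x -> U x -> \forall k \near \oo, bset (node alt k Q x) `<=` U) ->
  mu.-integrable (bset Q) (fun x => (\1_U x)%:E * h x)%E /\
  (\int[mu]_(x in bset Q) ((\1_U x)%:E * h x) =
   \int[mu]_(x in bset Q) ((\1_U x)%:E * (f x)%:E))%E.
Proof.
move=> mU oU; have [iF iG _ _] := cf.
have cchi x : bset Q x -> \forall k \near \oo, chi U k x = (\1_U x : R).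
  move=> xQ; have [xU|xU] := pselect (U x).
    near=> k; rewrite /chi indicE mem_set // asboolT //.
    by near: k; exact: oU.
  apply: nearW => k; rewrite /chi indicE memNset // asboolF // => sub.
  by apply: xU; apply: sub; exact: node_mem.
have chi01 k x : `|chi U k x| <= 1 by rewrite /chi; case: asbool; rewrite ?normr1 ?normr0.
have mchi k : measurable_fun (bset Q) (chi U k).
  exact: (measurable_node alt k (fun P => (asbool (bset P `<=` U))%:R : R)).
have mind : measurable_fun (bset Q) (\1_U : T2 -> R) by exact: measurable_indic.
have mh : measurable_fun (bset Q) h.
  by apply: measurable_fun_limn_esup => k; apply/measurable_EFinP.
have mf : measurable_fun (bset Q) f by apply/measurable_EFinP; exact: measurable_int iF.
have mF k : measurable_fun (bset Q) (fun x => (chi U k x * E k x)%:E).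
  by apply/measurable_EFinP; exact: measurable_funM.
have mF' k : measurable_fun (bset Q) (fun x => (chi U k x * f x)%:E).
  by apply/measurable_EFinP; exact: measurable_funM.
pose gg (x : T2) : \bar R := (`|avg f Q|%:E + S x)%E.
have igg : mu.-integrable (bset Q) gg.
  apply: integrableD => //.
  apply/integrableP; split; first exact: measurable_cst.
  by rewrite integral_cst //= normr_id [mu _]mu_bset // -EFinM ltry.
have mi : measurable_fun (bset Q) (fun x => (\1_U x : R)%:E) by exact/measurable_EFinP.
have [||||i1 _ c1] := @dominated_convergence _ _ R mu (bset Q) mQ
  (fun k x => (chi U k x * E k x)%:E) (fun x => (\1_U x)%:E * h x)%E gg mF.
- exact: emeasurable_funM.
- apply: filterS ae_fin => x Sx xQ.
  have ch : ((\1_U x : R)%:E * (E k x)%:E)%E @[k --> \oo] --> ((\1_U x)%:E * h x)%E.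
    by apply: cvgeZl => //; exact/cvg_h/Sx.
  apply: cvg_trans ch; apply: near_eq_cvg.
  by apply: filterS (cchi _ xQ) => k <-; rewrite EFinM.
- exact: igg.
- apply: aeW => x k xQ; rewrite EFinM abseM.
  apply: (@le_trans _ _ (1 * `|(E k x)%:E|)%E).
    by apply: lee_wpmul2r => //; rewrite lee_fin.
  rewrite mul1e /gg; apply: (@le_trans _ _ (`|avg f Q|%:E + `|E k x - avg f Q|%:E)%E).
    rewrite /= -EFinD lee_fin; apply: le_trans (ler_normD _ _).
    by rewrite addrC subrK.
  by apply: leeD.
have [||||_ _ c2] := @dominated_convergence _ _ R mu (bset Q) mQ
  (fun k x => (chi U k x * f x)%:E) (fun x => (\1_U x)%:E * (f x)%:E)%E
  (fun x => `|f x|%:E) mF'.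
- by apply: emeasurable_funM => //; exact/measurable_EFinP.
- apply: aeW => x xQ.
  have ch : ((\1_U x : R)%:E * (f x)%:E)%E @[k --> \oo] --> ((\1_U x)%:E * (f x)%:E)%E.
    exact: cvg_cst.
  apply: cvg_trans ch; apply: near_eq_cvg.
  by apply: filterS (cchi _ xQ) => k <-; rewrite EFinM.
- exact: integrable_norm.
- apply: aeW => x k xQ; rewrite EFinM abseM /= -EFinM lee_fin.
  by rewrite -[leRHS]mul1r ler_wpM2r.
split=> //; apply: (cvg_unique _ c1) => //.
suff -> : (fun k => \int[mu]_(x in bset Q) (chi U k x * E k x)%:E)%E =
  (fun k => \int[mu]_(x in bset Q) (chi U k x * f x)%:E)%E by exact: c2.
by apply/funext => k /=; exact: int_chi.
Unshelve. all: by end_near. Qed.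

Let indic_int (U : set T2) (g : T2 -> \bar R) :
  (\int[mu]_(x in bset Q) ((\1_U x : R)%:E * g x) = \int[mu]_(x in bset Q `&` U) g x)%E.
Proof.
rewrite [RHS]integral_mkcondr; apply: eq_integral => x _; rewrite /patch indicE.
by case: ifP => _; rewrite ?mul1e ?mul0e.
Qed.

Let small k i x : bset Q x -> forall y, bset (node alt k Q x) y ->
  `|crd i x - crd i y| ^+ 2 <= aspect Q * area Q / 2 ^+ k.
Proof.
move=> xQ y; have := node_mem alt k wQ xQ; rewrite !bsetE.
have := alt_len_le i wQ (node_nodes alt k Q x); move: (node alt k Q x) => P.
move=> lP xP yP; apply: le_trans lP.
have {xP yP} : `|crd i x - crd i y| <= len i P.
  rewrite ler_norml /len.
  by case: i; move: xP yP => /andP[/andP[? ?] /andP[? ?]] /andP[/andP[? ?] /andP[? ?]] /=;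
    apply/andP; split; lra.
by move=> H; rewrite lerXn2r ?nnegrE // (le_trans _ H).
Qed.

Let near_small (e : R) : 0 < e ->
  \forall k \near \oo, aspect Q * area Q / 2 ^+ k < e.
Proof.
move=> e0.
have : (aspect Q * area Q) * (1 / 2) ^+ k @[k --> \oo] --> (0 : R).
  by apply: cvg_geometric; rewrite ger0_norm; lra.
move=> /cvgr_lt /(_ _ e0); apply: filterS => k.
by rewrite div1r exprVn.
Qed.

Let open_quad a b x : bset Q x -> quad a b x ->
  \forall k \near \oo, bset (node alt k Q x) `<=` quad a b.
Proof.
move=> xQ; rewrite /quad /= !in_itv /= !andbT => -[ax bx].
have ea : 0 < (x.1 - a) ^+ 2 by rewrite exprn_gt0 // subr_gt0.
have eb : 0 < (x.2 - b) ^+ 2 by rewrite exprn_gt0 // subr_gt0.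
near=> k => y yP /=; rewrite !in_itv /= !andbT.
have h1 : aspect Q * area Q / 2 ^+ k < (x.1 - a) ^+ 2 by near: k; exact: near_small.
have h2 : aspect Q * area Q / 2 ^+ k < (x.2 - b) ^+ 2 by near: k; exact: near_small.
have s1 := le_lt_trans (small false xQ yP) h1.
have s2 := le_lt_trans (small true xQ yP) h2.
rewrite ltr_pXn2r ?nnegrE // ?subr_ge0 ?ltW // in s1.
rewrite ltr_pXn2r ?nnegrE // ?subr_ge0 ?ltW // in s2.
move: s1 s2; rewrite !ltr_norml /= => /andP[? ?] /andP[? ?].
by split; lra.
Unshelve. all: by end_near. Qed.

(** The limit exists because [f] has finite energy, and it has the same
integrals as [f] over quadrants. *)
Theorem Ecell_cvg :
  {ae mu, forall x, bset Q x -> Ecell f alt k Q x @[k --> \oo] --> f x}.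
Proof.
have [iF iG _ _] := cf.
have [|ih eh] := @lim_chi setT measurableT.
  by move=> x _ _; exact: nearW.
have ih' : mu.-integrable (bset Q) h.
  by apply: eq_integrable ih => // x _; rewrite indicT mul1e.
have : ae_eq mu (bset Q) h (EFin \o f).
  apply: quads_ae_eq => //.
    move: eh; rewrite !indic_int setIT; exact.
  move=> a b; have [|_] := @lim_chi (quad a b) (measurable_quad a b).
    by move=> x; exact: open_quad.
  by rewrite !indic_int.
apply: filterS2 ae_fin => x Sx hf xQ.
have := cvg_h (Sx xQ); rewrite hf // => /fine_cvg.
exact.
Qed.

End Fix.

(** Fatou's lemma carries bounds on the dyadic averages over to [f]. *)
Lemma fatou_Ecell f G V Q (B : R) : wf Q -> ctrl f G Q ->
    measurable_fun setT V -> (forall x, 0 <= V x) ->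
    (forall D, (\int[mu]_(x in bset Q) ((Ecell f alt D Q x - avg f Q) ^+ 2 * V x)%:E
      <= B%:E)%E) ->
  (\int[mu]_(x in bset Q) ((f x - avg f Q) ^+ 2 * V x)%:E <= B%:E)%E.
Proof.
move=> wQ cf mV V0 EB; have [iF _ _ _] := cf.
pose u D (x : T2) : \bar R := ((Ecell f alt D Q x - avg f Q) ^+ 2 * V x)%:E.
have mQ := measurable_bset Q.
have mVQ : measurable_fun (bset Q) V by exact: measurable_funTS.
have mf : measurable_fun (bset Q) f by apply/measurable_EFinP; exact: measurable_int iF.
have mu_ D : measurable_fun (bset Q) (u D).
  apply/measurable_EFinP; apply: measurable_funM => //; apply: (measurable_funX 2).
  by apply: measurable_funB; [exact: measurable_Ecell|exact: measurable_cst].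
have -> : (\int[mu]_(x in bset Q) ((f x - avg f Q) ^+ 2 * V x)%:E =
           \int[mu]_(x in bset Q) limn_einf (u ^~ x))%E.
  apply: ge0_ae_eq_integral => //.
  - apply/measurable_EFinP; apply: measurable_funM => //; apply: (measurable_funX 2).
    by apply: measurable_funB; [|exact: measurable_cst].
  - apply: (emeasurable_fun_cvg (fun n x => einfs (u ^~ x) n)).
      by move=> n; exact: measurable_fun_einfs.
    by move=> x _; rewrite limn_einf_lim; exact: is_cvg_einfs.
  - by move=> x _; rewrite lee_fin mulr_ge0 // sqr_ge0.
  - move=> x _; rewrite limn_einf_lim; apply: lime_ge; first exact: is_cvg_einfs.
    apply: nearW => n; apply: le_ereal_inf_tmp => _ [D _ <-].
    by rewrite lee_fin mulr_ge0 // sqr_ge0.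
  - apply: filterS (Ecell_cvg wQ cf) => x Ex xQ.
    have cu : u D x @[D --> \oo] --> ((f x - avg f Q) ^+ 2 * V x)%:E.
      apply: cvg_EFin; first exact: nearW.
      have cb : Ecell f alt D Q x - avg f Q @[D --> \oo] --> f x - avg f Q.
        by apply: cvgB; [exact: Ex|exact: cvg_cst].
      apply: cvgM; last exact: cvg_cst.
      exact: (cvgM cb cb).
    by rewrite (cvg_limn_einf_sup cu).1.
apply: le_trans; first apply: fatou => //.
  by move=> D x _; rewrite lee_fin mulr_ge0 // sqr_ge0.
rewrite limn_einf_lim; apply: lime_le; first exact: is_cvg_einfs.
by apply: nearW => D; apply: le_trans (EB D); apply: ereal_inf_lbound; exists D => /=.
Qed.

Theorem poincare f G Q : wf Q -> ctrl f G Q ->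
  (\int[mu]_(x in bset Q) ((f x - avg f Q) ^+ 2)%:E
     <= (8 * aspect Q * area Q * gint G Q)%:E)%E.
Proof.
move=> wQ cf; under eq_integral => x _ do rewrite -[_ ^+ 2]mulr1.
apply: (@fatou_Ecell f G (fun=> 1)) => //.
move=> D; under eq_integral => x _ do rewrite mulr1.
exact: alt_energy.
Qed.

End Conv.

(** * Smooth tents and plateaux *)

Section Tents.
Context {R : realType}.

Lemma smoothD (u v : R -> R) : smooth u -> smooth v -> smooth (fun x => u x + v x).
Proof. by move=> su sv k; exact: smooth_uptoD. Qed.

Lemma smoothZ (c : R) (u : R -> R) : smooth u -> smooth (fun x => c * u x).
Proof. by move=> su k; apply: smooth_uptoM => //; exact: smooth_upto_cst. Qed.

Lemma smooth_affine_comp (a b : R) (u : R -> R) :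
  smooth u -> smooth (fun x => u (a * x + b)).
Proof.
move=> su k; apply: (@smooth_upto_comp _ _ u (fun x => a * x + b)) => //.
exact: smooth_upto_affine.
Qed.

Lemma smooth_continuous (u : R -> R) : smooth u -> continuous u.
Proof.
move=> /smooth_derive[du _] x; have [d _] := du x.
exact/differentiable_continuous/derivable1_diffP.
Qed.

(** A smooth ramp, its derivative (a smooth step), and bounds that survive
rescaling of the variable. *)
Lemma smooth_step_pair : exists P p : R -> R, [/\ smooth P /\ smooth p,
  (forall x : R, is_derive x 1 P (p x)),
  (forall x, x <= 0 -> P x = 0) /\ (forall x, 1 <= x -> P x = x),
  (forall x, x <= 0 -> p x = 0) /\ (forall x, 1 < x -> p x = 1) &
  exists M, 1 <= M /\ forall x, `|p x| <= M /\ `|P x| <= M + `|x| ].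
Proof.
have [P [sP P0 P1]] := @smooth_relu R.
have [dP sp] := smooth_derive sP.
have p0' x : x < 0 -> (derive1 P) x = 0.
  move=> x0; rewrite derive1E.
  have -> : 'D_1 P x = 'D_1 (cst 0) x.
    by apply: near_eq_derive; near=> y; rewrite P0 //; near: y; exact: lt_le_nbhsl.
  by rewrite derive_cst.
have p0 x : x <= 0 -> (derive1 P) x = 0.
  rewrite le_eqVlt => /predU1P[->|]; last exact: p0'.
  apply/eqP/negPn/negP => n0.
  have e0 : 0 < `|(derive1 P) 0| by rewrite normr_gt0.
  have /cvgrPdist_lt /(_ _ e0) := smooth_continuous sp (x := 0).
  move=> /nbhs_ballP[r /= r0] /(_ (- (r / 2))); rewrite /ball /= opprK add0r.
  rewrite (p0' (- (r / 2))); last by rewrite oppr_lt0 divr_gt0.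
  rewrite subr0 ltxx gtr0_norm ?divr_gt0 //.
  by move=> /(_ _)/negP; apply; lra.
have p1 x : 1 < x -> (derive1 P) x = 1.
  move=> x1; rewrite derive1E.
  have -> : 'D_1 P x = 'D_1 id x.
    by apply: near_eq_derive; near=> y; rewrite P1 //; near: y; exact: lt_le_nbhsr.
  by rewrite derive_id.
have bnd (u : R -> R) : continuous u ->
    exists2 M, 0 <= M & forall x, 0 <= x <= 1 -> `|u x| <= M.
  move=> cu; have cu' : {within `[0, 1], continuous (fun x => `|u x|)}.
    apply: continuous_subspaceT => x.
    by apply: continuous_comp; [exact: cu|exact: norm_continuous].
  have [c _ Hc] := EVT_max ler01 cu'.
  by exists `|u c| => // x x01; apply: Hc; rewrite in_itv.
have [M1 M10 HM1] := bnd _ (smooth_continuous sp).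
have [M2 M20 HM2] := bnd _ (smooth_continuous sP).
exists P, (derive1 P); split=> //.
exists (1 + M1 + M2); split; first by lra.
move=> x; have [x0|x0] := ltP x 0.
  by rewrite p0 ?P0 ?(ltW x0) // normr0; split; rewrite ?addr_ge0 //; lra.
have [x1|x1] := ltP 1 x.
  by rewrite p1 // P1 ?(ltW x1) // normr1; split; lra.
have H1 : `|(derive1 P) x| <= M1 by apply: HM1; rewrite x0.
have H2 : `|P x| <= M2 by apply: HM2; rewrite x0.
split; first by lra.
by have := normr_ge0 x; lra.
Unshelve. all: by end_near. Qed.

(** Vanishing outside a compact subinterval of [`]a, b[`]. *)
Definition vanish_near (a b : R) (u : R -> R) := exists a' b',
  [/\ a < a', b' < b & forall x, ~~ (a' <= x <= b') -> u x = 0].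

Lemma cvg_harm (e : R) : e / n.+1%:R @[n --> \oo] --> (0 : R).
Proof.
rewrite -[X in _ --> X](mulr0 e); apply: cvgMr.
have := @cvg_harmonic R; exact.
Qed.

Lemma near_harm (e c : R) : 0 < c -> \forall n \near \oo, e / n.+1%:R < c.
Proof. by move=> c0; have /cvgr_lt := cvg_harm e; exact. Qed.

(** A rising step just after [c] minus a rising step just before [d]; the
widths shrink with [n]. *)
Lemma plateaux (c d : R) : c < d -> exists B : nat -> R -> R,
  [/\ forall n, smooth (B n), forall n, vanish_near c d (B n),
    exists M, forall n x, `|B n x| <= M &
    forall x, c < x < d -> B n x @[n --> \oo] --> (1 : R)].
Proof.
move=> cd; have [P [p [[sP sp] _ _ [p0 p1] [M [M1 HM]]]]] := smooth_step_pair.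
pose e : R := (d - c) / 8; have e0 : 0 < e by rewrite /e; lra.
pose dl n : R := e / n.+1%:R.
have dl0 n : 0 < dl n by rewrite divr_gt0.
have dle n : dl n <= e by rewrite ler_pdivrMr // ler_peMr ?ler1n // ltW.
pose B n x := p ((dl n)^-1 * x + (- (c + dl n) / dl n)) +
        -1 * p ((dl n)^-1 * x + (- (d - 2 * dl n) / dl n)).
have aff n x t : (dl n)^-1 * x + - t / dl n = (x - t) / dl n.
  by rewrite mulrBl mulNr mulrC.
exists B; split.
- move=> n; apply: smoothD; first exact: smooth_affine_comp.
  by apply: smoothZ; exact: smooth_affine_comp.
- move=> n; exists (c + dl n), (d - dl n / 2); have := dl0 n; have := dle n => h1 h2.
  have lt0 y : y < 0 -> y / dl n < 0 by move=> y0; rewrite pmulr_llt0 ?invr_gt0.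
  have gt1 y : dl n < y -> 1 < y / dl n by move=> y1; rewrite ltr_pdivlMr ?mul1r.
  rewrite /e in h1; split; [lra|lra|move=> x; rewrite negb_and -!ltNge /B !aff].
  case/orP => hx.
    by rewrite !p0 ?mulr0 ?addr0 //; apply/ltW/lt0; lra.
  by rewrite !p1 ?mulr1 ?subrr //; apply: gt1; lra.
- exists (M + M) => n x; apply: (le_trans (ler_normD _ _)).
  by rewrite normrM normrN1 mul1r; apply: lerD; exact: (HM _).1.
- move=> x /andP[cx xd].
  have c1 : (fun _ : nat => 1 : R) @ \oo --> (1 : R) by exact: cvg_cst.
  apply: cvg_trans c1; apply: near_eq_cvg; near=> n.
  rewrite /B !aff p1 ?p0 ?mulr0 ?addr0 //.
    rewrite pmulr_lle0 ?invr_gt0 // subr_le0.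
    have : dl n < (d - x) / 2 by near: n; apply: near_harm; lra.
    by lra.
  rewrite ltr_pdivlMr // mul1r.
  have : dl n < (x - c) / 2 by near: n; apply: near_harm; lra.
  by lra.
Unshelve. all: by end_near. Qed.

(** Smooth approximations of the tent over [[a, b]] with apex [m], as
combinations of three ramps.  The slopes [al] and [be] are corrected so that the
combination vanishes near both ends, and differ from [(m - a)^-1] and
[(b - m)^-1] by a vanishing amount. *)
Lemma tents (a m b : R) : a < m < b -> exists A A' : nat -> R -> R,
  [/\ forall n, smooth (A n) /\ smooth (A' n) /\
        (forall x : R, is_derive x 1 (A n) (A' n x)),
    forall n, vanish_near a b (A n) /\ vanish_near a b (A' n),
    exists M, forall n x, a < x < b -> `|A n x| <= M /\ `|A' n x| <= M &
    forall x, a < x < b ->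
      (A n x @[n --> \oo] -->
        (if x <= m then (x - a) / (m - a) else (b - x) / (b - m))) /\
      (A' n x @[n --> \oo] --> (if x <= m then (m - a)^-1 else - (b - m)^-1))].
Proof.
move=> /andP[am mb].
have [P [p [[sP sp] dP [P0 P1] [p0 p1] [M [M1 HM]]]]] := smooth_step_pair.
have [e [e0 ea eb]] : exists e : R, [/\ 0 < e, 8 * e <= m - a & 8 * e <= b - m].
  exists (Num.min (m - a) (b - m) / 8); split.
  - by rewrite divr_gt0 // lt_min !subr_gt0 am.
  - by rewrite mulrC divfK // ge_min lexx.
  - by rewrite mulrC divfK // ge_min lexx orbT.
have [dl [dl0 dle cd]] : exists dl : nat -> R, [/\ forall n, 0 < dl n,
    forall n, dl n <= e & dl n @[n --> \oo] --> (0 : R)].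
  exists (fun n => e / n.+1%:R); split=> [n|n|]; first by rewrite divr_gt0.
    by rewrite ler_pdivrMr // ler_peMr ?ler1n // ltW.
  exact: cvg_harm.
have near_dl c : 0 < c -> \forall n \near \oo, dl n < c.
  by move=> c0; have /cvgr_lt := cd; exact.
pose al n : R := (m - a - dl n)^-1.
pose be n : R := (b - 2 * dl n - m)^-1.
pose ar n t x := (dl n)^-1 * x + (- t / dl n).
have aff n x t : ar n t x = (x - t) / dl n.
  by rewrite /ar mulrBl mulNr mulrC.
have lt0 n y : y <= 0 -> y / dl n <= 0 by move=> y0; rewrite pmulr_lle0 ?invr_gt0.
have gt1 n y : dl n < y -> 1 < y / dl n by move=> y1; rewrite ltr_pdivlMr ?mul1r.
pose A n x := (al n * dl n) * P (ar n (a + dl n) x) +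
  (- (al n + be n) * dl n) * P (ar n m x) + (be n * dl n) * P (ar n (b - 2 * dl n) x).
pose A' n x := al n * p (ar n (a + dl n) x) +
  - (al n + be n) * p (ar n m x) + be n * p (ar n (b - 2 * dl n) x).
have al0 n : 0 < al n by rewrite invr_gt0; have := dle n; lra.
have be0 n : 0 < be n by rewrite invr_gt0; have := dle n; lra.
have Pbig n t x : dl n < x - t -> dl n * P (ar n t x) = x - t.
  by move=> h; rewrite aff P1 ?(ltW (gt1 _ _ h)) // mulrC divfK // gt_eqF.
have Psml n t x : x <= t -> P (ar n t x) = 0.
  by move=> h; rewrite aff P0 // lt0 // subr_le0.
have pbig n t x : dl n < x - t -> p (ar n t x) = 1.
  by move=> h; rewrite aff p1 // gt1.
have psml n t x : x <= t -> p (ar n t x) = 0.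
  by move=> h; rewrite aff p0 // lt0 // subr_le0.
exists A, A'; split.
- move=> n; split; [|split].
  + by apply: smoothD; [apply: smoothD|]; apply: smoothZ; exact: smooth_affine_comp.
  + by apply: smoothD; [apply: smoothD|]; apply: smoothZ; exact: smooth_affine_comp.
  + move=> x.
    have dq (c t : R) : is_derive x 1 (fun x : R => (c * dl n) * P (ar n t x))
        (c * p (ar n t x)).
      have d1 : is_derive x 1 (fun x : R => (dl n)^-1 * x + (- t / dl n)) (dl n)^-1.
        have := is_deriveD (is_deriveM (is_derive_cst (dl n)^-1 x 1)
          (is_derive_id x (1 : R))) (is_derive_cst (- t / dl n) x 1).
        by rewrite /GRing.scale /= mulr1 mulr0 !addr0.
      have d2 := is_derive1_comp (dP (ar n t x)) d1.
      have d3 := is_deriveM (is_derive_cst (c * dl n) x (1 : R)) d2.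
      apply: (is_derive_eq d3).
      by rewrite /GRing.scale /= mulr0 addr0; field; rewrite gt_eqF.
    exact: (is_deriveD (is_deriveD (dq _ _) (dq _ _)) (dq _ _)).
- move=> n; have h1 := dl0 n; have h2 := dle n.
  suff V x : ~~ (a + dl n <= x <= b - dl n / 2) -> A n x = 0 /\ A' n x = 0.
    by split; exists (a + dl n), (b - dl n / 2); split; try lra; move=> x /V[].
  rewrite negb_and -!ltNge /A /A' => /orP[] hx.
    by rewrite !Psml ?psml ?mulr0 ?addr0; [split|lra..].
  rewrite -!mulrA !Pbig ?pbig; [|lra..]; split; last by ring.
  by rewrite /al /be; field; lra.
- pose K := (m - a - e)^-1 + (b - 2 * e - m)^-1.
  have alK n : al n <= (m - a - e)^-1.
    by rewrite lef_pV2 ?posrE; have := dle n; lra.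
  have beK n : be n <= (b - 2 * e - m)^-1.
    by rewrite lef_pV2 ?posrE; have := dle n; lra.
  pose N := e * M + 2 * (b - a).
  have N0 : 0 <= N by rewrite /N addr_ge0 ?mulr_ge0; lra.
  have bP n t x : a < x < b -> a <= t <= b -> dl n * `|P (ar n t x)| <= N.
    move=> xab tab; apply: (@le_trans _ _ (dl n * (M + `|ar n t x|))).
      by rewrite ler_pM2l //; exact: (HM _).2.
    rewrite aff mulrDr normrM [`|(dl n)^-1|]gtr0_norm ?invr_gt0 //.
    have -> : dl n * (`|x - t| / dl n) = `|x - t| by field; rewrite gt_eqF.
    apply: lerD; first by rewrite ler_wpM2r //; lra.
    by rewrite ler_norml; apply/andP; split; lra.
  exists (2 * K * (N + M)) => n x xab; have hd := dle n; have hd0 := dl0 n.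
  have [aln ben] := (al0 n, be0 n); have [alk bek] := (alK n, beK n).
  have Ksum : al n + (al n + be n) + be n <= 2 * K by rewrite /K; lra.
  split.
    apply: (@le_trans _ _ ((al n + (al n + be n) + be n) * N)); last first.
      apply: ler_pM => //; lra.
    rewrite /A !mulrDl; apply: (le_trans (ler_normD _ _)); apply: lerD.
      apply: (le_trans (ler_normD _ _)); apply: lerD.
        rewrite -mulrA normrM (gtr0_norm aln) ler_pM2l // normrM gtr0_norm //.
        by apply: bP => //; lra.
      rewrite -mulrDl -mulrA normrM normrN (gtr0_norm (addr_gt0 aln ben)) ler_pM2l ?addr_gt0 //.
      by rewrite normrM gtr0_norm //; apply: bP => //; lra.
    rewrite -mulrA normrM (gtr0_norm ben) ler_pM2l // normrM gtr0_norm //.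
    by apply: bP => //; lra.
  apply: (@le_trans _ _ ((al n + (al n + be n) + be n) * M)); last first.
    apply: ler_pM => //; lra.
  rewrite /A' !mulrDl; apply: (le_trans (ler_normD _ _)); apply: lerD.
    apply: (le_trans (ler_normD _ _)); apply: lerD.
      by rewrite normrM (gtr0_norm aln) ler_pM2l //; exact: (HM _).1.
    rewrite -mulrDl normrM normrN (gtr0_norm (addr_gt0 aln ben)) ler_pM2l ?addr_gt0 //.
    exact: (HM _).1.
  by rewrite normrM (gtr0_norm ben) ler_pM2l //; exact: (HM _).1.
move=> x /andP[ax xb].
have cal : al n @[n --> \oo] --> (m - a)^-1.
  rewrite -[m - a]subr0; apply: cvgV; first by rewrite subr0; lra.
  by apply: cvgB => //; exact: cvg_cst.
have cbe : be n @[n --> \oo] --> (b - m)^-1.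
  have -> : b - m = b - 2 * 0 - m by ring.
  apply: cvgV; first by lra.
  apply: cvgB; last exact: cvg_cst.
  by apply: cvgB; [exact: cvg_cst|apply: cvgM => //; exact: cvg_cst].
have n1 : \forall n \near \oo, dl n < (x - a) / 2 by apply: near_dl; lra.
have n2 : \forall n \near \oo, dl n < (b - x) / 2 by apply: near_dl; lra.
have cA1 : al n * (x - a - dl n) @[n --> \oo] --> (x - a) / (m - a).
  rewrite mulrC; apply: cvgM => //; rewrite -[x - a]subr0.
  by apply: cvgB => //; rewrite subr0; exact: cvg_cst.
case: (leP x m) => xm.
  split.
    apply: cvg_trans cA1; apply: near_eq_cvg; near=> n.
    have h1 : dl n < (x - a) / 2 by near: n.
    have h2 : dl n < (b - x) / 2 by near: n.
    rewrite /A -mulrA Pbig; last by lra.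
    by rewrite !Psml ?mulr0 ?addr0 //; [congr (_ * _); ring|lra].
  apply: cvg_trans cal; apply: near_eq_cvg; near=> n.
  have h1 : dl n < (x - a) / 2 by near: n.
  have h2 : dl n < (b - x) / 2 by near: n.
  rewrite /A' pbig; last by lra.
  by rewrite !psml ?mulr0 ?addr0 ?mulr1 //; lra.
have n3 : \forall n \near \oo, dl n < x - m by apply: near_dl; lra.
split.
  have cA : al n * (x - a - dl n) - (al n + be n) * (x - m) @[n --> \oo] -->
      (b - x) / (b - m).
    have -> : (b - x) / (b - m) =
        (x - a) / (m - a) - ((m - a)^-1 + (b - m)^-1) * (x - m) by field; lra.
    by apply: cvgB => //; apply: cvgM; [exact: cvgD|exact: cvg_cst].
  apply: cvg_trans cA; apply: near_eq_cvg; near=> n.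
  have h1 : dl n < (x - a) / 2 by near: n.
  have h2 : dl n < (b - x) / 2 by near: n.
  have h3 : dl n < x - m by near: n.
  rewrite /A (Psml n (b - 2 * dl n)) ?mulr0 ?addr0; last by lra.
  rewrite -!mulrA !Pbig; [|lra..].
  by rewrite mulNr; congr (_ * _ - _); ring.
have cA : al n - (al n + be n) @[n --> \oo] --> - (b - m)^-1.
  have -> : - (b - m)^-1 = (m - a)^-1 - ((m - a)^-1 + (b - m)^-1) by ring.
  by apply: cvgB => //; exact: cvgD.
apply: cvg_trans cA; apply: near_eq_cvg; near=> n.
have h1 : dl n < (x - a) / 2 by near: n.
have h2 : dl n < (b - x) / 2 by near: n.
have h3 : dl n < x - m by near: n.
rewrite /A' (psml n (b - 2 * dl n)) ?mulr0 ?addr0; last by lra.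
by rewrite !pbig ?mulr1 //; lra.
Unshelve. all: by end_near. Qed.

End Tents.

(** * Products of functions of one variable as test functions *)

Section Tensor.
Context {R : realType}.
Implicit Types (A B u : R -> R) (i : bool).

Definition eb i : R * R := if i then e2 R else e1 R.
Definition tens i A B (x : R * R) : R := A (crd i x) * B (crd (~~ i) x).

(** Only the restriction of [phi] to a line matters for a directional
derivative. *)
Lemma is_derive_line (phi : R * R -> R) u (x v : R * R) (t c du : R) :
    (forall h : R, phi (h *: v + x) = u (h + t) * c) ->
    is_derive t 1 u du -> is_derive x v phi (du * c).
Proof.
move=> phiE [du1 duE].
have phi0 : phi x = u t * c by have := phiE 0; rewrite scale0r !add0r.
have : (fun h : R => h^-1 *: ((phi \o shift x) (h *: v) - phi x)) @ 0^' --> du * c.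
  have -> : (fun h : R => h^-1 *: ((phi \o shift x) (h *: v) - phi x)) =
      (fun h : R => (h^-1 *: ((u \o shift t) (h *: (1 : R)) - u t)) * c).
    apply/funext => h /=; rewrite phiE phi0 -mulrBl /GRing.scale /= mulr1.
    by rewrite mulrA.
  by apply: cvgM; [rewrite -duE; exact: du1|exact: cvg_cst].
by move=> cv; split; [apply/cvg_ex; eexists; exact: cv|exact/cvg_lim].
Qed.

Lemma is_derive_tens i A A' B x : (forall t : R, is_derive t 1 A (A' t)) ->
  is_derive x (eb i) (tens i A B) (tens i A' B x).
Proof.
move=> dA; apply: (@is_derive_line _ A _ _ (crd i x)) => // h.
by rewrite /tens /eb; case: i => /=; rewrite ?mulr1 ?mulr0 ?add0r;
  rewrite /GRing.scale /= ?mulr1 ?mulr0 ?add0r.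
Qed.

Lemma tensC i A B : tens i A B = tens (~~ i) B A.
Proof. by apply/funext => x; rewrite /tens negbK mulrC. Qed.

Lemma continuous_crd i : continuous (fun x : R * R => crd i x).
Proof. by move=> x; case: i; [exact: cvg_snd|exact: cvg_fst]. Qed.

Lemma continuous_tens i A B : smooth A -> smooth B -> continuous (tens i A B).
Proof.
move=> sA sB x; apply: cvgM.
  apply: (@continuous_comp _ _ _ (fun x : R * R => crd i x) A).
    exact: continuous_crd.
  exact: smooth_continuous.
apply: (@continuous_comp _ _ _ (fun x : R * R => crd (~~ i) x) B).
  exact: continuous_crd.
exact: smooth_continuous.
Qed.

Lemma derive_tens i A B : smooth A -> 'D_(eb i) (tens i A B) = tens i (derive1 A) B.
Proof.
move=> /smooth_derive[dA _]; apply/funext => x.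
by have [_ ->] := is_derive_tens i B x dA.
Qed.

Lemma Ck_tens k i A B : smooth A -> smooth B -> Ck k (tens i A B).
Proof.
elim: k i A B => [|k IH] i A B sA sB; first exact: continuous_tens.
wlog -> : i A B sA sB / i = false.
  move=> W; case: i; last exact: W.
  by rewrite tensC; exact: W.
have [dA sA'] := smooth_derive sA; have [dB sB'] := smooth_derive sB.
split.
- exact: continuous_tens.
- by move=> x; have [] := is_derive_tens false B x dA.
- by move=> x; rewrite tensC; have [] := is_derive_tens true A x dB.
- by rewrite (derive_tens false) //; exact: IH.
- by rewrite tensC (derive_tens true) //; exact: IH.
Qed.

Lemma test_tens (Omega : set (R * R)) i A B (Q : @box R) :
    smooth A -> smooth B ->
    vanish_near (crd i Q).1 (crd i Q).2 A ->
    vanish_near (crd (~~ i) Q).1 (crd (~~ i) Q).2 B ->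
    `]Q.1.1, Q.1.2[ `*` `]Q.2.1, Q.2.2[ `<=` Omega ->
  test_function Omega (tens i A B).
Proof.
move=> sA sB [a [b [aQ bQ vA]]] [c [d [cQ dQ vB]]] QO.
pose I (j : bool) : R * R := if j == i then (a, b) else (c, d).
pose K : set (R * R) := `[(I false).1, (I false).2] `*` `[(I true).1, (I true).2].
have cK : compact K by apply: compact_setX; exact: segment_compact.
have clK : closed K by apply: compact_closed => //; exact: norm_hausdorff.
have sub : closure [set x | tens i A B x != 0] `<=` K.
  rewrite [X in _ `<=` X](closure_id K).1 //; apply: closureS => x /=.
  rewrite /tens mulf_eq0 negb_or => /andP[An Bn].
  have hA : a <= crd i x <= b by apply: contraNT An => /vA ->.
  have hB : c <= crd (~~ i) x <= d by apply: contraNT Bn => /vB ->.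
  by move: hA hB; rewrite /K /I; case: (i) => /= hA hB; split; rewrite /= in_itv.
have KO : K `<=` Omega.
  apply: subset_trans QO => x; rewrite /K /I /= !in_itv /=.
  move: aQ bQ cQ dQ; case: (i) => /= aQ bQ cQ dQ [] /andP[? ?] /andP[? ?];
    by split; apply/andP; split; lra.
split.
- by move=> k; exact: Ck_tens.
- by apply: subclosed_compact cK sub; exact: closed_closure.
- exact: subset_trans sub KO.
Qed.

End Tensor.

(** * Averages on the two sides of a cut *)

Section Cut.
Context {R : realType}.
Notation mu := (leb2 R).
Notation T2 := (measurableTypeR R * measurableTypeR R)%type.

Lemma Rint_dominated (D : set T2) (u : nat -> T2 -> R) (v g : T2 -> R) :
    measurable D -> (forall n, measurable_fun D (u n)) -> measurable_fun D v ->
    {ae mu, forall x, D x -> u n x @[n --> \oo] --> v x} ->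
    mu.-integrable D (EFin \o g) ->
    (forall n, {ae mu, forall x, D x -> `|u n x| <= g x}) ->
  mu.-integrable D (EFin \o v) /\
  (\int[mu]_(x in D) u n x) @[n --> \oo] --> \int[mu]_(x in D) v x.
Proof.
move=> mD mun mv uv ig ug.
have [|||||iv _ c] := @dominated_convergence _ _ R mu D mD (fun n x => (u n x)%:E)
  (EFin \o v) (EFin \o g).
- by move=> n; exact/measurable_EFinP.
- exact/measurable_EFinP.
- by apply: filterS uv => x cx xD; apply: cvg_EFin; [exact: nearW|exact: cx].
- exact: ig.
- have := ae_foralln ug; apply: filterS => x ux n xD.
  by rewrite lee_fin; exact: ux.
split=> //; apply: fine_cvg; rewrite fineK //; exact: integrable_fin_num.
Qed.

Lemma mu_line i (t : R) : mu [set x : T2 | crd i x = t] = 0.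
Proof.
have lt : lebesgue_measure ([set t] : set (measurableTypeR R)) = 0.
  exact: lebesgue_measure_set1.
have ms : measurable ([set t] : set (measurableTypeR R)).
  by rewrite -set_itv1; exact: measurable_itv.
case: i.
  have -> : [set x : T2 | crd true x = t] = setT `*` [set t].
    by apply/seteqP; split => x /=; [move=> ->|case].
  rewrite [LHS]product_measure1E //.
  by rewrite [X in (_ * X)%E](_ : _ = 0) ?mule0 //; exact: lt.
have -> : [set x : T2 | crd false x = t] = [set t] `*` setT.
  by apply/seteqP; split => x /=; [move=> ->|case].
rewrite [LHS]product_measure1E //.
by rewrite [X in (X * _)%E](_ : _ = 0) ?mul0e //; exact: lt.
Qed.

Lemma measurable_crd i : measurable_fun setT (fun x : T2 => crd i x : R).
Proof. by case: i; [exact: measurable_snd|exact: measurable_fst]. Qed.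

Lemma ae_line i (t : R) : {ae mu, forall x : T2, crd i x <> t}.
Proof.
exists [set x : T2 | crd i x = t]; split.
- rewrite -[X in measurable X]setTI.
  have ms : measurable ([set t] : set R) by rewrite -set_itv1; exact: measurable_itv.
  exact: (@measurable_crd i measurableT [set t] ms).
- exact: mu_line.
- by move=> x /=; apply: contra_notP.
Qed.

Lemma sqr_int_le (D : set T2) (h : T2 -> R) (a : R) : measurable D ->
    mu D = a%:E -> 0 < a -> mu.-integrable D (EFin \o h) ->
    mu.-integrable D (EFin \o (fun x => h x ^+ 2)) ->
  (\int[mu]_(x in D) `|h x|) ^+ 2 <= a * \int[mu]_(x in D) (h x ^+ 2).
Proof.
move=> mD Da a0 ih ih2; set I := \int[mu]_(x in D) `|h x|.
have in_ : mu.-integrable D (EFin \o (fun x => `|h x|)) by exact: integrable_norm.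
have ic (c : R) : mu.-integrable D (EFin \o (fun=> c)).
  apply/integrableP; split; first exact: measurable_cst.
  by rewrite integral_cst //= Da -EFinM ltry.
pose s := I / a.
have : 0 <= \int[mu]_(x in D) (h x ^+ 2 - (2 * s) * `|h x| + s ^+ 2).
  apply: Rintegral_ge0 => x _.
  have -> : h x ^+ 2 - (2 * s) * `|h x| + s ^+ 2 = (`|h x| - s) ^+ 2.
    rewrite -[h x ^+ 2]real_normK ?num_real //; ring.
  exact: sqr_ge0.
have iZ : mu.-integrable D (EFin \o (fun x => (2 * s) * `|h x|)).
  exact: (integrableZl mD (2 * s) in_).
have iB : mu.-integrable D (EFin \o (fun x => h x ^+ 2 - 2 * s * `|h x|)).
  by apply: eq_integrable (integrableB mD ih2 iZ).
rewrite RintegralD // RintegralB // RintegralZl // Rintegral_cst // Da /= -/I => H.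
rewrite -subr_ge0.
have -> : a * \int[mu]_(x in D) (h x ^+ 2) - I ^+ 2 =
  a * (\int[mu]_(x in D) h x ^+ 2 - 2 * s * I + s ^+ 2 * a).
  by rewrite /s; field; rewrite gt_eqF.
by rewrite mulr_ge0 // ltW.
Qed.

Section Ineq.
Variables (Omega : set (R * R)) (i : bool) (f g : R * R -> R) (Q : @box R) (m : R).
Hypothesis (fg : weak_derivative Omega (eb i) f g).
Hypothesis (wQ : wf Q).
Hypothesis (QO : `]Q.1.1, Q.1.2[ `*` `]Q.2.1, Q.2.2[ `<=` Omega).
Hypothesis (mQ : (crd i Q).1 < m < (crd i Q).2).
Let F : T2 -> R := f \_ Omega.
Let GG : T2 -> R := g \_ Omega.
Hypothesis (iF : mu.-integrable (bset Q) (EFin \o F)).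
Hypothesis (iGG : mu.-integrable (bset Q) (EFin \o GG)).
Hypothesis (iG2 : mu.-integrable (bset Q) (EFin \o (fun x => GG x ^+ 2))).

Let to_box (h : R * R -> R) A B :
  vanish_near (crd i Q).1 (crd i Q).2 A ->
  vanish_near (crd (~~ i) Q).1 (crd (~~ i) Q).2 B ->
  \int[mu]_(x in Omega) (h x * tens i A B x) =
  \int[mu]_(x in bset Q) ((h \_ Omega) x * tens i A B x).
Proof.
move=> [a [b [aQ bQ vA]]] [c [d [cQ dQ vB]]].
rewrite Rintegral_mkcond [RHS]Rintegral_mkcond.
congr (fine _); apply: eq_integral => x _; congr (_%:E).
rewrite /patch.
have [tx|tx] := eqVneq (tens i A B x) 0.
  by rewrite tx !mulr0 !if_same.
have hA : a <= crd i x <= b.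
  by apply: contraNT tx => /vA; rewrite /tens => ->; rewrite mul0r.
have hB : c <= crd (~~ i) x <= d.
  by apply: contraNT tx => /vB; rewrite /tens => ->; rewrite mulr0.
have xO : Omega x.
  apply: QO; move: hA hB aQ bQ cQ dQ; rewrite /setX /= !in_itv /=.
  by case: (i) => /= /andP[? ?] /andP[? ?] ? ? ? ?; split; apply/andP; split; lra.
have xQ : bset Q x.
  rewrite bsetE; move: hA hB aQ bQ cQ dQ.
  case: (i) => /= /andP[? ?] /andP[? ?] ? ? ? ?; apply/andP; split; apply/andP; split; lra.
by rewrite !mem_set.
Qed.

(** Testing the weak derivative against tent times plateau and passing to the
limit turns the left side into the integral of [f] against the slopes of the
tent, which is minus [len (~~ i) Q] times the jump of the averages.  The right
side is at most the integral of [|g|], as the tent lies between 0 and 1, and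
Cauchy-Schwarz concludes.  The hypotheses ask for integrability on [Q] only, so
[Q] may touch the boundary of [Omega]. *)
Lemma cut_ineq :
  jump i m F Q ^+ 2 <= len i Q / len (~~ i) Q * gint (fun x => GG x ^+ 2) Q.
Proof.
have [A [A' [dA vA [M HM] cA]]] := tents mQ.
have cd : (crd (~~ i) Q).1 < (crd (~~ i) Q).2.
  by have := len_gt0 (~~ i) wQ; rewrite subr_gt0.
have [B [sB vB [N HN] cB]] := plateaux cd.
pose a := (crd i Q).1; pose b := (crd i Q).2.
pose L (x : T2) : R := if crd i x <= m then (m - a)^-1 else - (b - m)^-1.
pose T (x : T2) : R :=
  if crd i x <= m then (crd i x - a) / (m - a) else (b - crd i x) / (b - m).
have mbQ := measurable_bset Q.
have weak n : \int[mu]_(x in bset Q) (F x * tens i (A' n) (B n) x) =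
            - \int[mu]_(x in bset Q) (GG x * tens i (A n) (B n) x).
  have [sA [sA' dAn]] := dA n; have [vAn vA'n] := vA n.
  have tt : test_function Omega (tens i (A n) (B n)).
    exact: (test_tens sA (sB n) vAn (vB n)).
  rewrite -!to_box //; have [_ /(_ _ tt) <-] := fg.
  apply: eq_Rintegral => x _.
  by have [_ ->] := is_derive_tens i (B n) x dAn.
have ae_in : {ae mu, forall x : T2, bset Q x ->
    (a < crd i x < b) /\ ((crd (~~ i) Q).1 < crd (~~ i) x < (crd (~~ i) Q).2)}.
  apply: filterS2 (ae_line i b) (ae_line (~~ i) (crd (~~ i) Q).2) => x.
  rewrite bsetE /a /b; case: (i) => /= /eqP n1 /eqP n2 /andP[/andP[h1 h2] /andP[h3 h4]];
    by rewrite h1 h3 !lt_neqAle n1 n2 h2 h4.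
have mten A1 B1 : smooth A1 -> smooth B1 -> measurable_fun (bset Q) (tens i A1 B1 : T2 -> R).
  move=> s1 s2; apply: measurable_funTS; apply: measurable_funM.
    apply: measurableT_comp (measurable_crd i).
    by apply: continuous_measurable_fun; exact: smooth_continuous.
  apply: measurableT_comp (measurable_crd (~~ i)).
  by apply: continuous_measurable_fun; exact: smooth_continuous.
have mF : measurable_fun (bset Q) F by apply/measurable_EFinP; exact: measurable_int iF.
have mGG : measurable_fun (bset Q) GG by apply/measurable_EFinP; exact: measurable_int iGG.
have mle : measurable_fun setT (fun x : T2 => crd i x <= m).
  by apply: measurable_fun_ler => //; exact: measurable_crd.
have mL : measurable_fun (bset Q) L.
  by apply: measurable_funTS; apply: measurable_fun_ifT.
have mT : measurable_fun (bset Q) T.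
  apply: measurable_funTS; apply: measurable_fun_ifT => //; apply: measurable_funM => //;
  by apply: measurable_funB => //; exact: measurable_crd.
have [|||||iL cL] := @Rint_dominated (bset Q) (fun n x => F x * tens i (A' n) (B n) x)
  (fun x => F x * L x) (fun x => (M * N) * `|F x|) mbQ.
- move=> n; apply: measurable_funM => //; apply: mten => //; exact: (dA n).2.1.
- exact: measurable_funM.
- apply: filterS ae_in => x Hx /Hx[h1 h2].
  apply: cvgM; first exact: cvg_cst.
  rewrite -[L x]mulr1; apply: cvgM; [exact: (cA _ h1).2|exact: cB].
- exact: (integrableZl mbQ (M * N) (integrable_norm iF)).
- move=> n; apply: filterS ae_in => x Hx /Hx[h1 h2].
  rewrite normrM mulrC ler_wpM2r // normrM.
  by apply: ler_pM => //; exact: (HM n _ h1).2.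
have [|||||iT cT] := @Rint_dominated (bset Q) (fun n x => GG x * tens i (A n) (B n) x)
  (fun x => GG x * T x) (fun x => (M * N) * `|GG x|) mbQ.
- move=> n; apply: measurable_funM => //; apply: mten => //; exact: (dA n).1.
- exact: measurable_funM.
- apply: filterS ae_in => x Hx /Hx[h1 h2].
  apply: cvgM; first exact: cvg_cst.
  rewrite -[T x]mulr1; apply: cvgM; [exact: (cA _ h1).1|exact: cB].
- exact: (integrableZl mbQ (M * N) (integrable_norm iGG)).
- move=> n; apply: filterS ae_in => x Hx /Hx[h1 h2].
  rewrite normrM mulrC ler_wpM2r // normrM.
  by apply: ler_pM => //; exact: (HM n _ h1).1.
have FT : \int[mu]_(x in bset Q) (F x * L x) = - \int[mu]_(x in bset Q) (GG x * T x).
  apply: (cvg_unique _ cL) => //.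
  apply: cvg_trans (cvgN cT); apply: near_eq_cvg; apply: nearW => n.
  exact/esym/weak.
have /andP[am mb] := mQ.
have jL : \int[mu]_(x in bset Q) (F x * L x) = - (len (~~ i) Q * jump i m F Q).
  have ec : bset Q = bset (cut i m false Q) `|` bset (cut i m true Q).
    by apply: bset_cut; rewrite !ltW.
  have sub s : bset (cut i m s Q) `<=` bset Q.
    by rewrite [X in _ `<=` X]ec; case: s; [right|left].
  have iFs s := integrable_sub (sub s) iF.
  rewrite {1}ec Rintegral_setU; last 4 first.
  - exact: measurable_bset.
  - exact: measurable_bset.
  - by rewrite -ec.
  - exact: disj_cut.
  have side s x : bset (cut i m s Q) x -> (crd i x <= m) = ~~ s.
    rewrite bsetE /cut; case: (i); case: s => /= /andP[/andP[h1 h2] /andP[h3 h4]];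
      [by rewrite leNgt h3|exact: h4|by rewrite leNgt h1|exact: h2].
  have -> : \int[mu]_(x in bset (cut i m false Q)) (F x * L x) =
      \int[mu]_(x in bset (cut i m false Q)) (F x * (m - a)^-1).
    by apply: eq_Rintegral => x /set_mem xQ; rewrite /L (side _ _ xQ).
  have -> : \int[mu]_(x in bset (cut i m true Q)) (F x * L x) =
      \int[mu]_(x in bset (cut i m true Q)) (F x * - (b - m)^-1).
    by apply: eq_Rintegral => x /set_mem xQ; rewrite /L (side _ _ xQ).
  rewrite !RintegralZr //; try exact: measurable_bset; try exact: iFs.
  rewrite /jump /avg !(areaE i) /a /b; have l0 := len_gt0 (~~ i) wQ.
  have e1 s : len (~~ i) (cut i m s Q) = len (~~ i) Q by rewrite /len /cut; case: (i).
  have e2 : len i (cut i m true Q) = (crd i Q).2 - m by rewrite /len /cut; case: (i).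
  have e3 : len i (cut i m false Q) = m - (crd i Q).1 by rewrite /len /cut; case: (i).
  rewrite !e1 e2 e3; field; rewrite !subr_eq0 !gt_eqF //.
have Tle1 : `|\int[mu]_(x in bset Q) (GG x * T x)| <= \int[mu]_(x in bset Q) `|GG x|.
  apply: (le_trans (le_normr_Rintegral mbQ iT)).
  apply: le_Rintegral => //; try exact: integrable_norm.
  move=> x; rewrite bsetE => xQ; rewrite normrM ler_piMr // /T.
  have {}xQ : a < crd i x <= b by move: xQ; rewrite /a /b; case: (i) => /andP[].
  move: xQ => /andP[h1 h2]; move: am mb; rewrite -/a -/b => am mb.
  move: (crd i x) h1 h2 => t h1 h2.
  case: (leP t m) => h3; (rewrite ger0_norm; last by apply: divr_ge0; lra);
    rewrite ler_pdivrMr ?mul1r; lra.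
have := sqr_int_le mbQ (mu_bset wQ) (area_gt0 wQ) iGG iG2.
rewrite -/(gint (fun x => GG x ^+ 2) Q) => CS.
have l1 := len_gt0 i wQ; have l0 := len_gt0 (~~ i) wQ.
have : (len (~~ i) Q * jump i m F Q) ^+ 2 <= area Q * gint (fun x => GG x ^+ 2) Q.
  apply: le_trans CS; rewrite -[leLHS]sqrrN -jL FT sqrrN -[leLHS]real_normK ?num_real //.
  by apply: lerXn2r; rewrite ?nnegrE //; apply: Rintegral_ge0.
rewrite exprMn (areaE i) => H.
have -> : len i Q / len (~~ i) Q * gint (fun x => GG x ^+ 2) Q =
   (len i Q * len (~~ i) Q * gint (fun x => GG x ^+ 2) Q) / len (~~ i) Q ^+ 2.
  by field; rewrite gt_eqF.
by rewrite ler_pdivlMr ?exprn_gt0 // mulrC.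
Qed.
End Ineq.
End Cut.

(** * Functions of finite energy on the strip *)

Section Strip.
Context {R : realType}.
Notation mu := (leb2 R).
Notation T2 := (measurableTypeR R * measurableTypeR R)%type.
Notation S := (@strip R).

Lemma measurable_strip : measurable (S : set T2).
Proof.
have -> : (S : set T2) = setT `&` (fun x : T2 => crd true x) @^-1` `]0, pi[.
  by rewrite setTI; apply/seteqP; split => x; rewrite /strip /= in_itv.
by apply: (@measurable_crd R true measurableT); exact: measurable_itv.
Qed.

Lemma obox_sub_bset (P Q : @box R) x : bset P `<=` bset Q ->
  (`]P.1.1, P.1.2[ `*` `]P.2.1, P.2.2[) x ->
  [/\ Q.2.1 < x.2, x.2 < P.2.2 & P.2.2 <= Q.2.2].
Proof.
rewrite /setX /= !in_itv /= => PQ [/andP[h1 h2] /andP[h3 h4]].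
have : bset P (x.1, P.2.2) by rewrite bsetE /= h1 (ltW h2) lexx (lt_trans h3 h4).
move/PQ; rewrite bsetE /= => /andP[_ /andP[_ ->]].
have : bset P x by rewrite bsetE h1 (ltW h2) h3 (ltW h4).
by move/PQ; rewrite bsetE => /andP[_ /andP[-> _]].
Qed.

Lemma integrable_of_sqr (D : set T2) (h : T2 -> R) (a : R) : measurable D ->
  mu D = a%:E -> measurable_fun D h ->
  mu.-integrable D (EFin \o (fun x => h x ^+ 2)) -> mu.-integrable D (EFin \o h).
Proof.
move=> mD Da mh ih.
have i1 : mu.-integrable D (EFin \o (fun=> 1 : R)).
  apply/integrableP; split; first exact: measurable_cst.
  by rewrite integral_cst //= normr1 Da mul1e ltry.
apply: (le_integrable mD _ _ (integrableD mD i1 ih)).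
  exact/measurable_EFinP.
move=> x _; rewrite /= lee_fin.
rewrite [leRHS]ger0_norm; last by rewrite addr_ge0 ?sqr_ge0.
by rewrite -[h x ^+ 2]real_normK ?num_real //; have := sqr_ge0 (`|h x| - 1); have := sqr_ge0 `|h x|; lra.
Qed.

Section Fix.
Variables (f : R * R -> R) (g : (R * R -> R) * (R * R -> R)).
Hypotheses (f2 : L2loc S f) (fg : is_weak_grad S f g).
Hypothesis (dfin : (\int[mu]_(x in S) (g.1 x ^+ 2 + g.2 x ^+ 2)%:E < +oo)%E).

(** Extending by zero lets a function of the strip be averaged over half-open
boxes that touch the boundary of the strip. *)
Definition ext (h : R * R -> R) : T2 -> R := h \_ S.
Definition grad2 (x : T2) : R := ext g.1 x ^+ 2 + ext g.2 x ^+ 2.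

Lemma measurable_ext h : measurable_fun S h -> measurable_fun setT (ext h).
Proof. by move=> mh; apply/(measurable_restrictT h measurable_strip). Qed.

Lemma mext_f : measurable_fun setT (ext f).
Proof. by apply: measurable_ext; exact: f2.1. Qed.
Lemma mext_g1 : measurable_fun setT (ext g.1).
Proof. by apply: measurable_ext; exact: fg.1.1.1. Qed.
Lemma mext_g2 : measurable_fun setT (ext g.2).
Proof. by apply: measurable_ext; exact: fg.2.1.1. Qed.

Lemma grad2_ge0 x : 0 <= grad2 x.
Proof. by rewrite addr_ge0 ?sqr_ge0. Qed.

Lemma measurable_grad2 : measurable_fun setT grad2.
Proof.
by apply: measurable_funD; apply: (measurable_funX 2); [exact: mext_g1|exact: mext_g2].
Qed.

Lemma grad2E : (\int[mu]_x (grad2 x)%:E =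
  \int[mu]_(x in S) (g.1 x ^+ 2 + g.2 x ^+ 2)%:E)%E.
Proof.
rewrite [RHS]integral_mkcond; apply: eq_integral => x _.
rewrite /grad2 /ext /patch; case: ifP => // _.
by rewrite expr0n /= addr0.
Qed.

Lemma integrable_grad2 (D : set T2) : measurable D -> mu.-integrable D (EFin \o grad2).
Proof.
move=> mD; apply: (integrableS measurableT mD) => //; apply/integrableP; split.
  by apply/measurable_EFinP; exact: measurable_grad2.
under eq_integral => x _ do rewrite /= ger0_norm ?grad2_ge0 //.
by rewrite grad2E.
Qed.

(** Square integrability of the gradient is part of the hypotheses, but that
of [f] up to the boundary is not; [interior_ctrl] avoids the boundary, and
[strip_int] then removes the restriction. *)
Lemma ctrl_of_integrable Q : wf Q -> 0 <= Q.2.1 -> Q.2.2 <= pi ->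
  mu.-integrable (bset Q) (EFin \o ext f) -> ctrl (ext f) grad2 Q.
Proof.
move=> wQ Q0 Qpi iF; split=> //.
- by apply: integrable_grad2; exact: measurable_bset.
- exact: grad2_ge0.
move=> P i m wP PQ Pm.
have PS : `]P.1.1, P.1.2[ `*` `]P.2.1, P.2.2[ `<=` S.
  move=> x /(obox_sub_bset PQ)[h1 h2 h3]; rewrite /strip /=.
  by rewrite (le_lt_trans Q0 h1) (lt_le_trans h2) // (le_trans h3).
have mP := measurable_bset P.
pose gi : R * R -> R := if i then g.2 else g.1.
have wd : weak_derivative S (eb i) f gi by rewrite /gi /eb; case: (i); case: fg.
have mgi : measurable_fun setT (ext gi) by rewrite /gi; case: (i); [exact: mext_g2|exact: mext_g1].
have le x : ext gi x ^+ 2 <= grad2 x.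
  by rewrite /gi /grad2; case: (i); rewrite ?lerDl ?lerDr sqr_ge0.
have iGi2 : mu.-integrable (bset P) (EFin \o (fun x => ext gi x ^+ 2)).
  apply: (le_integrable mP _ _ (integrable_grad2 mP)).
    apply/measurable_EFinP; apply: measurable_funTS; exact: (measurable_funX 2).
  move=> x _; rewrite /= lee_fin !ger0_norm ?sqr_ge0 ?grad2_ge0 //.
have iGi : mu.-integrable (bset P) (EFin \o ext gi).
  apply: (integrable_of_sqr mP (mu_bset wP)) => //; exact: measurable_funTS.
apply: le_trans (cut_ineq wd wP PS Pm (integrable_sub PQ iF) iGi iGi2) _.
apply: ler_wpM2l.
  by rewrite divr_ge0 // ltW // len_gt0.
by apply: le_Rintegral => //; exact: integrable_grad2.
Qed.

Lemma interior_int Q : wf Q -> 0 < Q.2.1 -> Q.2.2 < pi ->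
  mu.-integrable (bset Q) (EFin \o (fun x => ext f x ^+ 2)).
Proof.
move=> wQ Q0 Qpi; have mQ := measurable_bset Q.
apply/integrableP; split.
  apply/measurable_EFinP; apply: measurable_funTS; apply: (measurable_funX 2).
  exact: mext_f.
pose K : set (R * R) := `[Q.1.1, Q.1.2] `*` `[Q.2.1, Q.2.2].
have mK : measurable (K : set T2) by apply: measurableX; exact: measurable_itv.
have cK : compact K by apply: compact_setX; exact: segment_compact.
have KS : K `<=` S.
  move=> x; rewrite /K /strip /setX /= !in_itv /= => -[_ /andP[h1 h2]].
  by rewrite (lt_le_trans Q0 h1) (le_lt_trans h2 Qpi).
have QK : bset Q `<=` K.
  move=> x; rewrite bsetE /K /setX /= !in_itv /= => /andP[/andP[h1 ->] /andP[h3 ->]].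
  by rewrite !ltW.
apply: le_lt_trans (f2.2 K cK KS).
have -> : (\int[mu]_(x in K) (f x ^+ 2)%:E = \int[mu]_(x in K) (ext f x ^+ 2)%:E)%E.
  by apply: eq_integral => x /set_mem xK; rewrite /ext /patch mem_set //; exact: KS.
under eq_integral => x _ do rewrite /= ger0_norm ?sqr_ge0 //.
apply: ge0_subset_integral => //.
- apply/measurable_EFinP; apply: measurable_funTS; apply: (measurable_funX 2).
  exact: mext_f.
- by move=> x _; rewrite lee_fin sqr_ge0.
Qed.

Lemma interior_ctrl Q : wf Q -> 0 < Q.2.1 -> Q.2.2 < pi -> ctrl (ext f) grad2 Q.
Proof.
move=> wQ Q0 Qpi; apply: ctrl_of_integrable; rewrite ?ltW //.
apply: (integrable_of_sqr (measurable_bset Q) (mu_bset wQ)).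
  by apply: measurable_funTS; exact: mext_f.
exact: interior_int.
Qed.

(** The Poincare inequality on the interior boxes [Qn] has a constant
independent of [n].  It bounds the oscillation of [f] on [Qn], and the averages
[c n] are bounded by comparison with [f] on the fixed box [Qn 0]. *)
Lemma strip_int (a b : R) : a < b ->
  mu.-integrable (bset ((a, b), (0, pi))) (EFin \o (fun x => ext f x ^+ 2)).
Proof.
move=> ab; pose Q : @box R := ((a, b), (0, pi)); rewrite -/Q.
have pi0 := pi_ge2 R.
have wQ : wf Q by rewrite /wf /= ab /=; lra.
pose F := ext f.
have mF : measurable_fun setT F by exact: mext_f.
have mF2 : measurable_fun setT (fun x => F x ^+ 2) by exact: (measurable_funX 2).
pose eta n : R := (n.+2%:R)^-1.
have eta0 n : 0 < eta n by rewrite invr_gt0.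
have eta1 n : eta n <= 1 / 2.
  by rewrite /eta div1r lef_pV2 ?posrE // ler_nat.
have etaS n m : (n <= m)%N -> eta m <= eta n.
  by move=> nm; rewrite /eta lef_pV2 ?posrE // ler_nat !ltnS.
pose Qn n : @box R := ((a, b), (eta n, pi - eta n)).
have wQn n : wf (Qn n) by rewrite /wf /= ab /=; have := eta1 n; lra.
have cQn n : ctrl F grad2 (Qn n).
  by apply: interior_ctrl; rewrite //= ?ltrBlDr ?ltrDl.
have iQn n : mu.-integrable (bset (Qn n)) (EFin \o (fun x => F x ^+ 2)).
  by apply: interior_int; rewrite //= ?ltrBlDr ?ltrDl.
have Qmono n m : (n <= m)%N -> bset (Qn n) `<=` bset (Qn m).
  move=> nm x; rewrite !bsetE /= => /andP[-> /andP[h1 h2]] /=; have := etaS _ _ nm => h.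
  by apply/andP; split; lra.
have QnQ n : bset (Qn n) `<=` bset Q.
  move=> x; rewrite !bsetE /= => /andP[-> /andP[h1 h2]] /=; have := eta0 n => h.
  by apply/andP; split; lra.
pose c n := avg F (Qn n).
pose T := gint grad2 Q.
have T0 : 0 <= T by apply: gint_ge0; exact: grad2_ge0.
pose C := 8 * (pi ^+ 2 + 2 * (b - a) ^+ 2) * T.
have mQn n := measurable_bset (Qn n).
have icst n (k : R) : mu.-integrable (bset (Qn n)) (EFin \o (fun=> k)).
  apply/integrableP; split; first exact: measurable_cst.
  by rewrite integral_cst //= [mu _]mu_bset // -EFinM ltry.
have iFn n : mu.-integrable (bset (Qn n)) (EFin \o F) by have [] := cQn n.
have poin n : (\int[mu]_(x in bset (Qn n)) ((F x - c n) ^+ 2)%:E <= C%:E)%E.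
  apply: (le_trans (poincare (wQn n) (cQn n))); rewrite lee_fin /C.
  have gT : gint grad2 (Qn n) <= T.
    rewrite /gint fine_le //.
    - by apply: integrable_fin_num => //; exact: integrable_grad2.
    - apply: integrable_fin_num; [exact: measurable_bset|].
      by apply: integrable_grad2; exact: measurable_bset.
    - apply: ge0_subset_integral => //; first exact: measurable_bset.
        by apply/measurable_EFinP; apply: measurable_funTS; exact: measurable_grad2.
      by move=> x _; rewrite lee_fin grad2_ge0.
  have as0 := aspect_gt0 (wQn n); have ar0 := area_gt0 (wQn n).
  apply: ler_pM => //.
  - by rewrite -mulrA mulr_ge0 // mulr_ge0 // ltW.
  - by apply: gint_ge0; exact: grad2_ge0.
  rewrite -mulrA ler_pM2l //.
  have l1 := len_gt0 false (wQn n); have l2 := len_gt0 true (wQn n).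
  have -> : aspect (Qn n) * area (Qn n) =
      len true (Qn n) ^+ 2 + 2 * len false (Qn n) ^+ 2.
    by rewrite /aspect /area; field; rewrite !gt_eqF.
  rewrite lerD2r; apply: lerXn2r; rewrite ?nnegrE ?(ltW l2) ?pi_ge0 //.
  by rewrite /len /=; have := eta0 n; lra.
have iD n : mu.-integrable (bset (Qn n)) (EFin \o (fun x => (F x - c n) ^+ 2)).
  apply/integrableP; split.
    apply/measurable_EFinP; apply: (measurable_funX 2).
    by apply: measurable_funTS; apply: measurable_funB.
  under eq_integral => x _ do rewrite /= ger0_norm ?sqr_ge0 //.
  by apply: le_lt_trans (poin n) _; rewrite ltry.
have dev n : \int[mu]_(x in bset (Qn n)) ((F x - c n) ^+ 2) <= C.
  have := poin n; rewrite -lee_fin /Rintegral fineK //.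
  exact: (integrable_fin_num (mQn n) (iD n)).
have areaQn n : fine (mu (bset (Qn n))) = area (Qn n) by rewrite [mu _]mu_bset.
have iZ n (h : T2 -> R) : mu.-integrable (bset (Qn n)) (EFin \o h) ->
    mu.-integrable (bset (Qn n)) (EFin \o (fun x => 2 * h x)).
  by move=> ih; exact: (integrableZl (mQn n) 2 ih).
have c2 n : c n ^+ 2 * area (Qn 0%N) <= 2 * C + 2 * \int[mu]_(x in bset (Qn 0%N)) (F x ^+ 2).
  have iD0 : mu.-integrable (bset (Qn 0%N)) (EFin \o (fun x => (F x - c n) ^+ 2)).
    by apply: integrable_sub (iD n); exact: Qmono.
  have dev0 : \int[mu]_(x in bset (Qn 0%N)) ((F x - c n) ^+ 2) <= C.
    apply: le_trans (dev n); rewrite /Rintegral fine_le //.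
    - exact: (integrable_fin_num (mQn 0%N) iD0).
    - exact: (integrable_fin_num (mQn n) (iD n)).
    - apply: ge0_subset_integral => //; last exact: Qmono.
        exact: (measurable_int _ (iD n)).
      by move=> x _; rewrite lee_fin sqr_ge0.
  rewrite -areaQn -Rintegral_cst //.
  apply: (@le_trans _ _ (\int[mu]_(x in bset (Qn 0%N))
     (2 * (F x - c n) ^+ 2 + 2 * F x ^+ 2))).
    apply: le_Rintegral => //.
      exact: (integrableD (mQn 0%N) (iZ _ _ iD0) (iZ _ _ (iQn 0%N))).
    by move=> x _; have := sqr_ge0 (2 * F x - c n); lra.
  rewrite RintegralD //; [|exact: iZ|exact: iZ].
  rewrite (RintegralZl 2 (mQn 0%N) iD0) (RintegralZl 2 (mQn 0%N) (iQn 0%N)).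
  by rewrite lerD2r ler_pM2l.
pose B := 2 * C + 2 * ((2 * C + 2 * \int[mu]_(x in bset (Qn 0%N)) (F x ^+ 2)) /
                       area (Qn 0%N) * area Q).
have A0 := area_gt0 (wQn 0%N).
have qB n : \int[mu]_(x in bset (Qn n)) (F x ^+ 2) <= B.
  apply: (@le_trans _ _ (\int[mu]_(x in bset (Qn n))
     (2 * (F x - c n) ^+ 2 + 2 * c n ^+ 2))).
    apply: le_Rintegral => //.
      exact: (integrableD (mQn n) (iZ _ _ (iD n)) (icst n (2 * c n ^+ 2))).
    by move=> x _; have := sqr_ge0 (F x - 2 * c n); lra.
  rewrite RintegralD //; [|exact: iZ].
  rewrite (RintegralZl 2 (mQn n) (iD n)).
  rewrite Rintegral_cst // areaQn /B; apply: lerD; first by rewrite ler_pM2l.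
  rewrite -mulrA ler_pM2l //; apply: ler_pM.
  - exact: sqr_ge0.
  - exact/ltW/area_gt0.
  - by rewrite ler_pdivlMr.
  by rewrite /area ler_pM2l ?len_gt0 // /len /=; have := eta0 n; lra.
apply/integrableP; split; first by apply/measurable_EFinP; exact: measurable_funTS.
under eq_integral => x _ do rewrite /= ger0_norm ?sqr_ge0 //.
apply: (@le_lt_trans _ _ B%:E); last by rewrite ltry.
have -> : (\int[mu]_(x in bset Q) (ext f x ^+ 2)%:E =
           \int[mu]_(x in \bigcup_n bset (Qn n)) (F x ^+ 2)%:E)%E.
  rewrite integral_mkcond [RHS]integral_mkcond; apply: eq_integral => x _.
  rewrite /patch; have [xQ|xQ] := boolP (x \in bset Q); last first.
    rewrite memNset // => -[n _ xn]; move/negP: xQ; apply; apply: mem_set; exact: QnQ xn.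
  have [//|xn] := boolP (x \in \bigcup_n bset (Qn n)).
  suff -> : ext f x = 0 by rewrite expr0n.
  rewrite /ext /patch memNset // => xS.
  have /andP[x0 xpi] : 0 < x.2 < pi by exact: xS.
  have hn : \forall n \near \oo, eta n < Num.min x.2 (pi - x.2).
    have h0 : 0 < Num.min x.2 (pi - x.2) by rewrite lt_min x0 subr_gt0.
    have := near_harm 1 h0; apply: filterS => n; apply: le_lt_trans.
    by rewrite div1r /eta lef_pV2 ?posrE // ler_nat.
  have [n _ /(_ n (leqnn n))] := hn; rewrite lt_min => /andP[e1 e2].
  move/negP: xn; apply; apply: mem_set; exists n => //.
  move/set_mem: xQ; rewrite !bsetE /= => /andP[-> _] /=.
  by apply/andP; split; lra.
have cv := @ge0_nondecreasing_set_cvg_integral _ _ R (fun n => bset (Qn n))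
  (fun x => (F x ^+ 2)%:E) mu _ mQn _ _.
have := cvg_lim _ (cv _ _ _) => <- //.
- apply: lime_le.
    apply: ereal_nondecreasing_is_cvgn.
    apply: ge0_nondecreasing_set_nondecreasing_integral => //.
    + by move=> n m nm; apply/subsetPset; exact: Qmono.
    + by move=> n; exact: (measurable_int _ (iQn n)).
    + by move=> n x _; rewrite lee_fin sqr_ge0.
  apply: nearW => n; have := qB n; rewrite -lee_fin /Rintegral fineK //.
  exact: (integrable_fin_num (mQn n) (iQn n)).
- by move=> n m nm; apply/subsetPset; exact: Qmono.
- by move=> n; exact: (measurable_int _ (iQn n)).
- by move=> n x _; rewrite lee_fin sqr_ge0.
Qed.

Lemma strip_ctrl (a b : R) : a < b -> ctrl (ext f) grad2 ((a, b), (0, pi)).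
Proof.
move=> ab; have wQ : wf ((a, b), (0, pi)) by rewrite /wf /= ab pi_gt0.
apply: ctrl_of_integrable => //=.
apply: (integrable_of_sqr (measurable_bset _) (mu_bset wQ)).
  by apply: measurable_funTS; exact: mext_f.
exact: strip_int.
Qed.

End Fix.
End Strip.

(** * Selecting the costly boxes *)

Section Select.
Context {R : realType}.
Notation mu := (leb2 R).
Notation T2 := (measurableTypeR R * measurableTypeR R)%type.
Implicit Types (Q P : @box R) (d : nat -> bool) (k : nat).
Implicit Types (f G V w : T2 -> R).

Fixpoint catn (X : Type) (l : nat -> seq X) n : seq X :=
  if n is n'.+1 then catn l n' ++ l n' else [::].

Lemma size_catn (X : Type) (l : nat -> seq X) n :
  size (catn l n) = (\sum_(j < n) size (l j))%N.
Proof.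
by elim: n => [|n IH]; rewrite ?big_ord0 // big_ord_recr /= size_cat IH.
Qed.

Lemma mem_catn (X : eqType) (l : nat -> seq X) n j x :
  (j < n)%N -> x \in l j -> x \in catn l n.
Proof.
elim: n => // n IH; rewrite ltnS leq_eqVlt => /predU1P[->|jn] xl /=.
  by rewrite mem_cat xl orbT.
by rewrite mem_cat IH.
Qed.

Lemma catn_mem (X : eqType) (l : nat -> seq X) n x :
  x \in catn l n -> exists2 j, (j < n)%N & x \in l j.
Proof.
elim: n => // n IH; rewrite mem_cat => /orP[/IH[j jn xl]|xl].
  by exists j => //; exact: ltnW.
by exists n.
Qed.

Lemma geo_le (kap : R) (n : nat) : 0 <= kap < 1 ->
  \sum_(j < n) kap ^+ j <= (1 - kap)^-1.
Proof.
move=> /andP[k0 k1]; rewrite -[leRHS]mul1r ler_pdivlMr ?subr_gt0 // mulrC.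
have := subrX1 kap n; have := exprn_ge0 n k0.
by move: (\sum_(_ < _) _) (kap ^+ n) => a b; lra.
Qed.

Lemma geo_small (Y kap : R) : 0 <= kap < 1 -> exists J, Y * kap ^+ J < 1.
Proof.
move=> /andP[k0 k1].
have /cvgr_lt : Y * kap ^+ n @[n --> \oo] --> (0 : R).
  by apply: cvg_geometric; rewrite ger0_norm.
by move=> /(_ _ ltr01)[J _ HJ]; exists J; exact: HJ (leqnn J).
Qed.

Definition costly d k V (c : R) P : bool :=
  ~~ ((len (d k) P / len (~~ d k) P)%:E * \int[mu]_(x in bset P) (V x)%:E <= c%:E)%E.

(** Each element of the list stands for the linear condition that the jump
across the given halving be zero. *)
Definition kills f (L : seq (bool * @box R)) := {in L, forall c, osc c.1 f c.2 = 0}.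

Lemma sum_int_nodes d k Q w : wf Q -> measurable_fun setT w -> (forall x, 0 <= w x) ->
  (\sum_(P <- nodes d k Q) \int[mu]_(x in bset P) (w x)%:E =
   \int[mu]_(x in bset Q) (w x)%:E)%E.
Proof.
by move=> wQ mw w0; rewrite -(ge0_int_node_dep d k (Psi := fun=> w)).
Qed.

(** The boxes of one generation are disjoint, so Chebyshev's inequality for
the additive quantity [w] counts the costly ones. *)
Lemma count_costly d k Q V w (c B Y : R) : wf Q ->
    measurable_fun setT w -> (forall x, 0 <= w x) -> 0 <= B ->
    {in nodes d k Q, forall P, costly d k V c P ->
      (1 <= B%:E * \int[mu]_(x in bset P) (w x)%:E)%E} ->
    (B%:E * \int[mu]_(x in bset Q) (w x)%:E <= Y%:E)%E ->
  (size [seq P <- nodes d k Q | costly d k V c P])%:R <= Y.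
Proof.
move=> wQ mw w0 B0 H HY; rewrite -lee_fin; apply: le_trans HY.
rewrite -(sum_int_nodes d k wQ mw w0) ge0_sume_distrr; last first.
  by move=> P _; apply: integral_ge0 => x _; rewrite lee_fin.
rewrite size_filter -sum1_count natr_sum -sumEFin big_seq_cond big_mkcond [leRHS]big_seq.
rewrite [leRHS]big_mkcond; apply: lee_sum => P _.
have v0 : (0 <= B%:E * \int[mu]_(x in bset P) (w x)%:E)%E.
  by apply: mule_ge0; rewrite ?lee_fin //; apply: integral_ge0 => x _; rewrite lee_fin.
by case: ifP => [/andP[HP cP]|_]; [rewrite HP; exact: H|case: ifP].
Qed.

(** Kill every jump of the first [K] generations, [2 ^ K - 1] in number, and
afterwards the jumps of the costly boxes.  The latter number at most
[Y * kap ^ j] in generation [K + j]; this is less than 1 from some generation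
on, so the list is finite. *)
Lemma selection d K Q V w (eps tau kap B Y : R) : wf Q ->
    measurable_fun setT w -> (forall x, 0 <= w x) ->
    0 <= B -> 0 <= kap < 1 -> 0 <= Y ->
    (forall j, {in nodes d (K + j) Q, forall P,
       costly d (K + j) V (eps * tau ^+ j) P ->
       (1 <= (B * kap ^+ j)%:E * \int[mu]_(x in bset P) (w x)%:E)%E}) ->
    (B%:E * \int[mu]_(x in bset Q) (w x)%:E <= Y%:E)%E ->
  exists L : seq (bool * @box R),
    [/\ (size L)%:R <= (2 ^+ K - 1) + Y / (1 - kap),
        K = 0%N -> Y < 1 -> L = [::],
        {in L, forall c, wf c.2 /\ bset c.2 `<=` bset Q} &
        forall f, kills f L ->
          (forall j, (j < K)%N -> {in nodes d j Q, forall P, osc (d j) f P = 0}) /\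
          (forall j, {in nodes d (K + j) Q, forall P,
             cheap d (K + j) f V (eps * tau ^+ j) P})].
Proof.
move=> wQ mw w0 B0 kap01 Y0 H HY; have /andP[kap0 kap1] := kap01.
have [J HJ] := geo_small Y kap01.
pose l1 j := [seq (d j, P) | P <- nodes d j Q].
pose bad j := [seq P <- nodes d (K + j) Q | costly d (K + j) V (eps * tau ^+ j) P].
pose l2 j := [seq (d (K + j), P) | P <- bad j].
have badY j : (size (bad j))%:R <= Y * kap ^+ j.
  apply: (count_costly wQ mw w0 _ (H j)).
    by rewrite mulr_ge0 // exprn_ge0.
  rewrite mulrC EFinM -muleA [(Y * _)%R]mulrC EFinM lee_wpmul2l //.
  by rewrite lee_fin exprn_ge0.
have bad0 j : Y * kap ^+ j < 1 -> bad j = [::].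
  move=> h; apply: size0nil; apply/eqP; rewrite -leqn0 -ltnS -(ltr_nat R).
  exact: le_lt_trans (badY j) h.
exists (catn l1 K ++ catn l2 J); split.
- rewrite size_cat natrD !size_catn; apply: lerD.
    under eq_bigr do rewrite size_map size_nodes.
    rewrite natr_sum; under eq_bigr do rewrite natrX.
    have := subrX1 (2 : R) K; move: (\sum_(_ < _) _) (2 ^+ K) => a b; lra.
  under eq_bigr do rewrite size_map.
  rewrite natr_sum; apply: (@le_trans _ _ (\sum_(j < J) Y * kap ^+ j)).
    by apply: ler_sum => j _; exact: badY.
  by rewrite -mulr_sumr ler_wpM2l //; exact: geo_le.
- move=> K0 Y1; rewrite {1}K0 /=; apply: size0nil; rewrite size_catn big1 // => j _.
  rewrite size_map bad0 //; apply: le_lt_trans Y1.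
  by rewrite ler_piMr // exprn_ile1 // ltW.
- move=> c; rewrite mem_cat => /orP[] /catn_mem[j _] /mapP[P HP ->] /=.
    by split; [exact: wf_nodes HP|exact: sub_nodes HP].
  move: HP; rewrite mem_filter => /andP[_ HP].
  by split; [exact: wf_nodes HP|exact: sub_nodes HP].
- move=> f kf; split => [j jK P HP|j P HP].
    apply: (kf (d j, P)); rewrite mem_cat (@mem_catn _ _ _ j) //.
    by apply/mapP; exists P.
  have [c|] := boolP (costly d (K + j) V (eps * tau ^+ j) P); last first.
    by rewrite negbK; right.
  have Pb : P \in bad j by rewrite mem_filter c HP.
  have jJ : (j < J)%N.
    rewrite ltnNge; apply/negP => Jj; move: Pb; rewrite bad0 //.
    apply: le_lt_trans HJ; rewrite ler_wpM2l // -(subnKC Jj) exprD ler_piMr ?exprn_ge0 //.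
    by rewrite exprn_ile1 // ltW.
  left; apply: (kf (d (K + j)%N, P)); rewrite mem_cat; apply/orP; right.
  by apply: (@mem_catn _ _ _ j) => //; apply/mapP; exists P.
Qed.

(** The number of generations killed unconditionally: none if [X] is small,
and otherwise such that [2 ^ K] is comparable to [X]. *)
Lemma dyadic_exponent (X : R) : 0 <= X ->
  exists K, [/\ X <= 2 ^+ K, 2 ^+ K <= 1 + 2 * X & X <= 1 -> K = 0%N].
Proof.
move=> X0; have [] := pselect (exists K, X <= 2 ^+ K :> R); last first.
  move=> nex; exfalso; apply: nex; exists (Num.truncn X).+1.
  apply: ltW; apply: lt_le_trans (truncnS_gt X) _.
  by rewrite -natrX ler_nat ltnW // ltn_expl.
move=> ex; case: (ex_minnP ex) => K HK minK; exists K; split=> //.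
  case: K HK minK => [|K] HK minK; first by rewrite expr0; lra.
  rewrite exprS; have [h|h] := leP X (2 ^+ K).
    by have := minK _ h; rewrite ltnn.
  by lra.
move=> X1; apply/eqP; rewrite -leqn0; apply: minK; by rewrite expr0.
Qed.

End Select.

(** * Selection on blocks and on cells *)

Section Cells.
Context {R : realType}.
Notation mu := (leb2 R).
Notation T2 := (measurableTypeR R * measurableTypeR R)%type.
Implicit Types (Q P : @box R) (k : nat) (f G V w : T2 -> R).

Definition hor (k : nat) : bool := false.

Lemma hor_len k Q : {in nodes hor k Q, forall P,
  len false P = len false Q / 2 ^+ k /\ len true P = len true Q}.
Proof.
elim: k => [|k IH] P; first by rewrite inE => /eqP ->; rewrite expr0 divr1.
case/nodesSP => N /IH[h1 h2] [s ->]; split; last by rewrite -h2 (len_halveN false).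
by rewrite /hor len_halve h1 exprSr invfM mulrA.
Qed.

(** A box of generation [K + j] has width [len false Q / 2 ^ (K + j)], so a
costly one carries a mass of at least a constant times
[(2 * 3 / 4) ^ j * 2 ^ K / len false Q]. *)
Lemma select_line (eps a : R) Q V : wf Q -> 1 <= len true Q -> 0 < eps -> 0 <= a ->
    measurable_fun setT V -> (forall x, 0 <= V x) ->
    ((len false Q)%:E * \int[mu]_(x in bset Q) (V x)%:E <= a%:E)%E ->
  exists L : seq (bool * @box R),
    [/\ (size L)%:R <= (2 + 3 / eps) * Num.sqrt a,
        a < eps -> a <= 1 -> L = [::],
        {in L, forall c, wf c.2 /\ bset c.2 `<=` bset Q} &
        forall f G, ctrl f G Q -> kills f L -> forall D,
          (\int[mu]_(x in bset Q) ((Ecell f hor D Q x - avg f Q) ^+ 2 * V x)%:E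
            <= (32 * eps * gint G Q)%:E)%E].
Proof.
move=> wQ lQ e0 a0 mV V0 LV.
have l0 := len_gt0 false wQ.
have [K [sK K2 K1]] := dyadic_exponent (sqrtr_ge0 a).
have K0 : 0 < 2 ^+ K :> R by rewrite exprn_gt0.
pose B := len false Q / (eps * 2 ^+ K).
have B0 : 0 <= B by rewrite divr_ge0 ?ltW // mulr_gt0.
pose Y := a / (eps * 2 ^+ K).
have Y0 : 0 <= Y by rewrite divr_ge0 // ltW // mulr_gt0.
have kap01 : 0 <= (2 / 3 : R) < 1 by apply/andP; split; lra.
have [||L [sL L0 LQ kL]] :=
  @selection R hor K Q V V eps (3 / 4) (2 / 3) B Y wQ mV V0 B0 kap01 Y0.
- move=> j P HP; rewrite /costly -ltNge => cP.
  have [h1 h2] := hor_len HP.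
  have v0 : (0 <= \int[mu]_(x in bset P) (V x)%:E)%E.
    by apply: integral_ge0 => x _; rewrite lee_fin.
  have t0 : 0 < eps * (3 / 4) ^+ j by rewrite mulr_gt0 // exprn_gt0.
  apply: (@le_trans _ _ ((eps * (3 / 4) ^+ j)^-1%:E *
    ((len false P / len true P)%:E * \int[mu]_(x in bset P) (V x)%:E))%E).
    apply: (@le_trans _ _ ((eps * (3 / 4) ^+ j)^-1%:E * (eps * (3 / 4) ^+ j)%:E)%E).
      by rewrite -EFinM mulVf // gt_eqF.
    by apply: lee_wpmul2l; [rewrite lee_fin invr_ge0 ltW|exact: ltW].
  rewrite muleA -EFinM; apply: lee_wpmul2r => //; rewrite lee_fin.
  rewrite h1 h2 /B.
  have -> : len false Q / (eps * 2 ^+ K) * (2 / 3) ^+ j =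
      (eps * (3 / 4) ^+ j)^-1 * (len false Q / 2 ^+ (K + j)).
    have -> : (2 / 3 : R) = 1 / (3 / 4 * 2) by field.
    rewrite expr_div_n expr1n exprMn exprD; field.
    by rewrite !expf_neq0 ?gt_eqF.
  rewrite ler_pM2l ?invr_gt0 // ler_pdivrMr; last by exact: lt_le_trans lQ.
  by rewrite ler_peMr // divr_ge0 ?exprn_ge0 // ltW.
- rewrite /B /Y mulrC EFinM -muleA [a / _]mulrC EFinM.
  by apply: lee_wpmul2l => //; rewrite lee_fin invr_ge0 mulr_ge0 ?ltW.
have sq : Num.sqrt a * Num.sqrt a = a by rewrite -expr2 sqr_sqrtr.
have Yle : Y <= Num.sqrt a / eps.
  rewrite /Y ler_pdivrMr ?mulr_gt0 //.
  have -> : Num.sqrt a / eps * (eps * 2 ^+ K) = Num.sqrt a * 2 ^+ K.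
    by field; rewrite gt_eqF.
  by rewrite -{1}sq ler_wpM2l // sqrtr_ge0.
exists L; split=> //.
- apply: (le_trans sL).
  have -> : (2 + 3 / eps) * Num.sqrt a = 2 * Num.sqrt a + 3 * (Num.sqrt a / eps).
    by field; rewrite gt_eqF.
  have -> : Y / (1 - 2 / 3) = 3 * Y by field.
  by lra.
- move=> ae a1; have K00 : K = 0%N.
    by apply: K1; rewrite -sqrtr1 ler_wsqrtr.
  apply: L0 => //; rewrite /Y K00 expr0 mulr1 ltr_pdivrMr // mul1r //.
move=> f G cf kf D; have [k1 k2] := kL f kf.
have -> : 32 * eps * gint G Q = 2 * eps / (1 - 3 / 4) ^+ 2 * gint G Q by field.
apply: tree_energy k1 k2 D => //; first exact: ltW.
by apply/andP; split; lra.
Qed.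

Lemma exprn_powR (x r : R) n : 0 <= x -> (x ^+ n) `^ r = (x `^ r) ^+ n.
Proof.
by move=> x0; rewrite -(powR_mulrn n x0) -(powR_mulrn n (powR_ge0 x r)) powRAC.
Qed.

(** Splitting according to whether [v] exceeds [l]; a substitute for Hoelder's
inequality in which the level [l] is free. *)
Lemma young_powR (l v p : R) : 1 <= p -> 0 < l -> 0 <= v ->
  l `^ (p - 1) * v <= l `^ (p - 1) * l + v `^ p.
Proof.
move=> p1 l0 v0; have [vl|lv] := leP v l.
  rewrite -[leLHS]addr0; apply: lerD; last exact: powR_ge0.
  by rewrite ler_wpM2l // powR_ge0.
rewrite -[leLHS]add0r; apply: lerD; first by rewrite mulr_ge0 ?powR_ge0 // ltW.
rewrite -(mulr_powRB1 v0) ?(lt_le_trans ltr01) // mulrC ler_wpM2l //.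
by apply: ge0_ler_powR; rewrite ?nnegrE ?subr_ge0 // ltW.
Qed.

(** A costly box of generation [K + j] has mass at least [dl], of order
[tau ^ j], and area [pi / 2 ^ (K + j)].  By [young_powR] at half the mean density,
[int_P V^p] is at least of order [dl^p * 2 ^ ((K + j) (p - 1))].  The growth
[2 ^ (p - 1) = sg ^ 2] is shared equally: one factor [sg^-1] is [tau ^ p], the
decay allowed to the tree, the other is [kap], the decay of the number of costly
boxes.  With [2 ^ K] of order [b] both contributions to the list are
[O(b)]. *)
Lemma select_cell (p eps : R) : 1 < p -> 0 < eps ->
  exists C c : R, [/\ 0 < C, 0 < c & forall Q V (b : R),
    wf Q -> len false Q = 1 -> len true Q = pi ->
    measurable_fun setT V -> (forall x, 0 <= V x) -> 0 <= b ->
    (\int[mu]_(x in bset Q) (V x `^ p)%:E <= (b `^ p)%:E)%E ->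
    exists L : seq (bool * @box R),
    [/\ (size L)%:R <= C * b, b <= c -> L = [::],
        {in L, forall c, wf c.2 /\ bset c.2 `<=` bset Q} &
        forall f G, ctrl f G Q -> kills f L ->
          (\int[mu]_(x in bset Q) ((f x - avg f Q) ^+ 2 * V x)%:E
            <= (eps * gint G Q)%:E)%E]].
Proof.
move=> p1 eps0; have p0 : 0 < p by exact: lt_trans p1.
have pm1 : 0 < p - 1 by rewrite subr_gt0.
have pi0 : 0 < pi :> R := pi_gt0 R.
pose A0 : R := pi + 2 / pi.
have A00 : 0 < A0 by rewrite addr_gt0 ?divr_gt0.
pose sg : R := 2 `^ ((p - 1) / 2).
have sg1 : 1 < sg.
  have := @gt0_ltr_powR R ((p - 1) / 2) _ 1 2; rewrite powR1 nnegrE => H.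
  by apply: H; rewrite ?nnegrE ?divr_gt0 //; lra.
have sg0 : 0 < sg by exact: lt_trans sg1.
have sg2 : 2 `^ (p - 1) = sg ^+ 2.
  by rewrite -powR_mulrn ?powR_ge0 // -powRrM divfK.
pose kap := sg^-1.
have kap0 : 0 < kap by rewrite invr_gt0.
have kap1 : kap < 1 by rewrite invf_lt1.
pose tau := kap `^ p^-1.
have tau0 : 0 < tau by rewrite powR_gt0.
have taup : tau `^ p = kap by rewrite -powRrM mulVf ?gt_eqF // powRr1 // ltW.
have tau1 : tau < 1.
  have := @gt0_ltr_powR R p^-1 _ kap 1; rewrite powR1; apply => //; rewrite ?nnegrE ?invr_gt0 //.
  exact: ltW.
pose e : R := eps * (1 - tau) ^+ 2 / 2.
have e0 : 0 < e by rewrite divr_gt0 // mulr_gt0 // exprn_gt0 // subr_gt0.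
pose c0 : R := (e / (2 * A0)) `^ p * (pi^-1) `^ (p - 1).
have c00 : 0 < c0.
  apply: mulr_gt0; apply: powR_gt0; last by rewrite invr_gt0.
  by apply: divr_gt0 => //; exact: mulr_gt0.
have C00 : 0 < c0^-1 by rewrite invr_gt0.
exists (2 + c0^-1 / (1 - kap)), (Num.min 1 (c0 / 2)); split.
- by rewrite addr_gt0 // divr_gt0 // subr_gt0.
- by rewrite lt_min ltr01 divr_gt0.
move=> Q V b wQ lf lt mV V0 b0 Vb.
have aQ : aspect Q = A0 by rewrite /aspect lf lt divr1 mul1r.
have areaQ : area Q = pi by rewrite /area lf lt mul1r.
have [K [sK K2 K1]] := dyadic_exponent b0.
pose W (x : T2) := V x `^ p.
have mW : measurable_fun setT W.
  by apply: (measurableT_comp (measurable_powR p)).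
have W0 x : 0 <= W x by exact: powR_ge0.
pose B := c0^-1 * kap ^+ (2 * K).
have B0 : 0 <= B by rewrite mulr_ge0 ?exprn_ge0 // ltW.
pose Y := c0^-1 * b.
have Y0 : 0 <= Y by rewrite mulr_ge0 // ltW.
have kap01 : 0 <= kap < 1 by rewrite ltW.
have [||L [sL L0 LQ kL]] :=
  @selection R alt K Q V W e tau kap B Y wQ mW W0 B0 kap01 Y0.
- move=> j P HP; rewrite /costly -ltNge => cP.
  have wP := wf_nodes wQ HP; have mP := measurable_bset P.
  have aP : area P = pi / 2 ^+ (K + j) by rewrite (area_nodes HP) areaQ.
  have v0 : (0 <= \int[mu]_(x in bset P) (V x)%:E)%E.
    by apply: integral_ge0 => x _; rewrite lee_fin.
  pose dl := e * tau ^+ j / A0.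
  have dl0 : 0 < dl by rewrite divr_gt0 // mulr_gt0 // exprn_gt0.
  have vdl : (dl%:E <= \int[mu]_(x in bset P) (V x)%:E)%E.
    have : ((e * tau ^+ j)%:E <= A0%:E * \int[mu]_(x in bset P) (V x)%:E)%E.
      apply: (le_trans (ltW cP)); apply: lee_wpmul2r => //; rewrite lee_fin -aQ.
      exact: alt_ratio_le.
    have -> : e * tau ^+ j = A0 * dl by rewrite /dl; field; rewrite gt_eqF.
    by rewrite EFinM lee_pmul2l // lte_fin.
  pose l := dl / 2 / area P.
  have l0 : 0 < l by apply: divr_gt0; [exact: divr_gt0|exact: area_gt0].
  pose lp := l `^ (p - 1); have lp0 : 0 < lp by rewrite powR_gt0.
  have I1 : ((lp * (dl / 2))%:E <= \int[mu]_(x in bset P) (W x)%:E)%E.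
    have : ((lp * dl)%:E <= (lp * (dl / 2))%:E + \int[mu]_(x in bset P) (W x)%:E)%E.
      apply: (@le_trans _ _ (lp%:E * \int[mu]_(x in bset P) (V x)%:E)%E).
        by rewrite EFinM lee_pmul2l // lte_fin.
      rewrite -ge0_integralZl_EFin //; last 3 first.
      - by move=> x _; rewrite lee_fin.
      - by apply/measurable_EFinP; exact: measurable_funTS.
      - exact: ltW.
      have -> : ((lp * (dl / 2))%:E = \int[mu]_(x in bset P) (lp * l)%:E)%E.
        rewrite integral_cst // [mu _]mu_bset // -EFinM; congr (_%:E).
        by rewrite /l; field; rewrite gt_eqF // area_gt0.
      rewrite -ge0_integralD //; last 3 first.
      - by move=> x _; rewrite lee_fin mulr_ge0 // ltW.
      - by move=> x _; rewrite lee_fin.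
      - by apply/measurable_EFinP; exact: measurable_funTS.
      apply: ge0_le_integral => //.
      - by move=> x _; rewrite -EFinM lee_fin mulr_ge0 // ltW.
      - by apply: emeasurable_funM => //; apply/measurable_EFinP; exact: measurable_funTS.
      - apply: emeasurable_funD; first exact: measurable_cst.
        by apply/measurable_EFinP; exact: measurable_funTS.
      - move=> x _; rewrite -EFinM -EFinD lee_fin; apply: young_powR => //; exact: ltW.
    have : (0 <= \int[mu]_(x in bset P) (W x)%:E)%E.
      by apply: integral_ge0 => x _; rewrite lee_fin.
    case: (\int[mu]_(x in bset P) (W x)%:E)%E => [r _|_ _|].
    - by rewrite -EFinD !lee_fin; lra.
    - by rewrite leey.
    - by rewrite leeNy_eq.
  apply: (@le_trans _ _ ((B * kap ^+ j)%:E * (lp * (dl / 2))%:E)%E); last first.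
    by apply: lee_wpmul2l => //; rewrite lee_fin mulr_ge0 // exprn_ge0 // ltW.
  rewrite -EFinM lee_fin le_eqVlt; apply/orP; left; apply/eqP.
  have E1 : lp * (dl / 2) = c0 * kap ^+ j * sg ^+ (2 * (K + j)).
    have h0 : 0 <= dl / 2 by rewrite divr_ge0 // ltW.
    have k0 : 0 <= 2 ^+ (K + j) :> R by rewrite exprn_ge0.
    have pv0 : 0 <= pi^-1 :> R by rewrite invr_ge0 ltW.
    rewrite /lp /l aP invf_div [2 ^+ _ / _]mulrC (powRM _ h0) ?mulr_ge0 //.
    rewrite (powRM _ pv0 k0) exprn_powR // sg2 -exprM.
    have -> : (dl / 2) `^ (p - 1) * (pi^-1 `^ (p - 1) * sg ^+ (2 * (K + j))) * (dl / 2) =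
       (dl / 2 * (dl / 2) `^ (p - 1)) * (pi^-1 `^ (p - 1) * sg ^+ (2 * (K + j))) by ring.
    rewrite mulr_powRB1 //.
    have -> : dl / 2 = e / (2 * A0) * tau ^+ j by rewrite /dl; field; rewrite gt_eqF.
    have h1 : 0 <= e / (2 * A0).
      by apply: divr_ge0; [exact: ltW|apply: mulr_ge0 => //; exact: ltW].
    have h2 : 0 <= tau ^+ j by rewrite exprn_ge0 // ltW.
    rewrite (powRM _ h1 h2).
    by rewrite exprn_powR ?(ltW tau0) // taup /c0; ring.
  rewrite E1 /B /kap !exprVn mulnDr exprD.
  have -> : sg ^+ (2 * j) = sg ^+ j * sg ^+ j by rewrite mul2n -addnn exprD.
  have x0 : sg ^+ (2 * K) != 0 by rewrite expf_neq0 // gt_eqF.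
  have y0 : sg ^+ j != 0 by rewrite expf_neq0 // gt_eqF.
  have z0 : c0 != 0 by rewrite gt_eqF.
  move: (sg ^+ (2 * K)) (sg ^+ j) (c0) x0 y0 z0 => x y z x0 y0 z0.
  by field; rewrite x0 y0 z0.
- apply: (@le_trans _ _ (B%:E * (b `^ p)%:E)%E).
    by apply: lee_wpmul2l => //; rewrite lee_fin.
  rewrite -EFinM lee_fin /B /Y -mulrA ler_pM2l //.
  rewrite -(mulr_powRB1 b0 p0) /kap exprVn mulrC ler_pdivrMr ?exprn_gt0 //.
  rewrite ler_wpM2l // exprM -sg2 -exprn_powR //.
  by apply: ge0_ler_powR; rewrite ?nnegrE ?exprn_ge0 // ltW.
exists L; split=> //.
- apply: (le_trans sL); rewrite mulrDl /Y; apply: lerD; first by lra.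
  by rewrite mulrAC.
- rewrite le_min => /andP[b1 bc]; apply: L0; first exact: K1.
  rewrite /Y mulrC ltr_pdivrMr // mul1r; lra.
move=> f G cf kf; have [k1 k2] := kL f kf.
apply: (fatou_Ecell wQ cf mV V0) => D.
have -> : eps * gint G Q = 2 * e / (1 - tau) ^+ 2 * gint G Q.
  by rewrite /e; field; rewrite subr_eq0 gt_eqF.
by apply: tree_energy k1 k2 D => //; [exact: ltW|rewrite tau0 tau1].
Qed.

End Cells.

(** * A discrete Hardy inequality; blocks, cells and the regular part of the strip *)

Section Blocks.
Context {R : realType}.
Notation mu := (leb2 R).
Notation T2 := (measurableTypeR R * measurableTypeR R)%type.
Notation S := (@strip R).
Implicit Types (Q P : @box R) (k n : nat) (f G V w : T2 -> R) (z j : int).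

(** With [y n = M n ^ 2 / 2 ^ n] the bound on the increments gives
[y n.+1 <= 3 / 4 * y n + O (t n + t n.+1)]; the factor is below 1 because the
weight halves while the square grows by at most [3 / 2] up to the error.  Hence
the [y n] are summable against the [t n]. *)
Lemma hardy (M v t : nat -> R) (c1 c2 : R) : 0 <= c1 -> 0 <= c2 ->
    M 0%N = 0 -> (forall n, 0 <= t n) ->
    (forall n, (M n.+1 - M n) ^+ 2 <= c1 * 2 ^+ n * (t n + t n.+1)) ->
    (forall n, M n = 0 \/ v n * 2 ^+ n <= c2) ->
  forall N, \sum_(n < N.+1) v n * M n ^+ 2 <= 12 * c1 * c2 * \sum_(n < N.+1) t n.
Proof.
move=> c10 c20 M0 t0 dM vM N.
pose y n := M n ^+ 2 / 2 ^+ n.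
have p2 n : 0 < 2 ^+ n :> R by rewrite exprn_gt0.
have y0 n : 0 <= y n by rewrite divr_ge0 ?sqr_ge0 // ltW.
have step n : y n.+1 <= 3 / 4 * y n + 3 / 2 * c1 * (t n + t n.+1).
  rewrite /y ler_pdivrMr //.
  have := @sqr_addW R (M n) (M n.+1 - M n) (1 / 2) ltac:(lra).
  have -> : M n + (M n.+1 - M n) = M n.+1 by ring.
  move/le_trans; apply.
  have -> : (3 / 4 * (M n ^+ 2 / 2 ^+ n) + 3 / 2 * c1 * (t n + t n.+1)) * 2 ^+ n.+1 =
     (1 + 1 / 2) * M n ^+ 2 + 3 * (c1 * 2 ^+ n * (t n + t n.+1)).
    by rewrite [2 ^+ n.+1]exprS; field; rewrite gt_eqF.
  by have := dM n; lra.
have main n : \sum_(i < n.+1) y i + 3 * y n <=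
    6 * c1 * \sum_(i < n) (t i + t i.+1).
  elim: n => [|n IH].
    by rewrite big_ord1 big_ord0 /y M0 expr0n /= mul0r !mulr0 addr0.
  rewrite big_ord_recr [X in _ <= _ * X]big_ord_recr /=.
  move: IH (step n).
  move: (\sum_(i < n.+1) y i) (\sum_(i < n) _) (y n) (y n.+1) (t n) (t n.+1).
  by move=> A B a b c d; lra.
have tb : \sum_(i < N) (t i + t i.+1) <= 2 * \sum_(i < N.+1) t i.
  rewrite big_split /=.
  have h1 : \sum_(i < N) t i <= \sum_(i < N.+1) t i by rewrite big_ord_recr /= lerDl.
  have h2 : \sum_(i < N) t i.+1 <= \sum_(i < N.+1) t i by rewrite big_ord_recl /= lerDr.
  by lra.
apply: (@le_trans _ _ (c2 * \sum_(n < N.+1) y n)).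
  rewrite mulr_sumr; apply: ler_sum => n _; rewrite /y.
  case: (vM n) => [->|h]; first by rewrite expr0n /= mul0r !mulr0.
  have -> : v n * M n ^+ 2 = (v n * 2 ^+ n) * (M n ^+ 2 / 2 ^+ n).
    by field; rewrite gt_eqF.
  by rewrite ler_wpM2r // divr_ge0 ?sqr_ge0 // ltW.
have -> : 12 * c1 * c2 * \sum_(n < N.+1) t n = c2 * (6 * c1 * (2 * \sum_(n < N.+1) t n)).
  by ring.
apply: ler_wpM2l => //; apply: (@le_trans _ _ (6 * c1 * \sum_(i < N) (t i + t i.+1))).
  by apply: le_trans (main N); rewrite lerDl mulr_ge0.
by rewrite ler_wpM2l // mulr_ge0.
Qed.

Definition slab (I : R * R) : @box R := (I, (0, pi)).
(** The box of the [z]-th rectangle, up to a null set. *)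
Definition blk z : @box R := slab (match z with
  | Posz 0 => (-1, 1)
  | Posz n.+1 => (2 ^+ n, 2 ^+ n.+1)
  | Negz n => (- 2 ^+ n.+1, - 2 ^+ n) end).
Definition cellb j : @box R := slab (j%:~R, (j + 1)%:~R).
Definition big N : @box R := slab (- 2 ^+ N, 2 ^+ N).
Definition depth z : nat := match z with
  | Posz 0 => 1%N | Posz n.+1 => n | Negz n => n end.
Definition lft z : int := match z with
  | Posz 0 => -1 | Posz n.+1 => (2 ^+ n)%R | Negz n => (- 2 ^+ n.+1)%R end.

Lemma wf_slab (a b : R) : a < b -> wf (slab (a, b)).
Proof. by move=> ab; rewrite /wf /= ab pi_gt0. Qed.

Lemma pow2_lt n : (2 : R) ^+ n < 2 ^+ n.+1.
Proof.
by have h : (0 : R) < 2 ^+ n; [rewrite exprn_gt0|rewrite exprS; lra].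
Qed.

Lemma wf_blk z : wf (blk z).
Proof.
case: z => [[|n]|n]; apply: wf_slab; first by lra.
  exact: pow2_lt.
by rewrite ltrN2; exact: pow2_lt.
Qed.

Lemma wf_cellb j : wf (cellb j).
Proof. by apply: wf_slab; rewrite ltr_int ltzD1. Qed.

Lemma wf_big N : wf (big N).
Proof.
by apply: wf_slab; have h : (0 : R) < 2 ^+ N; [rewrite exprn_gt0|lra].
Qed.

(** Every block has integer ends and a power of two as length, so that its
horizontal halvings end in unit cells. *)
Lemma blkE z : blk z = slab ((lft z)%:~R, (lft z + 2 ^+ depth z)%:~R).
Proof.
by rewrite /blk /lft /depth; case: z => [[|n]|n]; congr (slab (_, _));
  rewrite ?intrD ?intrN ?rmorphXn /= ?exprS ?expr0; ring.
Qed.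

Lemma hor_leaf k (x0 : int) P :
  P \in nodes hor k (slab (x0%:~R, (x0 + 2 ^+ k)%:~R)) -> exists j, P = cellb j.
Proof.
elim: k x0 => [|k IH] x0; first by rewrite inE expr0 => /eqP ->; exists x0.
set Q := slab _.
have -> : nodes hor k.+1 Q =
  nodes hor k (halve false false Q) ++ nodes hor k (halve false true Q) by [].
have m : mid false Q = (x0 + 2 ^+ k)%:~R.
  by rewrite /mid /= !intrD !rmorphXn /= exprS; field.
have -> : halve false false Q = slab (x0%:~R, (x0 + 2 ^+ k)%:~R) by rewrite /halve m.
have -> : halve false true Q = slab ((x0 + 2 ^+ k)%:~R, (x0 + 2 ^+ k + 2 ^+ k)%:~R).
  rewrite /halve m /cut /=; congr (slab (_, _)); congr (_%:~R).
  by rewrite exprS; ring.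
by rewrite mem_cat => /orP[] /IH.
Qed.

Lemma blk_leaf z P : P \in nodes hor (depth z) (blk z) -> exists j, P = cellb j.
Proof. by rewrite blkE; exact: hor_leaf. Qed.

(** The boxes are half-open, whereas the rectangles and the slices of the
strip are open; they agree away from the vertical lines through the integers,
which are negligible. *)
Definition intline z : set T2 := [set x | crd false x = z%:~R].
Definition reg : set T2 := S `\` \bigcup_z intline z.

Lemma int_bigcup (X : Type) (F : int -> set X) :
  \bigcup_z F z = \bigcup_(k : nat) (if unpickle k is Some z then F z else set0).
Proof.
apply/seteqP; split => x [].
  by move=> z _ Fz; exists (pickle z) => //; rewrite pickleK.
by move=> k _; case: unpickle => // z Fz; exists z.
Qed.

Lemma measurable_intline z : measurable (intline z).
Proof.
rewrite /intline -[X in measurable X]setTI.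
have ms : measurable ([set z%:~R] : set R) by rewrite -set_itv1; exact: measurable_itv.
exact: (@measurable_crd R false measurableT _ ms).
Qed.

Lemma measurable_reg : measurable reg.
Proof.
apply: measurableD; first exact: measurable_strip.
rewrite int_bigcup; apply: bigcup_measurable => k _.
by case: unpickle => // z; exact: measurable_intline.
Qed.

Lemma ae_reg : {ae mu, forall x, S x -> reg x}.
Proof.
have : {ae mu, forall x, ~ (\bigcup_z intline z) x}.
  have H k : {ae mu, forall x, ~ (if @unpickle int k is Some z then intline z else set0) x}.
    case: unpickle => [z|]; last by apply: aeW => x [].
    by apply: filterS (ae_line false (z%:~R : R)) => x.
  have := ae_foralln H; apply: filterS => x Hx.
  by rewrite int_bigcup => -[k _]; exact: Hx.
by apply: filterS => x nx xS; split.
Qed.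

Lemma reg_neq x z : reg x -> x.1 != z%:~R.
Proof. by move=> [_ nx]; apply/eqP => xz; apply: nx; exists z. Qed.

Lemma blk_rectangle z x : bset (blk z) x -> reg x -> rectangle z x.
Proof.
rewrite bsetE => /andP[/andP[h1 h2] _] rx; split; first by case: rx.
have n2 n : x.1 != 2 ^+ n by have := reg_neq (2 ^+ n) rx; rewrite rmorphXn.
have n3 n : x.1 != - 2 ^+ n by have := reg_neq (- 2 ^+ n) rx; rewrite intrN rmorphXn.
case: z h1 h2 => [[|n]|n] /= h1 h2; rewrite h1 lt_neqAle h2 andbT.
- by have := reg_neq 1 rx.
- exact: n2.
- exact: n3.
Qed.

Lemma cellb_sub j x : bset (cellb j) x -> reg x ->
  (S `&` [set x | j%:~R < x.1 < (j + 1)%:~R]) x.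
Proof.
rewrite bsetE => /andP[/andP[h1 h2] _] rx; split; first by case: rx.
by rewrite /= h1 lt_neqAle h2 reg_neq.
Qed.

End Blocks.

(** * The potential against the quantities a and b *)

Section Main.
Context {R : realType}.
Notation mu := (leb2 R).
Notation T2 := (measurableTypeR R * measurableTypeR R)%type.
Notation S := (@strip R).
Implicit Types (Q P : @box R) (k n N : nat) (z j : int).

(** Compares integrals over two domains neither of which contains the
other. *)
Lemma le_int_sub (B E : set T2) (h h' : T2 -> R) : measurable B -> measurable E ->
    measurable_fun B h -> measurable_fun E h' ->
    (forall x, B x -> 0 <= h x) -> (forall x, E x -> 0 <= h' x) ->
    (forall x, B x -> E x -> h x <= h' x) -> (forall x, B x -> ~ E x -> h x = 0) ->
  (\int[mu]_(x in B) (h x)%:E <= \int[mu]_(x in E) (h' x)%:E)%E.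
Proof.
move=> mB mE mh mh' h0 h'0 hle hz.
rewrite integral_mkcond [leRHS]integral_mkcond; apply: ge0_le_integral => //.
- by move=> x _; apply: erestrict_ge0 => y yB; rewrite lee_fin; exact: h0.
- by apply/(measurable_restrictT _ mB); exact/measurable_EFinP.
- by apply/(measurable_restrictT _ mE); exact/measurable_EFinP.
- move=> x _; rewrite /patch; case: ifPn => [/set_mem xB|_]; last first.
    by case: ifPn => // /set_mem xE; rewrite lee_fin; exact: h'0.
  case: ifPn => [/set_mem xE|/negP xE]; first by rewrite lee_fin; exact: hle.
  by rewrite hz // => xE'; apply: xE; exact: mem_set.
Qed.

Section Potential.
Variables (V : R * R -> R).
Hypothesis pV : potential S V.

(** The potential, changed on a null set so that its integrals over half-open
boxes do not exceed those over the open rectangles and slices. *)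
Definition Vt : T2 -> R := V \_ (@reg R).

Let mV : measurable_fun (S : set T2) (V : T2 -> R).
Proof. exact: pV.2.1. Qed.

Lemma Vt_ge0 x : 0 <= Vt x.
Proof.
rewrite /Vt /patch; case: ifPn => // /set_mem[xS _]; exact: (pV.1 x xS).
Qed.

Lemma Vt_reg x : @reg R x -> Vt x = V x.
Proof. by move=> rx; rewrite /Vt /patch mem_set. Qed.

Lemma Vt_nreg x : ~ @reg R x -> Vt x = 0.
Proof. by move=> rx; rewrite /Vt /patch memNset. Qed.

Lemma measurable_Vt : measurable_fun setT Vt.
Proof.
apply/(measurable_restrictT _ (@measurable_reg R)).
by apply: measurable_funS mV; [exact: measurable_strip|move=> x []].
Qed.

Lemma measurable_slice (a b : R) :
  measurable ((S `&` [set x | a < x.1 < b]) : set T2).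
Proof.
apply: measurableI; first exact: measurable_strip.
have mJ : measurable (`]a, b[%classic : set R) by exact: measurable_itv.
have -> : ([set x | a < x.1 < b] : set T2) =
    setT `&` (fun x : T2 => crd false x) @^-1` `]a, b[.
  by rewrite setTI; apply/funext => x; rewrite /= in_itv.
exact: (@measurable_crd R false measurableT _ mJ).
Qed.

Lemma measurable_rectangle z : measurable (@rectangle R z : set T2).
Proof.
case: z => [[|n]|n]; rewrite /rectangle /=.
- exact: (measurable_slice (-1) 1).
- exact: (measurable_slice (2 ^+ n) (2 ^+ n.+1)).
- exact: (measurable_slice (- 2 ^+ n.+1) (- 2 ^+ n)).
Qed.

(** The weight [1 + |x_1|] of [a_n] is comparable to the length of the
block. *)
Lemma blk_len_le z (x : T2) : bset (blk z) x -> len false (@blk R z) <= 2 * (1 + `|x.1|).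
Proof.
rewrite bsetE /len /blk /slab => /andP[/andP[h1 h2] _].
have hn := ler_norm x.1; have hn' := ler_norm (- x.1).
rewrite normrN in hn'.
by case: z h1 h2 => [[|n]|n] /= h1 h2; rewrite ?exprS in h1 h2 *; lra.
Qed.

Lemma int_Vt_blk z :
  ((len false (blk z))%:E * \int[mu]_(x in bset (blk z)) (Vt x)%:E <= 2%:E * a_ V z)%E.
Proof.
have l0 : 0 <= len false (@blk R z) by rewrite ltW // len_gt0 // wf_blk.
have mB := measurable_bset (@blk R z).
have mVB : measurable_fun (bset (blk z)) Vt by apply: measurable_funTS; exact: measurable_Vt.
have mE := measurable_rectangle z.
have mw : measurable_fun (@rectangle R z : set T2) (fun x : T2 => (1 + `|x.1|) * V x).
  apply: measurable_funM; last by apply: measurable_funS mV; [exact: measurable_strip|move=> x []].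
  apply: measurable_funTS; apply: measurable_funD; first exact: measurable_cst.
  apply: measurableT_comp; first exact: normr_measurable.
  exact: (@measurable_crd R false).
have w0 x : @rectangle R z x -> 0 <= (1 + `|x.1|) * V x.
  by move=> [xS _]; apply: mulr_ge0; [rewrite addr_ge0|exact: pV.1].
rewrite -!ge0_integralZl_EFin //; last 3 first.
- exact/measurable_EFinP.
- by move=> x _; rewrite lee_fin Vt_ge0.
- exact/measurable_EFinP.
apply: (@le_int_sub _ _ (fun x => len false (blk z) * Vt x)
  (fun x => 2 * ((1 + `|x.1|) * V x))) => //.
- by apply: measurable_funM => //; exact: measurable_cst.
- by apply: measurable_funM => //; exact: measurable_cst.
- by move=> x _; rewrite mulr_ge0 // Vt_ge0.
- by move=> x xE; apply: mulr_ge0 => //; exact: w0.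
- move=> x xB xE; have [rx|rx] := pselect (@reg R x); last first.
    by rewrite Vt_nreg // mulr0; apply: mulr_ge0 => //; exact: w0.
  rewrite Vt_reg // mulrA; apply: ler_wpM2r; first by apply: pV.1; case: rx.
  exact: blk_len_le.
- move=> x xB nE; rewrite Vt_nreg ?mulr0 // => rx; apply: nE; exact: blk_rectangle.
Qed.

Lemma int_Vt_cell (p : R) j : 0 < p ->
  (\int[mu]_(x in bset (cellb j)) (Vt x `^ p)%:E <=
   \int[mu]_(x in S `&` [set x | j%:~R < x.1 < (j + 1)%:~R]%R) (V x `^ p)%:E)%E.
Proof.
move=> p0.
have mE : measurable ((S `&` [set x | j%:~R < x.1 < (j + 1)%:~R]) : set T2).
  exact: measurable_slice.
apply: (@le_int_sub _ _ (fun x => Vt x `^ p) (fun x => V x `^ p)) => //.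
- exact: measurable_bset.
- apply: (measurableT_comp (measurable_powR p)); apply: measurable_funTS.
  exact: measurable_Vt.
- apply: (measurableT_comp (measurable_powR p)).
  by apply: measurable_funS mV; [exact: measurable_strip|move=> x []].
- by move=> x _; exact: powR_ge0.
- by move=> x _; exact: powR_ge0.
- move=> x _ _; have [rx|rx] := pselect (@reg R x); first by rewrite Vt_reg.
  by rewrite Vt_nreg // powR0 ?gt_eqF // powR_ge0.
- move=> x xB nE; rewrite Vt_nreg ?powR0 ?gt_eqF // => rx; apply: nE.
  exact: cellb_sub.
Qed.

End Potential.
End Main.

(** * Energy on an exhausting family of blocks *)

Section Energy.
Context {R : realType}.
Notation mu := (leb2 R).
Notation T2 := (measurableTypeR R * measurableTypeR R)%type.
Notation S := (@strip R).
Implicit Types (Q P : @box R) (k n N : nat) (z j : int).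

Lemma slab_cut (a m b : R) : a <= m <= b ->
  bset (slab (a, b)) = bset (slab (a, m)) `|` bset (slab (m, b)).
Proof. by move=> amb; exact: (@bset_cut R false m (slab (a, b))). Qed.

Lemma int_slab_add (h : T2 -> R) (a m b : R) : a <= m <= b ->
    measurable_fun setT h -> (forall x, 0 <= h x) ->
  (\int[mu]_(x in bset (slab (a, b))) (h x)%:E =
   \int[mu]_(x in bset (slab (a, m))) (h x)%:E +
   \int[mu]_(x in bset (slab (m, b))) (h x)%:E)%E.
Proof.
move=> amb mh h0; rewrite (slab_cut amb) ge0_integral_setU //.
- exact: measurable_bset.
- exact: measurable_bset.
- by apply/measurable_EFinP; exact: measurable_funTS.
- by move=> x _; rewrite lee_fin.
- exact: (@disj_cut R false m (slab (a, b))).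
Qed.

(** Enumerates the blocks to the left, starting from the central block, as
[Posz] does to the right. *)
Definition ngz n : int := if n is n'.+1 then Negz n' else Posz 0.

Lemma int_big (h : T2 -> R) N : measurable_fun setT h -> (forall x, 0 <= h x) ->
  (\int[mu]_(x in bset (big N)) (h x)%:E =
   \int[mu]_(x in bset (blk 0)) (h x)%:E +
   \sum_(n < N) (\int[mu]_(x in bset (blk (Posz n.+1))) (h x)%:E +
                 \int[mu]_(x in bset (blk (ngz n.+1))) (h x)%:E))%E.
Proof.
move=> mh h0; elim: N => [|N IH]; first by rewrite big_ord0 adde0 /big expr0.
have p2 : (2 : R) ^+ N < 2 ^+ N.+1 := pow2_lt N.
have p0 : (0 : R) < 2 ^+ N by rewrite exprn_gt0.
rewrite big_ord_recr /= addeA -IH /big.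
rewrite (@int_slab_add h _ (2 ^+ N)) //; last by apply/andP; split; lra.
rewrite (@int_slab_add h _ (- 2 ^+ N) (2 ^+ N)) //; last by apply/andP; split; lra.
by rewrite -addeA addeC -addeA.
Qed.

Section Fix.
Variables (F G U : T2 -> R).
Hypothesis cF : forall a b, a < b -> ctrl F G (slab (a, b)).
Hypotheses (mF : measurable_fun setT F) (mG : measurable_fun setT G).
Hypotheses (mU : measurable_fun setT U) (U0 : forall x, 0 <= U x).
Hypothesis HC : forall j,
  (\int[mu]_(x in bset (cellb j)) ((F x - avg F (cellb j)) ^+ 2 * U x)%:E
     <= (1 / 18 * gint G (cellb j))%:E)%E.
Hypothesis HL : forall z D,
  (\int[mu]_(x in bset (blk z)) ((Ecell F hor D (blk z) x - avg F (blk z)) ^+ 2 * U x)%:E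
     <= (1 / 18 * gint G (blk z))%:E)%E.

Let G0 x : 0 <= G x.
Proof. by have [] := cF (ltr01 : (0 : R) < 1). Qed.

Let iG (a b : R) : a < b -> mu.-integrable (bset (slab (a, b))) (EFin \o G).
Proof. by case/cF. Qed.

Let gintE (a b : R) : a < b ->
  ((gint G (slab (a, b)))%:E = \int[mu]_(x in bset (slab (a, b))) (G x)%:E)%E.
Proof.
move=> ab; rewrite /gint /Rintegral fineK //.
by apply: (integrable_fin_num (measurable_bset _)); exact: iG.
Qed.

Let gint_add (a m b : R) : a < m -> m < b ->
  gint G (slab (a, b)) = gint G (slab (a, m)) + gint G (slab (m, b)).
Proof.
move=> am mb; apply/EFin_inj; rewrite EFinD !gintE ?(lt_trans am mb) //.
by apply: int_slab_add => //; rewrite !ltW.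
Qed.

(** [f] is split into its deviation from the cell average, the deviation of
the latter from the block average, and the block average; the constant 3 is that
of [(a + b + c)^2 <= 3 (a^2 + b^2 + c^2)], so that [1 / 18] for each of the first
two leaves [1 / 3]. *)
Lemma block_energy z : (\int[mu]_(x in bset (blk z)) (U x)%:E < +oo)%E ->
  (\int[mu]_(x in bset (blk z)) (U x * F x ^+ 2)%:E <=
   (1 / 3 * gint G (blk z) +
    3 * (fine (\int[mu]_(x in bset (blk z)) (U x)%:E) * avg F (blk z) ^+ 2))%:E)%E.
Proof.
move=> Ufin; set Q := blk z; set M := avg F Q.
have wQ : wf Q by exact: wf_blk.
have mQ := measurable_bset Q.
have cQ : ctrl F G Q.
  by rewrite /Q blkE; apply: cF; rewrite ltr_int ltrDl exprn_gt0.
have [iF iGQ _ _] := cQ.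
pose E (x : T2) := Ecell F hor (depth z) Q x.
have mE : measurable_fun (bset Q) E by exact: measurable_Ecell.
have mUQ : measurable_fun (bset Q) U by exact: measurable_funTS.
have mFQ : measurable_fun (bset Q) F by exact: measurable_funTS.
pose h1 x := (F x - E x) ^+ 2 * U x.
pose h2 x := (E x - M) ^+ 2 * U x.
pose h3 x := M ^+ 2 * U x.
have m1 : measurable_fun (bset Q) h1.
  by apply: measurable_funM => //; apply: (measurable_funX 2); exact: measurable_funB.
have m2 : measurable_fun (bset Q) h2.
  by apply: measurable_funM => //; apply: (measurable_funX 2); apply: measurable_funB.
have m3 : measurable_fun (bset Q) h3.
  by apply: measurable_funM => //; exact: measurable_cst.
have p1 x : 0 <= h1 x by rewrite mulr_ge0 ?sqr_ge0.
have p2 x : 0 <= h2 x by rewrite mulr_ge0 ?sqr_ge0.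
have p3 x : 0 <= h3 x by rewrite mulr_ge0 ?sqr_ge0.
have I1 : (\int[mu]_(x in bset Q) (h1 x)%:E <= (1 / 18 * gint G Q)%:E)%E.
  pose Psi P (x : T2) := (F x - avg F P) ^+ 2 * U x.
  rewrite (ge0_int_node_dep hor (depth z) (Psi := Psi)) //; last 2 first.
  - move=> P; apply: measurable_funM => //; apply: (measurable_funX 2).
    by apply: measurable_funB => //; exact: measurable_cst.
  - by move=> P x; rewrite mulr_ge0 ?sqr_ge0.
  rewrite -(sum_gint hor (depth z) wQ iGQ) mulr_sumr -sumEFin big_seq [leRHS]big_seq.
  by apply: lee_sum => P /blk_leaf[j ->]; exact: HC.
have I2 : (\int[mu]_(x in bset Q) (h2 x)%:E <= (1 / 18 * gint G Q)%:E)%E by exact: HL.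
have v0 : (0 <= \int[mu]_(x in bset Q) (U x)%:E)%E.
  by apply: integral_ge0 => x _; rewrite lee_fin.
have I3 : (\int[mu]_(x in bset Q) (h3 x)%:E =
   (M ^+ 2 * fine (\int[mu]_(x in bset Q) (U x)%:E))%:E)%E.
  rewrite /h3; under eq_integral do rewrite EFinM.
  rewrite ge0_integralZl_EFin ?sqr_ge0 //.
  - by rewrite [RHS]EFinM fineK // ge0_fin_numE.
  - by move=> x _; rewrite lee_fin.
  - exact/measurable_EFinP.
apply: (@le_trans _ _ (3%:E * (\int[mu]_(x in bset Q) (h1 x)%:E +
   \int[mu]_(x in bset Q) (h2 x)%:E + \int[mu]_(x in bset Q) (h3 x)%:E))%E).
  have mm (w : T2 -> R) : measurable_fun (bset Q) w -> measurable_fun (bset Q) (fun x : T2 => (w x)%:E).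
    by move=> mk; exact/measurable_EFinP.
  rewrite -ge0_integralD //; [|by move=> x _; rewrite lee_fin|exact: mm
     |by move=> x _; rewrite lee_fin|exact: mm].
  rewrite -ge0_integralD //; [|by move=> x _; rewrite -EFinD lee_fin addr_ge0
    |by apply: emeasurable_funD; exact: mm
    |by move=> x _; rewrite lee_fin|exact: mm].
  rewrite -ge0_integralZl_EFin //; last 2 first.
  - by move=> x _; rewrite -!EFinD lee_fin !addr_ge0.
  - by do 2 (apply: emeasurable_funD; [|exact: mm]); exact: mm.
  apply: ge0_le_integral => //.
  - by move=> x _; rewrite lee_fin mulr_ge0 ?sqr_ge0.
  - by apply: mm; apply: measurable_funM => //; exact: (measurable_funX 2).
  - apply: emeasurable_funM => //.
    by do 2 (apply: emeasurable_funD; [|exact: mm]); exact: mm.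
  - move=> x _; rewrite -!EFinD -EFinM lee_fin /h1 /h2 /h3 -!mulrDl mulrA mulrC.
    apply: ler_wpM2r => //.
    move: (F x) (E x) => a b; move: (M) => c.
    have s1 := sqr_ge0 (a - b - (b - c)); have s2 := sqr_ge0 (b - c - c).
    by have s3 := sqr_ge0 (a - b - c); lra.
rewrite I3; apply: (@le_trans _ _ (3%:E * ((1 / 18 * gint G Q)%:E + (1 / 18 * gint G Q)%:E
   + (M ^+ 2 * fine (\int[mu]_(x in bset Q) (U x)%:E))%:E))%E).
  by apply: lee_wpmul2l => //; do 2 apply: leeD => //.
by rewrite -!EFinD -EFinM lee_fin; lra.
Qed.

Hypothesis Ufin : forall z, (\int[mu]_(x in bset (blk z)) (U x)%:E < +oo)%E.
Let v z := fine (\int[mu]_(x in bset (blk z)) (U x)%:E).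
Hypothesis H0 : avg F (blk 0) = 0.
Variable c2 : R.
Hypothesis c20 : 0 <= c2 <= 1 / 1000.
Hypothesis HH : forall n, (avg F (blk n%:Z) = 0 \/ v n%:Z * 2 ^+ n <= c2) /\
                          (avg F (blk (ngz n)) = 0 \/ v (ngz n) * 2 ^+ n <= c2).

(** The two pieces need not have equal widths: [ctrl] allows cuts at any
point, and neighbouring blocks have ratio 2. *)
Let adj (a m b c : R) : a < m -> m < b -> b - a <= 4 * c ->
  (avg F (slab (m, b)) - avg F (slab (a, m))) ^+ 2 <=
  2 * c * (gint G (slab (a, m)) + gint G (slab (m, b))).
Proof.
move=> am mb bac; have ab := lt_trans am mb.
have [_ _ _ /(_ (slab (a, b)) false m (wf_slab ab) (@subset_refl _ _))] := cF ab.
rewrite am mb => /(_ isT) H.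
apply: (le_trans H); rewrite (gint_add am mb); apply: ler_wpM2r.
  by rewrite addr_ge0 // gint_ge0.
rewrite /len /= subr0 ler_pdivrMr ?pi_gt0 //.
by have := pi_ge2 R; nra.
Qed.

Let hardy_pos N : \sum_(n < N.+1) v n%:Z * avg F (blk n%:Z) ^+ 2 <=
  12 * 2 * c2 * \sum_(n < N.+1) gint G (blk n%:Z).
Proof.
have /andP[c2_0 _] := c20.
apply: (@hardy R (fun n => avg F (blk n%:Z)) (fun n => v n%:Z)
  (fun n => gint G (blk n%:Z)) 2 c2 _ c2_0 H0); first by [].
- by move=> n; exact: gint_ge0.
- case=> [|n].
    have -> : blk 1%:Z = slab (1, 2 : R) by rewrite /blk expr0 expr1.
    by rewrite expr0; apply: adj; lra.
  have p0 : (0 : R) < 2 ^+ n by rewrite exprn_gt0.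
  by apply: (@adj (2 ^+ n) (2 ^+ n.+1) (2 ^+ n.+2) (2 ^+ n.+1)); rewrite !exprS; lra.
- by move=> n; have [] := HH n.
Qed.

Let hardy_neg N : \sum_(n < N.+1) v (ngz n) * avg F (blk (ngz n)) ^+ 2 <=
  12 * 2 * c2 * \sum_(n < N.+1) gint G (blk (ngz n)).
Proof.
have /andP[c2_0 _] := c20.
apply: (@hardy R (fun n => avg F (blk (ngz n))) (fun n => v (ngz n))
  (fun n => gint G (blk (ngz n))) 2 c2 _ c2_0 H0); first by [].
- by move=> n; exact: gint_ge0.
- move=> n; rewrite -sqrrN opprB [gint _ _ + _]addrC; case: n => [|n].
    have -> : blk (ngz 1) = slab (-2, -1 : R) by rewrite /blk /= expr0 expr1.
    by rewrite expr0; apply: adj; lra.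
  have p0 : (0 : R) < 2 ^+ n by rewrite exprn_gt0.
  by apply: (@adj (- 2 ^+ n.+2) (- 2 ^+ n.+1) (- 2 ^+ n) (2 ^+ n.+1));
    rewrite !exprS; lra.
- by move=> n; have [] := HH n.
Qed.

(** Each half of the strip contributes [24 * c2 * T] by [hardy]; with the
factor 3 of [block_energy] the averages cost at most [144 * c2 * T], less than
[T / 6] as [c2 <= 1 / 1000]. *)
Lemma big_energy (T : R) N : (\int[mu]_x (G x)%:E <= T%:E)%E ->
  (\int[mu]_(x in bset (big N)) (U x * F x ^+ 2)%:E <= (T / 2)%:E)%E.
Proof.
move=> GT.
have GN : gint G (blk 0) + \sum_(n < N) (gint G (blk (Posz n.+1)) + gint G (blk (ngz n.+1))) <= T.
  rewrite -lee_fin; apply: le_trans GT.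
  have gb z : ((gint G (blk z))%:E = \int[mu]_(x in bset (blk z)) (G x)%:E)%E.
    by rewrite blkE; apply: gintE; rewrite ltr_int ltrDl exprn_gt0.
  rewrite EFinD -sumEFin gb.
  under eq_bigr do rewrite EFinD !gb.
  rewrite -int_big //; apply: ge0_subset_integral => //.
  - exact: measurable_bset.
  - exact/measurable_EFinP.
  - by move=> x _; rewrite lee_fin.
rewrite int_big; last 2 first.
- by apply: measurable_funM => //; exact: (measurable_funX 2).
- by move=> x; rewrite mulr_ge0 ?sqr_ge0.
pose B z := 1 / 3 * gint G (blk z) + 3 * (v z * avg F (blk z) ^+ 2).
apply: (@le_trans _ _ ((B 0)%:E + \sum_(n < N) ((B (Posz n.+1))%:E + (B (ngz n.+1))%:E))%E).
  apply: leeD; first exact: block_energy.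
  by apply: lee_sum => n _; apply: leeD; exact: block_energy.
under eq_bigr do rewrite -EFinD.
rewrite sumEFin -EFinD lee_fin.
have g0 z : 0 <= gint G (blk z) by exact: gint_ge0.
pose s1 := \sum_(n < N) gint G (blk (Posz n.+1)).
pose s2 := \sum_(n < N) gint G (blk (ngz n.+1)).
pose w1 := \sum_(n < N) v (Posz n.+1) * avg F (blk (Posz n.+1)) ^+ 2.
pose w2 := \sum_(n < N) v (ngz n.+1) * avg F (blk (ngz n.+1)) ^+ 2.
have s10 : 0 <= s1 by exact: sumr_ge0.
have s20 : 0 <= s2 by exact: sumr_ge0.
have hp : w1 <= 24 * c2 * (gint G (blk 0) + s1).
  have := hardy_pos N; rewrite big_ord_recl [X in _ <= _ * X -> _]big_ord_recl.
  rewrite H0 expr0n /= mulr0 add0r => h; apply: (le_trans h).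
  by rewrite -/s1; lra.
have hn : w2 <= 24 * c2 * (gint G (blk 0) + s2).
  have := hardy_neg N; rewrite big_ord_recl [X in _ <= _ * X -> _]big_ord_recl.
  rewrite [avg F (blk (ngz 0))]H0 expr0n /= mulr0 add0r => h; apply: (le_trans h).
  by rewrite -/s2; lra.
have GN' : gint G (blk 0) + s1 + s2 <= T by move: GN; rewrite big_split addrA.
have BE : B 0 + \sum_(n < N) (B (Posz n.+1) + B (ngz n.+1)) =
    1 / 3 * (gint G (blk 0) + s1 + s2) + 3 * (w1 + w2).
  rewrite big_split /= /B !big_split /= -!mulr_sumr -/s1 -/s2 -/w1 -/w2.
  by rewrite H0 expr0n /= mulr0; ring.
rewrite BE; have /andP[c2_0 c2_1] := c20; have g00 := g0 0.
have h3 : 24 * c2 * (gint G (blk 0) + s1) + 24 * c2 * (gint G (blk 0) + s2) <= 48 * c2 * T.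
  have -> : 24 * c2 * (gint G (blk 0) + s1) + 24 * c2 * (gint G (blk 0) + s2) =
    (24 * c2) * (2 * gint G (blk 0) + s1 + s2) by ring.
  have -> : 48 * c2 * T = (24 * c2) * (2 * T) by ring.
  by apply: ler_wpM2l; lra.
have T0 : 0 <= T by lra.
have h4 : 48 * c2 * T <= 48 * (1 / 1000) * T by apply: ler_wpM2r => //; lra.
by lra.
Qed.

End Fix.
End Energy.

(** * The energy inequality and its case of equality *)

Section Reduction.
Context {R : realType}.
Notation mu := (leb2 R).
Notation T2 := (measurableTypeR R * measurableTypeR R)%type.
Notation S := (@strip R).
Implicit Types (Q P : @box R) (k n N : nat) (z j : int).

Lemma big_mono : {homo (fun N => bset (@big R N)) : n m / (n <= m)%N >-> (n <= m)%O}.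
Proof.
move=> n m nm; apply/subsetPset => x; rewrite !bsetE /= => /andP[/andP[h1 h2] ->].
have h : (2 : R) ^+ n <= 2 ^+ m by rewrite ler_weXn2l // ler1n.
by rewrite andbT; apply/andP; split; lra.
Qed.

Lemma strip_big : S `<=` \bigcup_N bset (big N).
Proof.
move=> x; rewrite /strip /= => /andP[x0 xpi].
exists (Num.bound `|x.1|) => //; rewrite bsetE /= x0 (ltW xpi) !andbT.
have h : `|x.1| < 2 ^+ Num.bound `|x.1|.
  apply: (lt_trans (archi_boundP _)) => //.
  by rewrite -natrX ltr_nat ltn_expl.
by move: h; rewrite ltr_norml => /andP[-> /ltW].
Qed.

Lemma integral_bigs (h : T2 -> R) (c : \bar R) : measurable_fun setT h ->
    (forall x, 0 <= h x) ->
    (forall N, (\int[mu]_(x in bset (big N)) (h x)%:E <= c)%E) ->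
  (\int[mu]_(x in S) (h x)%:E <= c)%E.
Proof.
move=> mh h0 hc; have mB N := measurable_bset (@big R N).
have cv := @ge0_nondecreasing_set_cvg_integral _ _ R (fun n => bset (big n))
  (fun x => (h x)%:E) mu big_mono mB _ _.
have mhB i : measurable_fun (bset (big i)) (fun x : T2 => (h x)%:E).
  by apply/measurable_EFinP; exact: measurable_funTS.
have hB0 i x : bset (big i) x -> (0 <= (h x)%:E)%E by rewrite lee_fin.
have {}cv := cv mhB hB0.
apply: (@le_trans _ _ (\int[mu]_(x in \bigcup_N bset (big N)) (h x)%:E)%E).
  apply: ge0_subset_integral => //.
  - exact: measurable_strip.
  - exact: bigcup_measurable.
  - by apply/measurable_EFinP; exact: measurable_funTS.
  - by move=> x _; rewrite lee_fin.
  - exact: strip_big.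
have <- := cvg_lim _ cv; last by [].
apply: lime_le; first by apply/cvg_ex; eexists; exact: cv.
exact: nearW.
Qed.

Section Fix.
Variables (V f : R * R -> R) (g : (R * R -> R) * (R * R -> R)).
Hypotheses (pV : potential S V) (f2 : L2loc S f) (fg : is_weak_grad S f g).
Hypothesis (dfin : (\int[mu]_(x in S) (g.1 x ^+ 2 + g.2 x ^+ 2)%:E < +oo)%E).

Lemma int_potential : (\int[mu]_(x in S) (V x * f x ^+ 2)%:E =
  \int[mu]_(x in S) (Vt V x * ext f x ^+ 2)%:E)%E.
Proof.
have mS := @measurable_strip R.
have mV : measurable_fun (S : set T2) (V : T2 -> R) := pV.2.1.
have mf : measurable_fun (S : set T2) (f : T2 -> R) := f2.1.
have E : {ae mu, forall x : T2, S x -> (V x * f x ^+ 2)%:E = (Vt V x * ext f x ^+ 2)%:E}.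
  have FF := ae_filter_ringOfSetsType mu.
  apply: (@filterS _ _ FF _ _ _ (@ae_reg R)) => x H xS; rewrite Vt_reg; last exact: H.
  by rewrite /ext /patch mem_set.
apply: (@ae_eq_integral _ T2 R mu) => //.
- apply/measurable_EFinP; apply: measurable_funM => //; exact: (measurable_funX 2).
- apply/measurable_EFinP; apply: measurable_funTS; apply: measurable_funM.
    exact: measurable_Vt.
  apply: (measurable_funX 2); exact: mext_f.
Qed.

Hypothesis HC : forall j,
  (\int[mu]_(x in bset (cellb j)) ((ext f x - avg (ext f) (cellb j)) ^+ 2 * Vt V x)%:E
     <= (1 / 18 * gint (grad2 g) (cellb j))%:E)%E.
Hypothesis HL : forall z D,
  (\int[mu]_(x in bset (blk z))
     ((Ecell (ext f) hor D (blk z) x - avg (ext f) (blk z)) ^+ 2 * Vt V x)%:E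
     <= (1 / 18 * gint (grad2 g) (blk z))%:E)%E.
Hypothesis afin : forall z, (a_ V z < +oo)%E.
Hypothesis H0 : avg (ext f) (blk 0) = 0.
Hypothesis HH : forall z, avg (ext f) (blk z) = 0 \/ (a_ V z <= (1 / 4000)%:E)%E.

Let mVt := measurable_Vt pV.

Let int0 z : (0 <= \int[mu]_(x in bset (blk z)) (Vt V x)%:E)%E.
Proof. by apply: integral_ge0 => x _; rewrite lee_fin Vt_ge0. Qed.

Lemma int_Vt_fin z : (\int[mu]_(x in bset (blk z)) (Vt V x)%:E < +oo)%E.
Proof.
have l0 := len_gt0 false (@wf_blk R z).
have := int_Vt_blk pV z; have := afin z; have := int0 z.
move: (\int[mu]_(x in _) _)%E => I I0; case: I I0 => [r|//|//] _; first by rewrite ltry.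
case: (a_ V z) => [a|//|] _; rewrite mulry gtr0_sg // mul1e.
  by rewrite -EFinM leye_eq.
by rewrite mulrNy gtr0_sg // mul1e.
Qed.

(** The constant [1 / 4000] is what makes [v_z * 2 ^ n], which is at most
[4 * a_z], no larger than [1 / 1000]. *)
Lemma strip_energy : (\int[mu]_(x in S) (V x * f x ^+ 2)%:E <=
  (fine (\int[mu]_(x in S) (g.1 x ^+ 2 + g.2 x ^+ 2)%:E) / 2)%:E)%E.
Proof.
have d0 : (0 <= \int[mu]_(x in S) (g.1 x ^+ 2 + g.2 x ^+ 2)%:E)%E.
  by apply: integral_ge0 => x _; rewrite lee_fin addr_ge0 ?sqr_ge0.
rewrite int_potential; apply: integral_bigs.
- apply: measurable_funM => //; apply: (measurable_funX 2); exact: mext_f.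
- by move=> x; rewrite mulr_ge0 ?sqr_ge0 // Vt_ge0.
move=> N; apply: (@big_energy R (ext f) (grad2 g) (Vt V) _ _ _ _ _ _ _ _ _ (1 / 1000)) => //.
- by move=> a b; exact: strip_ctrl.
- exact: mext_f.
- by apply: measurable_grad2 fg.
- exact: Vt_ge0.
- exact: int_Vt_fin.
- by apply/andP; split; lra.
- have vsmall z n : 2 ^+ n <= 2 * len false (@blk R z) ->
      (a_ V z <= (1 / 4000)%:E)%E ->
      fine (\int[mu]_(x in bset (blk z)) (Vt V x)%:E) * 2 ^+ n <= 1 / 1000.
    move=> hn ha; have := int_Vt_blk pV z; have := int_Vt_fin z; have := int0 z.
    case: integral => // v; rewrite lee_fin => v0 _ /= h.
    have : len false (@blk R z) * v <= 2 * (1 / 4000).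
      by rewrite -lee_fin; apply: (le_trans h); rewrite EFinM; apply: lee_wpmul2l.
    have := ler_wpM2l v0 hn; move: (len false _) (2 ^+ n) => l e; lra.
  have p2 n : (0 : R) < 2 ^+ n by rewrite exprn_gt0.
  move=> n; split.
    case: (HH n) => h; [by left|right]; apply: (vsmall _ _ _ h).
    by rewrite /len; case: n {h} => [|n] /=; rewrite ?exprS ?expr0; [lra|have := p2 n; lra].
  case: (HH (ngz n)) => h; [by left|right]; apply: (vsmall _ _ _ h).
  by rewrite /len; case: n {h} => [|n] /=; rewrite ?exprS ?expr0; [lra|have := p2 n; lra].
- by rewrite grad2E fineK // ge0_fin_numE.
Qed.

(** The energy inequality gains a factor 2, so the reverse inequality leaves
no energy at all. *)
Lemma null_energy_eq0 :
  (\int[mu]_(x in S) (g.1 x ^+ 2 + g.2 x ^+ 2)%:E <= \int[mu]_(x in S) (V x * f x ^+ 2)%:E)%E ->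
  {ae mu, forall x, S x -> f x = 0}.
Proof.
move=> hle.
have d0 : (0 <= \int[mu]_(x in S) (g.1 x ^+ 2 + g.2 x ^+ 2)%:E)%E.
  by apply: integral_ge0 => x _; rewrite lee_fin addr_ge0 ?sqr_ge0.
have {hle}D0 : (\int[mu]_(x in S) (g.1 x ^+ 2 + g.2 x ^+ 2)%:E = 0)%E.
  have := le_trans hle strip_energy; move: d0 dfin.
  case: integral => // d; rewrite !lee_fin /= => d1 _ d2; congr (_%:E); lra.
have G0 : (\int[mu]_x (grad2 g x)%:E = 0)%E by rewrite grad2E.
have gi0 Q : gint (grad2 g) Q = 0.
  rewrite /gint /Rintegral; suff -> : (\int[mu]_(x in bset Q) (grad2 g x)%:E = 0)%E by [].
  apply/eqP; rewrite eq_le; apply/andP; split.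
    rewrite -G0; apply: ge0_subset_integral => //.
    - exact: measurable_bset.
    - by apply/measurable_EFinP; apply: measurable_grad2 fg.
    - by move=> x _; rewrite lee_fin grad2_ge0.
  by apply: integral_ge0 => x _; rewrite lee_fin grad2_ge0.
have ctN N : {ae mu, forall x, bset (big N) x -> ext f x = avg (ext f) (big N)}.
  have mB := measurable_bset (@big R N).
  have h : (0 : R) < 2 ^+ N by rewrite exprn_gt0.
  have wB : wf (@big R N) by apply: wf_big.
  have cB : ctrl (ext f) (grad2 g) (big N) by apply: strip_ctrl => //; lra.
  have mh : measurable_fun (bset (big N))
      (fun x : T2 => ((ext f x - avg (ext f) (big N)) ^+ 2)%:E).
    apply/measurable_EFinP; apply: measurable_funTS; apply: (measurable_funX 2).
    by apply: measurable_funB => //; exact: mext_f.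
  have := poincare wB cB; rewrite gi0 mulr0 => p0.
  have : (\int[mu]_(x in bset (big N)) `|((ext f x - avg (ext f) (big N)) ^+ 2)%:E| = 0)%E.
    under eq_integral => x _ do rewrite gee0_abs ?lee_fin ?sqr_ge0 //.
    apply/eqP; rewrite eq_le p0; apply: integral_ge0 => x _.
    by rewrite lee_fin sqr_ge0.
  move=> /(ae_eq_integral_abs mu mB mh); apply: filterS => x H xB.
  by apply/eqP; rewrite -subr_eq0 -sqrf_eq0; apply/eqP; case: (H xB).
have avg0 N : avg (ext f) (big N) = 0.
  have -> : avg (ext f) (big N) = avg (ext f) (blk 0); last exact: H0.
  have w0 := @wf_blk R 0; have a0 := area_gt0 w0; have m0 := measurable_bset (@blk R 0).
  have s0 : bset (@blk R 0) `<=` bset (big N).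
    have : bset (big 0) `<=` bset (@big R N) by apply/subsetPset/big_mono.
    by rewrite /big expr0.
  rewrite [RHS]/avg.
  have -> : \int[mu]_(x in bset (blk 0)) ext f x =
      \int[mu]_(x in bset (blk 0)) avg (ext f) (big N).
    have E : {ae mu, forall x : T2, bset (blk 0) x ->
        (ext f x)%:E = (avg (ext f) (big N))%:E}.
      have FF := ae_filter_ringOfSetsType mu.
      by apply: (@filterS _ _ FF _ _ _ (ctN N)) => x H /s0 /H ->.
    rewrite /Rintegral; congr fine.
    apply: (@ae_eq_integral _ T2 R mu) => //.
    - apply/measurable_EFinP; apply: measurable_funTS; exact: mext_f.
  have -> := @Rintegral_cst _ T2 R mu _ m0 (avg (ext f) (big N)).
  have -> : fine (mu (bset (blk 0))) = area (@blk R 0) by rewrite [mu _]mu_bset.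
  by rewrite mulfK // gt_eqF.
have : {ae mu, forall x N, bset (big N) x -> ext f x = 0}.
  by apply: ae_foralln => N; apply: filterS (ctN N) => x H /H; rewrite avg0.
apply: filterS => x H xS; have [N _ /H] := strip_big xS.
by rewrite /ext /patch mem_set.
Qed.

End Fix.
End Reduction.

(** * Linear conditions *)

Section Codes.
Context {R : realType}.
Notation mu := (leb2 R).
Notation T2 := (measurableTypeR R * measurableTypeR R)%type.
Notation S := (@strip R).
Implicit Types (Q P : @box R) (k n N : nat).

(** A finite sum has finitely many terms above a positive level, so that each
of the two sums in the bound is attained on a finite list of indices. *)
Lemma esum_lb_finite (T : choiceType) (A : set T) (a : T -> \bar R) (c : R) : 0 < c ->
    (forall z : T, A z -> c%:E <= a z)%E -> (\esum_(z in A) a z < +oo)%E ->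
  exists s : seq T, [/\ uniq s, A = [set` s] &
    (\esum_(z in A) a z = \sum_(z <- s) a z)%E].
Proof.
move=> c0 ca afin.
have a0 (z : T) : A z -> (0 <= a z)%E by move=> /ca; apply: le_trans; rewrite lee_fin ltW.
have fA : finite_set A.
  apply: contrapT => /infinite_set_fset iA.
  have e0 : (0 <= \esum_(z in A) a z)%E by exact: esum_ge0.
  pose e := fine (\esum_(z in A) a z).
  have eE : (\esum_(z in A) a z = e%:E)%E by rewrite fineK // ge0_fin_numE.
  have [B BA hB] := iA (Num.bound (e / c)).
  have ub := finmap.fset_uniq B.
  have : (\sum_(z <- finmap.enum_fset B) a z <= e%:E)%E.
    rewrite -eE; apply: esum_ge; exists [set` finmap.enum_fset B].
      by split; [apply/finite_seqP; eexists|exact: BA].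
    by rewrite -fsbig_seq.
  apply/negP; rewrite -ltNge.
  apply: (@lt_le_trans _ _ (\sum_(z <- finmap.enum_fset B) c%:E)%E); last first.
    rewrite big_seq [leRHS]big_seq; apply: lee_sum => z zB; apply: ca; exact: BA.
  rewrite sumEFin lte_fin big_const_seq count_predT iter_addr_0 -mulr_natr.
  rewrite mulrC -ltr_pdivrMr //.
  apply: (lt_le_trans (archi_boundP _)); last by rewrite ler_nat.
  by apply: divr_ge0; [exact: fine_ge0|exact: ltW].
have /finite_seqP[s As] := fA.
exists (undup s); have us := undup_uniq s.
have As' : A = [set` undup s] by rewrite As; apply/seteqP; split => z /=; rewrite mem_undup.
split => //; rewrite fsbig_seq // -As' esum_fset // => z /set_mem; exact: a0.
Qed.

(** A matrix with more rows than columns has a nonzero row kernel. *)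
Lemma common_kernel (K : fieldType) n (X : eqType) (L : seq X) (phi : X -> 'I_n -> K) :
  (size L < n)%N -> exists2 c : 'I_n -> K, (exists i, c i != 0) &
    {in L, forall x, \sum_i c i * phi x i = 0}.
Proof.
move=> Ln; pose A := \matrix_(i < n, j < size L) phi (tnth (in_tuple L) j) i.
have : kermx A != 0.
  rewrite kermx_eq0 /row_free neq_ltn; apply/orP; left.
  exact: leq_ltn_trans (rank_leq_col A) Ln.
move=> /matrix0Pn[i [k ik]]; exists (fun l => kermx A i l); first by exists k.
move=> x; rewrite -[L]/(tval (in_tuple L)) => /tnthP[j ->].
have : (kermx A *m A) i j = 0 by rewrite mulmx_ker mxE.
rewrite mxE => E; rewrite -[RHS]E; apply: eq_bigr => l _.
by rewrite [A l j]mxE.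
Qed.

(** Names of linear functionals: [None] for the average over the box, [Some i]
for the jump across its halving in direction [i].  Lists of names, unlike lists
of functionals, have decidable membership. *)
Definition code : Type := (option bool * @box R)%type.
Definition read (x : code) (f : T2 -> R) : R :=
  if x.1 is Some i then osc i f x.2 else avg f x.2.

Lemma size_flatten_map (X Y : Type) (F : X -> seq Y) (s : seq X) :
  (size (flatten [seq F z | z <- s]))%:R = \sum_(z <- s) (size (F z))%:R :> R.
Proof.
elim: s => [|z s IH]; first by rewrite big_nil.
by rewrite /= size_cat natrD IH big_cons.
Qed.

(** [32 * eps = 1 / 18] is the share of the energy that the horizontal
averages may use. *)
Lemma block_codes : exists2 K : R, 0 <= K &
  forall V : R * R -> R, potential S V -> (forall z : int, (a_ V z < +oo)%E) ->
  forall z, exists L : seq (bool * @box R), [/\ (size L)%:R <= K * Num.sqrt (fine (a_ V z)),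
        (a_ V z <= (1 / 4000)%:E)%E -> L = [::],
        {in L, forall c, wf c.2 /\ bset c.2 `<=` bset (blk z)} &
        forall f G, ctrl f G (blk z) -> kills f L -> forall D,
          (\int[mu]_(x in bset (blk z)) ((Ecell f hor D (blk z) x - avg f (blk z)) ^+ 2 * Vt V x)%:E
            <= (1 / 18 * gint G (blk z))%:E)%E].
Proof.
have [eps [e0 epsE]] : exists eps : R, 0 < eps /\ 32 * eps = 1 / 18.
  by exists (1 / 576); split; lra.
exists ((2 + 3 / eps) * Num.sqrt 2) => [|V pV afin z].
  by rewrite mulr_ge0 ?sqrtr_ge0 // addr_ge0 // divr_ge0 // ltW.
have a0 : (0 <= a_ V z)%E.
  apply: integral_ge0 => x [xS _]; rewrite lee_fin; apply: mulr_ge0.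
    by rewrite addr_ge0.
  exact: pV.1.
have wz := @wf_blk R z.
have lz : 1 <= len true (@blk R z) by rewrite /len /= subr0; have := pi_ge2 R; lra.
have f0 : 0 <= 2 * fine (a_ V z) by rewrite mulr_ge0 // fine_ge0.
have fE : (a_ V z = (fine (a_ V z))%:E)%E by rewrite fineK // ge0_fin_numE.
have hV : ((len false (blk z))%:E * \int[mu]_(x in bset (blk z)) (Vt V x)%:E <=
    (2 * fine (a_ V z))%:E)%E.
  by rewrite EFinM -fE; exact: int_Vt_blk.
have [L [sL nL bL kL]] := select_line wz lz e0 f0 (measurable_Vt pV) (Vt_ge0 pV) hV.
exists L; split => //.
- by rewrite -mulrA -sqrtrM.
- by rewrite fE lee_fin; move: (fine _) nL => a nL h; apply: nL; lra.
- move=> f G cf kf D; have := kL f G cf kf D.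
  by rewrite epsE.
Qed.

Lemma cell_codes (p : R) : 1 < p -> exists C c : R, [/\ 0 < C, 0 < c &
  forall (V : R * R -> R), potential S V -> (forall j : int, (b_ p V j < +oo)%E) ->
  forall j, exists L : seq (bool * @box R), [/\ (size L)%:R <= C * fine (b_ p V j),
        (b_ p V j <= c%:E)%E -> L = [::],
        {in L, forall c, wf c.2 /\ bset c.2 `<=` bset (cellb j)} &
        forall f G, ctrl f G (cellb j) -> kills f L ->
          (\int[mu]_(x in bset (cellb j)) ((f x - avg f (cellb j)) ^+ 2 * Vt V x)%:E
            <= (1 / 18 * gint G (cellb j))%:E)%E]].
Proof.
move=> p1; have p0 : 0 < p by exact: lt_trans p1.
have e0 : 0 < 1 / 18 :> R by lra.
have [C [c [C0 c0 H]]] := select_cell p1 e0.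
exists C, c; split => // V pV bfin j.
have b0 : (0 <= b_ p V j)%E by exact: poweR_ge0.
have bE : (b_ p V j = (fine (b_ p V j))%:E)%E by rewrite fineK // ge0_fin_numE.
have hV : (\int[mu]_(x in bset (cellb j)) (Vt V x `^ p)%:E <=
    (fine (b_ p V j) `^ p)%:E)%E.
  apply: (le_trans (int_Vt_cell pV j p0)); move: (bfin j); rewrite /b_.
  set I := (\int[_]_(_ in _) _)%E => h.
  have I0 : (0 <= I)%E by apply: integral_ge0 => x _; rewrite lee_fin powR_ge0.
  have Ifin : (I < +oo)%E by apply: lty_poweRy h; rewrite invr_eq0 gt_eqF.
  case: (I) I0 Ifin => // r; rewrite lee_fin => r0 _.
  by rewrite poweR_EFin /= -powRrM mulVf ?gt_eqF // powRr1.
have l1 : len false (@cellb R j) = 1 by rewrite /len /= intrD; ring.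
have l2 : len true (@cellb R j) = pi by rewrite /len /= subr0.
have [L [sL nL bL kL]] := H _ _ _ (wf_cellb j) l1 l2 (measurable_Vt pV) (Vt_ge0 pV)
  (fine_ge0 b0) hV.
by exists L; split => //; rewrite bE lee_fin.
Qed.

End Codes.

(** * Counting the conditions *)

Section Count.
Context {R : realType}.
Notation mu := (leb2 R).
Notation T2 := (measurableTypeR R * measurableTypeR R)%type.
Notation S := (@strip R).
Implicit Types (Q P : @box R).

Definition tagged_osc (L : seq (bool * @box R)) : seq (@code R) :=
  [seq (Some x.1, x.2) | x <- L].

(** The additional condition on each block average is absorbed in
[C * sqrt a_n], since [a_n > c] there. *)
Lemma strip_codes (p : R) : 1 < p -> exists C c : R, [/\ 0 < C, 0 < c &
  forall V : R * R -> R, potential S V ->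
  let A := (\esum_(n in [set n : int | c%:E < a_ V n]) sqrte (a_ V n))%E in
  let B := (\esum_(n in [set n : int | c%:E < b_ p V n]) b_ p V n)%E in
  (A < +oo)%E -> (B < +oo)%E ->
  exists L : seq (@code R), [/\
    ((size L)%:R%:E <= 1 + C%:E * A + C%:E * B)%E,
    {in L, forall x, exists2 I : R * R, I.1 < I.2 & wf x.2 /\ bset x.2 `<=` bset (slab I)} &
    forall f g, L2loc S f -> is_weak_grad S f g ->
      (\int[mu]_(x in S) (g.1 x ^+ 2 + g.2 x ^+ 2)%:E < +oo)%E ->
      {in L, forall x, read x (ext f) = 0} ->
      (\int[mu]_(x in S) (g.1 x ^+ 2 + g.2 x ^+ 2)%:E <=
       \int[mu]_(x in S) (V x * f x ^+ 2)%:E)%E ->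
      {ae mu, forall x, S x -> f x = 0}]].
Proof.
move=> p1; have [C1 [c1 [C10 c10 Hcell]]] := cell_codes p1.
have [K K0 Hblk] := @block_codes R.
pose c := Num.min (1 / 4000) c1.
have c0 : 0 < c by rewrite lt_min c10 andbT; lra.
have cle : c <= 1 / 4000 by rewrite ge_min lexx.
have cle1 : c <= c1 by rewrite ge_min lexx orbT.
have sc0 : 0 < Num.sqrt c by rewrite sqrtr_gt0.
have isc : 0 < (Num.sqrt c)^-1 by rewrite invr_gt0.
pose C := (Num.sqrt c)^-1 + K + C1.
have KC : (Num.sqrt c)^-1 + K <= C by rewrite lerDl ltW.
have C1C : C1 <= C by rewrite lerDr addr_ge0 // ltW.
exists C, c; split => //; first exact: lt_le_trans C1C.
move=> V pV A B Afin Bfin.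
have a0 (z : int) : (0 <= a_ V z)%E.
  apply: integral_ge0 => x [xS _]; rewrite lee_fin; apply: mulr_ge0.
    by rewrite addr_ge0.
  exact: pV.1.
have b0 (j : int) : (0 <= b_ p V j)%E by exact: poweR_ge0.
have sq_lt (z : int) : (c%:E < a_ V z)%E -> ((Num.sqrt c)%:E <= sqrte (a_ V z))%E.
  case: (a_ V z) (a0 z) => [a| |]//; rewrite ?leey // lte_fin lee_fin => a0' h.
  by apply: ler_wsqrtr; rewrite ltW.
have [sA [uA EA SA]] := @esum_lb_finite R _ [set n : int | (c%:E < a_ V n)%E]
  (fun n => sqrte (a_ V n)) _ sc0 sq_lt Afin.
have [sB [uB EB SB]] := @esum_lb_finite R _ [set n : int | (c%:E < b_ p V n)%E]
  (fun n => b_ p V n) _ c0 (fun j h => ltW h) Bfin.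
have inA z : (z \in sA) = (c%:E < a_ V z)%E.
  by apply/idP/idP; have := congr1 (fun X : set int => X z) EA => /= ->.
have inB z : (z \in sB) = (c%:E < b_ p V z)%E.
  by apply/idP/idP; have := congr1 (fun X : set int => X z) EB => /= ->.
have afin (z : int) : (a_ V z < +oo)%E.
  have [h|h] := leP (a_ V z) c%:E; first by rewrite (le_lt_trans h) // ltry.
  have : (sqrte (a_ V z) <= A)%E.
    by apply: esum_ge; exists [set z]; [split => // y ->|rewrite fsbig_set1].
  by move/le_lt_trans => /(_ _ Afin); case: (a_ V z) (a0 z) => // a _ _; rewrite ltry.
have bfin (z : int) : (b_ p V z < +oo)%E.
  have [h|h] := leP (b_ p V z) c%:E; first by rewrite (le_lt_trans h) // ltry.
  apply: le_lt_trans Bfin.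
  by apply: esum_ge; exists [set z]; [split => // y ->|rewrite fsbig_set1].
have [LA HA] := boolp.choice (Hblk V pV afin).
have [LB HB] := boolp.choice (Hcell V pV bfin).
pose FA z : seq (@code R) := (None, blk z) :: tagged_osc (LA z).
pose FB z := tagged_osc (LB z).
exists ((None, blk 0) :: flatten [seq FA z | z <- sA] ++ flatten [seq FB z | z <- sB]).
have inFA z x : z \in sA -> x \in FA z ->
    x \in (None, blk 0) :: flatten [seq FA z | z <- sA] ++ flatten [seq FB z | z <- sB].
  move=> zA xF; rewrite inE mem_cat; apply/orP; right; apply/orP; left.
  by apply/flattenP; exists (FA z) => //; exact: map_f.
have inFB z x : z \in sB -> x \in FB z ->
    x \in (None, blk 0) :: flatten [seq FA z | z <- sA] ++ flatten [seq FB z | z <- sB].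
  move=> zA xF; rewrite inE mem_cat; apply/orP; right; apply/orP; right.
  by apply/flattenP; exists (FB z) => //; exact: map_f.
split.
- rewrite /= size_cat -addn1 !natrD !size_flatten_map /A /B SA SB.
  have -> : (\sum_(z <- sA) sqrte (a_ V z) = (\sum_(z <- sA) Num.sqrt (fine (a_ V z)))%:E)%E.
    rewrite -sumEFin; apply: eq_bigr => z _.
    by case: (a_ V z) (a0 z) (afin z).
  have -> : (\sum_(z <- sB) b_ p V z = (\sum_(z <- sB) fine (b_ p V z))%:E)%E.
    rewrite -sumEFin; apply: eq_bigr => z _.
    by rewrite fineK // ge0_fin_numE.
  rewrite -!EFinM -!EFinD lee_fin [leLHS]addrC addrA; apply: lerD; first apply: lerD => //.
    rewrite mulr_sumr big_seq [leRHS]big_seq; apply: ler_sum => z zA.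
    rewrite /FA /= /tagged_osc size_map -addn1 natrD.
    have [sz _ _ _] := HA z; apply: (le_trans (lerD sz (lexx _))).
    set s := Num.sqrt _; have h1 : 1 <= (Num.sqrt c)^-1 * s.
      rewrite mulrC ler_pdivlMr // mul1r; have := zA; rewrite inA => /sq_lt.
      by rewrite /s; case: (a_ V z) (a0 z) (afin z) => // a _ _; rewrite lee_fin.
    have s0 : 0 <= s by exact: sqrtr_ge0.
    apply: le_trans (ler_wpM2r s0 KC).
    by rewrite mulrDl addrC lerD2r.
  rewrite mulr_sumr; apply: ler_sum => z _; rewrite /FB /tagged_osc size_map.
  have [sz _ _ _] := HB z; apply: (le_trans sz); apply: ler_wpM2r; last exact: C1C.
  exact: fine_ge0.
- have sl z : exists2 I : R * R, I.1 < I.2 & @blk R z = slab I.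
    by rewrite blkE; eexists; [|reflexivity]; rewrite /= ltr_int ltrDl exprn_gt0.
  have slB j : exists2 I : R * R, I.1 < I.2 & @cellb R j = slab I.
    by rewrite /cellb; eexists; [|reflexivity]; rewrite /= ltr_int ltzD1.
  have bl z : exists2 I : R * R, I.1 < I.2 & wf (@blk R z) /\ bset (blk z) `<=` bset (slab I).
    have [I I0 E] := sl z; exists I => //; split; first exact: wf_blk.
    by rewrite E.
  move=> x; rewrite inE => /orP[/eqP -> /=|]; first exact: bl.
  rewrite mem_cat => /orP[] /flattenP[? /mapP[z zs ->]].
    rewrite inE => /orP[/eqP -> /=|]; first exact: bl.
    move=> /mapP[y yL ->] /=; have [_ _ /(_ y yL)[w1 w2] _] := HA z.
    by have [I I0 E] := sl z; exists I => //; split => //; rewrite -E.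
  move=> /mapP[y yL ->] /=; have [_ _ /(_ y yL)[w1 w2] _] := HB z.
  by have [I I0 E] := slB z; exists I => //; split => //; rewrite -E.
move=> f g f2 fg dfin kill.
have ctr I : I.1 < I.2 -> ctrl (ext f) (grad2 g) (slab I).
  by case: I => a b; exact: strip_ctrl.
have kA z : kills (ext f) (LA z).
  have [zA|zA] := boolP (z \in sA).
    move=> y yL; apply: (kill (Some y.1, y.2)); apply: (inFA z) => //.
    by rewrite inE; apply/orP; right; apply/mapP; exists y.
  have [_ nil _ _] := HA z; have -> : LA z = [::]; last by [].
  by apply: nil; apply: (@le_trans _ _ c%:E); [rewrite leNgt -inA|rewrite lee_fin].
have kB z : kills (ext f) (LB z).
  have [zA|zA] := boolP (z \in sB).
    move=> y yL; apply: (kill (Some y.1, y.2)); apply: (inFB z) => //.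
    by apply/mapP; exists y.
  have [_ nil _ _] := HB z; have -> : LB z = [::]; last by [].
  by apply: nil; apply: (@le_trans _ _ c%:E); [rewrite leNgt -inB|rewrite lee_fin].
apply: null_energy_eq0 => //.
- move=> j; have [_ _ _ H] := HB j; apply: H => //; apply: ctr.
  by rewrite /= ltr_int ltzD1.
- move=> z D; have [_ _ _ H] := HA z; apply: H => //; rewrite blkE; apply: ctr.
  by rewrite /= ltr_int ltrDl exprn_gt0.
- by apply: (kill (None, blk 0)); rewrite inE eqxx.
- move=> z; have [zA|zA] := boolP (z \in sA).
    by left; apply: (kill (None, blk z)); apply: (inFA z); rewrite // inE eqxx.
  by right; apply: (@le_trans _ _ c%:E); [rewrite leNgt -inA|rewrite lee_fin].
Qed.

End Count.

(** * Dimension count *)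

Section Linear.
Context {R : realType}.
Notation mu := (leb2 R).
Notation T2 := (measurableTypeR R * measurableTypeR R)%type.
Notation S := (@strip R).
Implicit Types (Q P : @box R).

Section Combination.
Variables (n : nat) (c : 'I_n -> R) (h : 'I_n -> T2 -> R).

Let comb (s : seq 'I_n) (y : T2) : R := \sum_(i <- s) c i * h i y.

Let avg_comb Q : (forall i, mu.-integrable (bset Q) (EFin \o h i)) ->
  avg (fun y => \sum_i c i * h i y) Q = \sum_i c i * avg (h i) Q.
Proof.
move=> ih; have mQ := measurable_bset Q.
have iZ i : mu.-integrable (bset Q) (EFin \o (fun y => c i * h i y)).
  exact: (integrableZl mQ (c i) (ih i)).
have H s : mu.-integrable (bset Q) (EFin \o comb s) /\
    \int[mu]_(y in bset Q) comb s y = \sum_(i <- s) c i * \int[mu]_(y in bset Q) h i y.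
  elim: s => [|i s [IH1 IH2]].
    have -> : comb [::] = fun=> 0 by apply/funext => y; rewrite /comb big_nil.
    by split; [exact: integrable0|rewrite big_nil /Rintegral integral0].
  have -> : comb (i :: s) = fun y => c i * h i y + comb s y.
    by apply/funext => y; rewrite /comb big_cons.
  split; first exact: (integrableD mQ (iZ i) IH1).
  by rewrite RintegralD // IH2 big_cons (RintegralZl (c i) mQ (ih i)).
have [_ E] := H (index_enum 'I_n); rewrite /avg [X in X / _]E mulr_suml.
by apply: eq_bigr => i _; rewrite mulrA.
Qed.

Lemma read_comb (x : @code R) : wf x.2 -> (forall i, mu.-integrable (bset x.2) (EFin \o h i)) ->
  read x (fun y => \sum_i c i * h i y) = \sum_i c i * read x (h i).
Proof.
case: x => [[i|] Q] /= wQ ih; last exact: avg_comb.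
have iH s j : mu.-integrable (bset (halve i s Q)) (EFin \o h j).
  by apply: integrable_sub (ih j); exact: sub_halve.
rewrite /read /osc /jump /= !avg_comb; [|exact: iH|exact: iH].
by rewrite -sumrB; apply: eq_bigr => j _; rewrite mulrBr.
Qed.

End Combination.

Lemma subspace_sum (W : set (R * R -> R)) n (c : 'I_n -> R) (h : 'I_n -> R * R -> R) :
  linear_subspace W -> (forall i, W (h i)) -> W (fun x => \sum_i c i * h i x).
Proof.
move=> [W0 WD] Wh; elim: (index_enum _) => [|i s IH].
  have -> : (fun x => \sum_(i <- [::]) c i * h i x) = cst 0.
    by apply/funext => x; rewrite big_nil.
  exact: W0.
have -> : (fun x => \sum_(i <- i :: s) c i * h i x) =
    fun x => c i * h i x + \sum_(i <- s) c i * h i x.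
  by apply/funext => x; rewrite big_cons.
exact: WD.
Qed.

Lemma ext_comb n (c : 'I_n -> R) (h : 'I_n -> R * R -> R) :
  ext (fun x => \sum_i c i * h i x) = fun x => \sum_i c i * ext (h i) x.
Proof.
apply/funext => x; rewrite /ext /patch; case: ifP => // _.
by rewrite big1 // => i _; rewrite mulr0.
Qed.

(** More free functions than conditions would have a nontrivial combination
satisfying all of them. *)
Lemma ae_dim_le (V : R * R -> R) (W : set (R * R -> R)) (L : seq (@code R)) :
    linear_subspace W -> W `<=` form_domain V S ->
    {in L, forall x, exists2 I : R * R, I.1 < I.2 & wf x.2 /\ bset x.2 `<=` bset (slab I)} ->
    (forall f, W f -> {in L, forall x, read x (ext f) = 0} ->
      {ae mu, forall x, S x -> f x = 0}) ->
  (ae_dim S W <= (size L)%:R%:E)%E.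
Proof.
move=> lW WV Lslab Wkill; apply: ub_ereal_sup => _ [n [h [Wh hfree]] <-].
rewrite lee_fin ler_nat leqNgt; apply/negP => Ln.
have [c [i ci] Hc] := common_kernel (fun x j => read x (ext (h j))) Ln.
move/eqP: ci; apply; apply: hfree.
apply: (Wkill _ (subspace_sum c lW Wh)) => x xL.
rewrite ext_comb read_comb; first exact: Hc.
- by have [I _ []] := Lslab x xL.
move=> j; have [[a b] ab [_ xI]] := Lslab x xL.
have [h2 hg hd _] := WV _ (Wh j).
by apply: integrable_sub xI _; have [] := strip_ctrl h2 hg hd ab.
Qed.

End Linear.

Theorem theorem7p9 (R : realType) (p : R) (hp : 1 < p) :
  exists C c : R, 0 < C /\ 0 < c /\
    forall V : R * R -> R, potential (@strip R) V ->
      (Neg V (@strip R) <=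
         1 + C%:E * (\esum_(n in [set n : int | c%:E < a_ V n]) sqrte (a_ V n))
           + C%:E * (\esum_(n in [set n : int | c%:E < b_ p V n]) b_ p V n))%E.
Proof.
have [C [c [C0 c0 H]]] := strip_codes hp.
exists C, c; split => //; split => // V pV; have := H V pV.
set A := (\esum_(n in _) sqrte _)%E; set B := (\esum_(n in _) b_ p V n)%E => /= {}H.
have A0 : (0 <= A)%E by apply: esum_ge0 => z _; exact: sqrte_ge0.
have B0 : (0 <= B)%E by apply: esum_ge0 => z _; exact: poweR_ge0.
have [Ay|Afin] := eqVneq A +oo%E.
  rewrite Ay gt0_muley ?lte_fin // addey // addye ?leey //.
  by rewrite gt_eqF // (lt_le_trans ltNy0) // mule_ge0 // lee_fin ltW.
have [By|Bfin] := eqVneq B +oo%E.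
  rewrite By gt0_muley ?lte_fin // addey ?leey //.
  by rewrite gt_eqF // (lt_le_trans ltNy0) // adde_ge0 // mule_ge0 // lee_fin ltW.
have [||L [sL Lslab kL]] := H; [by rewrite ltey|by rewrite ltey|].
apply: le_trans sL; apply: ub_ereal_sup => _ [W [lW WV We] <-].
apply: (ae_dim_le lW WV Lslab) => f Wf kill.
have [f2 fg fd fp] := WV f Wf.
apply: (kL f (wgrad (@strip R) f)) => //.
have P0 : (0 <= potential_energy V (@strip R) f)%E.
  by apply: integral_ge0 => x xS; rewrite lee_fin mulr_ge0 ?sqr_ge0 // pV.1.
have := We f Wf; rewrite /energy leeBlDr ?add0e //.
by rewrite ge0_fin_numE.
Qed.
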